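(* Let $G\subset\mathbb{O}$ be a domain. Suppose that $f_n:G\to\mathbb{O}$ $(n\in\mathbb{N})$ is a normally convergent sequence of left $\mathbb{O}$-regular functions (respectively, of right $\mathbb{O}$-regular functions) with $f_n(z)\neq0$ for all $z\in G$ and each $n\in\mathbb{N}$. Then the limit function $f(z):=\lim_{n\to\infty}f_n(z)$ has the property that either $$ \sum_{c\in G}\operatorname{ord}(f;c)=0 $$ or $f$ vanishes identically over $G$.
   Context: $\mathbb{O}$ denotes the octonions: the $8$-dimensional real non-associative normed division algebra with basis $1=e_0,e_1,\dots,e_7$, where $e_i^2=-1$ for $i\geq 1$, $e_ie_j=-e_je_i$ for distinct $i,j\ge 1$, and $e_ie_j=e_k$ for $(i,j,k)$ any cyclic permutation of one of $(1,2,4),(1,3,5),(2,3,6),(4,3,7),(1,7,6),(2,5,7),(4,6,5)$. An octonion is written $z=\sum_{i=0}^7 x_ie_i$ with $x_i\in\mathbb{R}$, so $\mathbb{O}\cong\mathbb{R}^8$; $\overline z=x_0-\sum_{i=1}^7x_ie_i$ and $|z|^2=\sum_{i=0}^7 x_i^2$. $B(c,\varepsilon)=\{z:|z-c|<\varepsilon\}$ and $\overline B(c,\varepsilon)$ is its closure. Boundaries are oriented by the outward normal. Normal convergence means uniform convergence on compact subsets of $G$. A real differentiable function $f$ from an open subset of $\mathbb{O}$ to $\mathbb{O}$ is left $\mathbb{O}$-regular if $\mathcal{D}f:=\sum_{i=0}^7 e_i\frac{\partial f}{\partial x_i}=0$, and right $\mathbb{O}$-regular if $f\mathcal{D}:=\sum_{i=0}^7\frac{\partial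 f}{\partial x_i}e_i=0$. $q_{\mathbf 0}(z):=\overline z/|z|^8$ for $z\neq0$, and $d\sigma(z):=\sum_{i=0}^7(-1)^i e_i\,\widehat{dx_i}$ with $\widehat{dx_i}=dx_0\wedge\cdots\wedge dx_{i-1}\wedge dx_{i+1}\wedge\cdots\wedge dx_7$. For an isolated zero $c$ of $f$, choose $\varepsilon>0$ such that $\overline B(c,\varepsilon)$ lies in the domain of $f$ and $f\ne0$ on $\overline B(c,\varepsilon)\setminus\{c\}$, and set $$\operatorname{ord}(f;c):=\frac{3}{\pi^4}\int_{f(\partial B(c,\varepsilon))}q_{\mathbf 0}(w)\,d\sigma(w)$$ in the left regular case, respectively $\frac{3}{\pi^4}\int_{f(\partial B(c,\varepsilon))}d\sigma(w)\,q_{\mathbf 0}(w)$ in the right regular case, where the integral is over the image $7$-cycle of the sphere (i.e. the integral over $\partial B(c,\varepsilon)$ of the pullback of the form under $f$). At points $c$ with $f(c)\neq0$ one has $\operatorname{ord}(f;c)=0$. The order of a point is defined only in these two cases, and the sum $\sum_{c\in G}\operatorname{ord}(f;c)$ extends over the points $c\in G$ at which it is defined, so that only isolated zeroes of $f$ can contribute. *)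

(* Defs.v *)
From HB Require Import structures.
From mathcomp Require Import all_boot all_order all_algebra.
From mathcomp Require Import all_classical all_reals all_analysis.
From mathcomp Require summability.

Set Implicit Arguments.
Unset Strict Implicit.
Unset Printing Implicit Defensive.

Import Order.TTheory GRing.Theory Num.Theory.
Import numFieldNormedType.Exports.

Local Open Scope classical_set_scope.
Local Open Scope ring_scope.

(* An octonion [z] is the row vector of its coordinates in [e_0, ..., e_7].
   The library norm [`|z|] on row vectors is the sup norm; it gives the same
   topology and uniformity as the octonion norm [onorm], which is the one used
   wherever a norm of octonions enters a formula. *)
Notation octonion R := 'rV[R]_8.

Section Octonions.
Context {R : realType}.
Local Notation O := (octonion R).

Definition oe (i : 'I_8) : O := delta_mx 0 i.

Definition fano : seq (nat * nat * nat) :=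
  [:: (1, 2, 4); (1, 3, 5); (2, 3, 6); (4, 3, 7);
      (1, 7, 6); (2, 5, 7); (4, 6, 5)]%N.

Definition fano_cyclic (i j k : nat) : bool :=
  [|| (i, j, k) \in fano, (j, k, i) \in fano | (k, i, j) \in fano].

(* The coefficient of [e_k] in the product [e_i e_j]. *)
Definition ostruct (i j k : nat) : R :=
  if i == 0%N then (j == k)%:R
  else if j == 0%N then (i == k)%:R
  else if i == j then - (k == 0%N)%:R
  else (fano_cyclic i j k)%:R - (fano_cyclic j i k)%:R.

Definition omul (x y : O) : O :=
  \row_k \sum_(i < 8) \sum_(j < 8) x 0 i * y 0 j * ostruct i j k.

Definition oconj (z : O) : O :=
  z 0 0 *: oe 0 - \sum_(i < 8 | i != 0) z 0 i *: oe i.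

Definition onorm (z : O) : R := Num.sqrt (\sum_(i < 8) z 0 i ^+ 2).

Definition oball (c : O) (eps : R) : set O := [set z | onorm (z - c) < eps].

Definition domain (G : set O) : Prop := [/\ open G, connected G & G !=set0].

Definition left_regular (G : set O) (f : O -> O) : Prop :=
  forall z, G z ->
    differentiable f z /\ \sum_(i < 8) omul (oe i) ('D_(oe i) f z) = 0.

Definition right_regular (G : set O) (f : O -> O) : Prop :=
  forall z, G z ->
    differentiable f z /\ \sum_(i < 8) omul ('D_(oe i) f z) (oe i) = 0.

Definition normally_cvg (G : set O) (f_ : nat -> O -> O) (f : O -> O) : Prop :=
  forall K : set O, compact K -> K `<=` G -> {uniform K, f_ @ \oo --> f}.

(* An octonion-valued 7-form is given by its value at a point on 7 tangent
   vectors, the rows of a 7 x 8 matrix.  The form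
   [dx_0 /\ .. /\ dx_(i-1) /\ dx_(i+1) /\ .. /\ dx_7] sends them to the minor
   with column [i] deleted. *)
Definition oform := O -> 'M[R]_(7, 8) -> O.

Definition dsigma (V : 'M[R]_(7, 8)) : O :=
  \sum_(i < 8) ((-1) ^+ i * \det (col' i V)) *: oe i.

Definition q0 (w : O) : O := (onorm w ^+ 8)^-1 *: oconj w.

Definition q0_dsigma : oform := fun w V => omul (q0 w) (dsigma V).

Definition dsigma_q0 : oform := fun w V => omul (dsigma V) (q0 w).

Fixpoint iterated_integral (D : seq (set R)) (F : seq R -> R) : R :=
  if D is A :: D' then
    \int[lebesgue_measure]_(t in A) iterated_integral D' (fun s => F (t :: s))
  else F [::].

(* [0, pi]^6 x [0, 2 pi] *)
Definition angle_box : seq (set R) :=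
  rcons (nseq 6 `[0, pi]%classic) `[0, 2 * pi]%classic.

(* The integral of [omega] over the singular 7-chain [gamma], parametrised by
   [angle_box]: the integral over the box of the pullback of [omega], that is
   of [omega] at [gamma t] on the partial derivatives of [gamma] at [t]. *)
Definition chain_integral (omega : oform) (gamma : 'rV[R]_7 -> O) : O :=
  \row_(k < 8) iterated_integral angle_box (fun s =>
    let t : 'rV[R]_7 := \row_(j < 7) nth 0 s j in
    omega (gamma t) (\matrix_(j < 7) 'D_(delta_mx 0 j) gamma t) 0 k).

(* Hyperspherical coordinates
   (cos t_0, sin t_0 cos t_1, .., sin t_0 .. sin t_5 cos t_6,
    sin t_0 .. sin t_6).
   The determinant with rows [usphere t] and then the 7 partial derivatives at
   [t] is sin^6 t_0 sin^5 t_1 .. sin t_5 >= 0 on [angle_box], so the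
   parametrised unit sphere is oriented by the outward normal. *)
Definition usphere (t : 'rV[R]_7) : O :=
  \row_(i < 8) ((\prod_(j < 7 | (j < i)%N) sin (t 0 j)) *
                (if (i < 7)%N then cos (t 0 (inord i)) else 1)).

Definition sphere (c : O) (eps : R) (t : 'rV[R]_7) : O := c + eps *: usphere t.

Definition isolated_zero (G : set O) (f : O -> O) (c : O) : Prop :=
  [/\ G c, f c = 0 & \forall z \near c^', f z != 0].

Definition ord_radius (G : set O) (f : O -> O) (c : O) : set R :=
  [set eps | [/\ 0 < eps, closure (oball c eps) `<=` G &
     forall z, closure (oball c eps) z -> z != c -> f z != 0]].

Definition ord_wrt (omega : oform) (G : set O) (f : O -> O) (c : O) : O :=
  if f c != 0 then 0
  else let eps := xget 1 (ord_radius G f c) in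
       (3 / pi ^+ 4) *: chain_integral omega (f \o sphere c eps).

(* The order is meaningful on [ord_dom G f] only. *)
Definition ord_dom (G : set O) (f : O -> O) : set O :=
  [set c | G c /\ (f c != 0 \/ isolated_zero G f c)].

Definition left_ord := ord_wrt q0_dsigma.
Definition right_ord := ord_wrt dsigma_q0.

(* Unconditional summation over a possibly infinite set [A]: the finite partial
   sums converge to [s] along the directed set of finite subsets. *)
Definition sums_to (A : set O) (F : O -> O) (s : O) : Prop :=
  summability.partial_sum (patch (fun=> 0) A F) @ summability.totally --> s.

Lemma coord_le_onorm (z : O) i : `|z 0 i| <= onorm z.
Proof.
rewrite -sqrtr_sqr ler_sqrt; last by apply: sumr_ge0 => j _; exact: sqr_ge0.
by rewrite (bigD1 i)//= lerDl sumr_ge0// => j _; exact: sqr_ge0.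
Qed.

Lemma norm_le_onorm (z : O) : `|z| <= onorm z.
Proof.
rewrite [leLHS]mx_normrE; apply: bigmax_le => [|[i j] _]; first exact: sqrtr_ge0.
by rewrite (ord1 i) coord_le_onorm.
Qed.

Lemma closure_oball_sub (c : O) eps :
  0 < eps -> closure (oball c eps) `<=` closed_ball c eps.
Proof.
move=> e0; apply: closureS => z; rewrite /oball /= => h.
by rewrite -ball_normE /= distrC; apply: le_lt_trans h; exact: norm_le_onorm.
Qed.

Lemma ord_radius_neq0 (G : set O) (f : O -> O) (c : O) :
  open G -> isolated_zero G f c -> ord_radius G f c !=set0.
Proof.
move=> oG [Gc _ fc].
have : \forall z \near c, G z /\ (z != c -> f z != 0).
  have nG : nbhs c G by exact: open_nbhs_nbhs.
  by move: fc; rewrite /dnbhs /within/= => fc; near=> z; split;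
    [near: z|near: z].
move=> /nbhs_closedballP[e he]; exists e%:num; split=> //.
- by move=> z /closure_oball_sub /(_ _) h; case: (he z (h _)).
- by move=> z /closure_oball_sub /(_ _) h; case: (he z (h _)).
Unshelve. all: by end_near.
Qed.

End Octonions.

(* Main.v *)
(* Every order [ord(f; c)] vanishes, so the first alternative always holds.

   Each [f_n] is smoothed without leaving the class of regular functions: by
   Goursat's bisection argument the flux of a merely differentiable regular
   function through the faces of a cube is zero, and this flux is, up to the
   volume, the Dirac operator applied to the average over translates of the
   cube.  Averaging twice gives a function [h_n] of class C^2, still zero free
   and close to [f_n], with harmonic coordinates.

   As [h_n] has no zero in the ball, the closed form [q_0 dsigma] pulls back to
   a closed form on the ball, and shrinking the radius to 0 gives integral 0.

   By the interior gradient estimate for harmonic functions, uniform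
   convergence of the [h_n] to [f] near the sphere gives uniform convergence of
   their gradients, so the integral of [f] is the limit of zero integrals. *)

Require Import Defs.
From mathcomp Require Import all_boot all_order all_algebra.
From mathcomp Require Import all_classical all_reals all_analysis.
From mathcomp Require Import fingroup perm ring lra.
Import Order.TTheory GRing.Theory Num.Theory.
Import numFieldNormedType.Exports.
Set Implicit Arguments.
Unset Strict Implicit.
Unset Printing Implicit Defensive.
Local Open Scope classical_set_scope.
Local Open Scope ring_scope.

(** * Oriented integrals of continuous functions *)

(** Regularity supplies plain differentiability only, whereas closedness of a pulled-back form
    involves second derivatives; hence the detour through [C^2] approximants. The kernel of the
    smoothing is the indicator of a cube because the divergence of such an average is exactly the
    flux that Goursat's argument controls.

    The product enters through real coordinates alone: multiplication by [e_i] is a matrix [L i]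
    with [L i *m (L j)^T + L j *m (L i)^T] twice the identity for [i = j] and zero otherwise, and
    each coordinate of the 7-form is given by an array [b] whose symmetric part is scalar. So
    associativity never arises, and the left and right cases differ only in [L] and [b].

    Functions on [G] are extended to the whole space by a radial retraction onto a ball, which lets
    all notions of smoothness be global. Integrals are iterated integrals of continuous functions,
    one variable at a time, so that the fundamental theorem of calculus in one variable takes the
    place of Stokes' theorem. *)

Section OrientedIntegral.
Context {R : realType}.
Implicit Types (g : R -> R) (a b c x y : R).
Local Notation mu := lebesgue_measure.

Lemma is_derive_continuous g x d : is_derive x 1 g d -> {for x, continuous g}.
Proof.
by move=> H; apply: differentiable_continuous; apply/derivable1_diffP; exact: ex_derive.
Qed.

Lemma is_derive0_cst g : (forall x, is_derive x 1 g 0) -> forall x y, g x = g y.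
Proof.
move=> dg.
suff H a b : a <= b -> g a = g b.
  by move=> x y; have [/H//|/ltW /H ->] := leP x y.
move=> ab; have [|c _] := @MVT_segment R g (fun=> 0) a b ab (fun x _ => dg x).
  by apply: continuous_subspaceT => x; exact: is_derive_continuous (dg x).
by rewrite mul0r => /eqP; rewrite subr_eq0 => /eqP.
Qed.

Lemma continuous_integrable g a b : continuous g ->
  mu.-integrable `[a, b] (EFin \o g).
Proof.
move=> cg; apply: continuous_compact_integrable; first exact: segment_compact.
exact: continuous_subspaceT.
Qed.

(** At most one of the two intervals has positive length, so this is the oriented integral from 0 to
    [y], an antiderivative of a continuous [g] on the whole line. *)
Definition prim g y := \int[mu]_(t in `[0, y]) g t - \int[mu]_(t in `[y, 0]) g t.

(** Integrating from a point [a] to the left of both 0 and [y] changes the primitive by a constant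
    only, and gives the form to which the fundamental theorem for a fixed left end applies. *)
Lemma primE g a y : continuous g -> a < 0 -> a < y ->
  prim g y = \int[mu]_(t in `[a, y]) g t - \int[mu]_(t in `[a, 0]) g t.
Proof.
move=> cg a0 ay; rewrite /prim.
have itvB x z : a < x -> x <= z -> \int[mu]_(t in `[a, z]) g t -
    \int[mu]_(t in `[a, x]) g t = \int[mu]_(t in `[x, z]) g t.
  move=> ax xz; rewrite Rintegral_itvB ?bnd_simp ?(ltW ax)//; last first.
    exact: continuous_integrable.
  rewrite Rintegral_itv_obnd_cbnd//.
  apply: integrableS (continuous_integrable x z cg) => //.
  exact: subset_itv_oc_cc.
have int0 x z : z <= x -> \int[mu]_(t in `[x, z]) g t = 0.
  rewrite le_eqVlt => /predU1P[->|zx]; first by rewrite set_itv1 Rintegral_set1.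
  by rewrite set_itv_ge ?bnd_simp -?ltNge// Rintegral_set0.
have [y0|y0] := leP y 0.
  by rewrite (int0 0)// sub0r -(itvB y 0)// opprB.
by rewrite (int0 y 0 (ltW y0)) subr0 itvB// ltW.
Qed.

Lemma is_derive_prim g y : continuous g -> is_derive y 1 (prim g) (g y).
Proof.
move=> cg; set a := Num.min y 0 - 1.
have a0 : a < 0 by rewrite /a ltrBlDr add0r gt_min ltr01 orbT.
have ay : a < y by rewrite /a ltrBlDr gt_min ltrDl ltr01.
have [||||d e] := @continuous_FTC1_closed R g a y (y + 1); rewrite ?ltrDl//.
- exact: continuous_integrable.
- exact: cg.
have : is_derive y 1 (fun x => \int[mu]_(t in `[a, x]) g t - \int[mu]_(t in `[a, 0]) g t)
   (g y - 0).
  apply: is_deriveB; rewrite -e derive1E; exact: derivableP.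
rewrite subr0; apply: near_eq_is_derive.
near=> x; rewrite /= (@primE _ a)//; near: x; exact: lt_nbhsr.
Unshelve. all: by end_near.
Qed.

Definition oint g a b := prim g b - prim g a.

Lemma is_derive_oint g a y : continuous g -> is_derive y 1 (oint g a) (g y).
Proof.
move=> cg; have := is_derive_prim y cg => H.
have -> : g y = g y - 0 by rewrite subr0.
by apply: is_deriveB.
Qed.

Lemma ointaa g a : oint g a a = 0. Proof. exact: subrr. Qed.

Lemma oint_chasles g a b c : oint g a c = oint g a b + oint g b c.
Proof. by rewrite /oint; ring. Qed.

Lemma ointP g G a b : continuous g -> (forall x, is_derive x 1 G (g x)) ->
  oint g a b = G b - G a.
Proof.
move=> cg dG.
have : oint g a b - G b = oint g a a - G a.
  apply: (@is_derive0_cst (oint g a \- G)) => x.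
  have := is_derive_oint a x cg => H; have := dG x => H'.
  by rewrite -(subrr (g x)); apply: is_deriveB.
by rewrite ointaa => /eqP; rewrite sub0r subr_eq addrC => /eqP ->.
Qed.

Lemma RintegralE g a b : continuous g -> a <= b ->
  \int[mu]_(t in `[a, b]) g t = oint g a b.
Proof.
move=> cg; rewrite le_eqVlt => /predU1P[->|ab].
  by rewrite set_itv1 Rintegral_set1 ointaa.
rewrite /Rintegral (@continuous_FTC2 _ g (prim g))//.
- exact: continuous_subspaceT.
- have c x := is_derive_continuous (is_derive_prim x cg).
  split.
  + by move=> x _; have := is_derive_prim x cg => H; exact: ex_derive.
  + exact/cvg_at_right_filter/c.
  + exact/cvg_at_left_filter/c.
- by move=> x _; have := is_derive_prim x cg => H; rewrite derive1E derive_val.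
Qed.

Lemma oint_lin (k l : R) f g a b : continuous f -> continuous g ->
  oint (fun x => k * f x + l * g x) a b = k * oint f a b + l * oint g a b.
Proof.
move=> cf cg.
have c : continuous (fun x => k * f x + l * g x).
  by move=> x; apply: cvgD; apply: cvgM; [exact: cvg_cst|exact: cf|exact: cvg_cst|exact: cg].
have dG x : is_derive x 1 (fun y => k * prim f y + l * prim g y) (k * f x + l * g x).
  by apply: is_deriveD; apply: is_deriveZ; exact: is_derive_prim.
by rewrite (ointP _ _ c dG) /oint; ring.
Qed.

Lemma oint_shift g a b c : continuous g ->
  oint (fun x => g (x + c)) a b = oint g (a + c) (b + c).
Proof.
move=> cg.
have cc : continuous (fun x => g (x + c)).
  by move=> x; apply: continuous_comp; [apply: cvgD; [exact: cvg_id|exact: cvg_cst]|exact: cg].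
have dG x : is_derive x 1 (fun y => prim g (y + c)) (g (x + c)).
  rewrite -[g _]mulr1; apply: (@is_derive1_comp R (prim g) (fun y => y + c)).
    exact: is_derive_prim.
  by rewrite -[X in is_derive _ _ _ X]addr0; apply: is_deriveD.
exact: ointP cc dG.
Qed.

Lemma oint_cst k a b : oint (fun=> k) a b = k * (b - a).
Proof.
have dG x : is_derive x 1 (fun x => k * x) k.
  by rewrite -[X in is_derive _ _ _ X]mulr1; exact: is_deriveZ.
by rewrite mulrBr; exact: ointP (@cst_continuous _ _ k) dG.
Qed.

Lemma oint_sub f g a b : continuous f -> continuous g ->
  oint (fun x => f x - g x) a b = oint f a b - oint g a b.
Proof.
move=> cf cg; rewrite -[oint f a b]mul1r -mulN1r -oint_lin//; congr (oint _ a b).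
by apply/funext => x; ring.
Qed.

Lemma oint_le g a b C : continuous g -> a <= b ->
  (forall x, a <= x <= b -> `|g x| <= C) -> `|oint g a b| <= C * (b - a).
Proof.
move=> cg ab H.
have [|c cab e] := @MVT_segment R (prim g) g a b ab (fun x _ => is_derive_prim x cg).
  apply: continuous_subspaceT => x; exact: is_derive_continuous (is_derive_prim x cg).
by rewrite /oint e normrM (ger0_norm (_ : 0 <= b - a)) ?subr_ge0// ler_wpM2r ?subr_ge0 ?H.
Qed.

Lemma eq_oint f g a b : (forall x, f x = g x) -> oint f a b = oint g a b.
Proof. by move=> /funext ->. Qed.

End OrientedIntegral.

(** * Integrals depending on a parameter *)

Section ParametricIntegral.
Context {R : realType}.

Lemma continuous_pair (T U V : topologicalType) (f : T -> U) (g : T -> V) :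
  continuous f -> continuous g -> continuous (fun x => (f x, g x)).
Proof. by move=> cf cg x; exact: (cvg_pair (cf x) (cg x)). Qed.

Lemma continuous_comp_fun (T U V : topologicalType) (f : T -> U) (g : U -> V) :
  continuous f -> continuous g -> continuous (fun x => g (f x)).
Proof. by move=> cf cg x; exact: continuous_comp (cf x) (cg (f x)). Qed.

(** Compactness of [[a, b]] makes continuity in the parameter uniform in [s]. *)
Lemma tube (T : topologicalType) (F : T -> R -> R) (a b : R) x e :
  continuous (fun p : T * R => F p.1 p.2) -> 0 < e ->
  \forall y \near x, forall s, a <= s <= b -> `|F y s - F x s| <= e.
Proof.
move=> cF e0.
have /compact_near_coveringP := @segment_compact R a b.
move=> /(_ T (nbhs x) (fun y s => `|F y s - F x s| <= e) _).
have H s : `[a, b]%classic s -> \forall s' \near s & i \near x, `|F i s' - F x s'| <= e.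
  move=> _; have e20 : 0 < e / 2 by rewrite divr_gt0.
  have /cvgrPdist_lt/(_ _ e20) := cF (x, s).
  case=> -[A B] /= [nA nB] sAB; exists (B, A) => //= -[t y] [/= Bt Ay].
  have h1 := sAB (y, t) (conj Ay Bt); have h2 := sAB (x, t) (conj (nbhs_singleton nA) Bt).
  rewrite -(subrKA (F x s)) (le_trans (ler_normD _ _))// (splitr e).
  by rewrite lerD ?(ltW h2)// distrC ltW.
move=> /(_ H); apply: filterS => y Hy s sab; apply: Hy.
by rewrite /= in_itv.
Qed.

Lemma uncurry_continuous2 (T : topologicalType) (F : T -> R -> R) x :
  continuous (fun p : T * R => F p.1 p.2) -> continuous (F x).
Proof.
move=> cF; apply: (@continuous_comp_fun _ _ _ (fun t : R => (x, t)) (fun p => F p.1 p.2) _ cF).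
by apply: continuous_pair => t; [exact: cvg_cst|exact: cvg_id].
Qed.

Lemma oint_continuous (T : topologicalType) (F : T -> R -> R) (a b : R) :
  continuous (fun p : T * R => F p.1 p.2) -> continuous (fun x => oint (F x) a b).
Proof.
move=> cF; wlog ab : a b / a <= b => [H|].
  have [/H//|/ltW /H h x] := leP a b.
  have -> : (fun x => oint (F x) a b) = (fun x => - oint (F x) b a).
    by apply/funext => y; rewrite /oint opprB.
  by apply: cvgN; exact: h.
move=> x; apply/cvgrPdist_le => e e0.
(* The summand 1 covers the case [a = b]. *)
have e1 : 0 < e / (b - a + 1) by rewrite divr_gt0// ltr_wpDl// subr_ge0.
apply: filterS (tube a b x cF e1) => y Hy.
have c z : continuous (F z) by exact: uncurry_continuous2.
rewrite distrC -oint_sub//.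
apply: le_trans (oint_le _ ab Hy) _.
  by move=> s; apply: cvgB; exact: c.
rewrite mulrAC ler_pdivrMr ?ltr_wpDl ?subr_ge0// ler_wpM2l ?(ltW e0)//; lra.
Qed.

(** The two difference quotients coincide. Directional derivatives in a normed space are thereby
    reduced to calculus in one variable. *)
Lemma is_derive_line (V W : normedModType R) (f : V -> W) (x v : V) (h : R) (d : W) :
  is_derive h (1 : R) (fun t : R => f (t *: v + x)) d <-> is_derive (h *: v + x) v f d.
Proof.
have E : (fun k : R => k^-1 *: (((fun t : R => f (t *: v + x)) \o shift h) (k *: 1) -
                           f (h *: v + x))) =
   (fun k => k^-1 *: ((f \o shift (h *: v + x)) (k *: v) - f (h *: v + x))).
  by apply/funext => k /=; rewrite [k *: 1]mulr1 scalerDl addrA.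
by split=> -[D <-]; apply: DeriveDef; rewrite /derivable ?/derive -?E// E.
Qed.

Lemma is_derive_line0 (V W : normedModType R) (f : V -> W) (x v : V) (d : W) :
  is_derive (0 : R) (1 : R) (fun t : R => f (t *: v + x)) d <-> is_derive x v f d.
Proof. by have := is_derive_line f x v 0 d; rewrite scale0r add0r. Qed.

Lemma MVT_line (g g' : R -> R) (h : R) : (forall t : R, is_derive t 1 g (g' t)) ->
  exists2 c, `|c| <= `|h| & g h - g 0 = g' c * h.
Proof.
move=> dg; have cg a b : {within `[a, b], continuous g}.
  by apply: continuous_subspaceT => t; exact: is_derive_continuous (dg t).
have [h0|/ltW h0] := leP 0 h.
  have [c /itvP cab ->] := MVT_segment h0 (fun x _ => dg x) (cg _ _).
  by exists c; rewrite ?subr0// !ger0_norm ?cab.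
have [c /itvP cab e] := MVT_segment h0 (fun x _ => dg x) (cg _ _).
exists c; first by rewrite !ler0_norm ?cab ?lerN2 ?cab.
by rewrite -opprB e sub0r mulrN opprK.
Qed.

(** By the mean value theorem along a segment, the difference quotient of [F ^~ s] is a value of
    [F' ^~ s] between [x] and [x + h v]; [tube] bounds its distance to [F' x s] uniformly in [s]. *)
Lemma is_derive_under_oint (V : normedModType R) (F F' : V -> R -> R) (a b : R) x v :
  continuous (fun p : V * R => F p.1 p.2) ->
  continuous (fun p : V * R => F' p.1 p.2) ->
  (forall y s, is_derive y v (F ^~ s) (F' y s)) ->
  is_derive x v (fun y => oint (F y) a b) (oint (F' x) a b).
Proof.
move=> cF cF' dF; wlog ab : a b / a <= b => [H|].
  have [/H//|/ltW /H h] := leP a b.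
  have -> : (fun x => oint (F x) a b) = (fun x => - oint (F x) b a).
    by apply/funext => y; rewrite /oint opprB.
  have -> : oint (F' x) a b = - oint (F' x) b a by rewrite /oint opprB.
  exact: is_deriveN.
suff L : h^-1 *: (((fun y => oint (F y) a b) \o shift x) (h *: v) - oint (F x) a b)
    @[h --> 0^'] --> oint (F' x) a b.
  apply: DeriveDef; first by apply/cvg_ex; exists (oint (F' x) a b).
  exact/cvg_lim.
apply/cvgrPdist_le => e e0.
have e1 : 0 < e / (b - a + 1) by rewrite divr_gt0// ltr_wpDl// subr_ge0.
have T := tube a b x cF' e1.
have cl : (h : R) *: v + x @[h --> (0 : R)] --> x.
  rewrite -[X in _ --> X]add0r; apply: cvgD; last exact: cvg_cst.
  by rewrite -[X in _ --> X](scale0r v); apply: cvgZr_tmp; exact: cvg_id.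
have /cl /nbhs_ballP[r /= r0 Hr] := T.
near=> h.
have h0 : h != 0 by near: h; exact: nbhs_dnbhs_neq.
have hr : `|h| < r by near: h; exact: dnbhs0_lt.
have c y : continuous (F y) by exact: uncurry_continuous2.
have c' y : continuous (F' y) by exact: uncurry_continuous2.
have Q : oint (F' x) a b - h^-1 *: (oint (F (h *: v + x)) a b - oint (F x) a b) =
   oint (fun s => F' x s - h^-1 * (F (h *: v + x) s - F x s)) a b.
  have c1 : continuous (fun s => F (h *: v + x) s - F x s) by move=> s; apply: cvgB; exact: c.
  rewrite -oint_sub// -[_ *: _]/(_ * _) -[X in X - _]mul1r -mulNr -oint_lin//.
  by apply: eq_oint => s; ring.
rewrite /= Q.
apply: le_trans (oint_le (C := e / (b - a + 1)) _ ab _) _.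
- move=> s; apply: cvgB; first exact: c'.
  by apply: cvgM; [exact: cvg_cst|apply: cvgB; exact: c].
- move=> s sab.
  have dl (t : R) : is_derive t 1 (fun t : R => F (t *: v + x) s) (F' (t *: v + x) s).
    exact: (iffRL (is_derive_line (F ^~ s) x v t _) (dF _ s)).
  have [k kh] := MVT_line h dl; rewrite scale0r add0r => ->.
  rewrite mulrCA mulVf// mulr1 distrC; apply: Hr => //.
  by rewrite /ball /= sub0r normrN (le_lt_trans kh).
rewrite mulrAC ler_pdivrMr ?ltr_wpDl ?subr_ge0// ler_wpM2l ?(ltW e0)//; lra.
Unshelve. all: by end_near.
Qed.

End ParametricIntegral.

(** * Functions of class C^k *)

Lemma cvg_row (R : realType) n (T : Type) (D : set_system T) (FF : Filter D)
    (F : T -> 'rV[R]_n) (l : 'rV[R]_n) :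
  (forall j, (F x 0 j) @[x --> D] --> l 0 j) -> F @ D --> l.
Proof.
move=> cF; apply/cvgrPdist_le => e e0.
have : \forall y \near D, forall j, `|l 0 j - F y 0 j| <= e.
  by apply: filter_forall => j; have /cvgrPdist_le/(_ _ e0) := cF j.
apply: filterS => y Hy.
rewrite /Num.norm/= mx_normrE; apply: bigmax_le; first exact: ltW.
by move=> [i j] _; rewrite !mxE (ord1 i).
Qed.

Lemma cvg_bigsum (R : realType) (T I : Type) (D : set_system T) (FF : Filter D)
    (r : seq I) (F : I -> T -> R) (l : I -> R) :
  (forall i, F i @ D --> l i) -> (\sum_(i <- r) F i x) @[x --> D] --> \sum_(i <- r) l i.
Proof.
move=> cF; elim: r => [|i r IH].
  by rewrite big_nil; under eq_fun do rewrite big_nil; exact: cvg_cst.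
by rewrite big_cons; under eq_fun do rewrite big_cons; exact: cvgD.
Qed.

Section ContinuousCombinators.
Context {R : realType} {T : topologicalType}.
Implicit Types f g : T -> R.

Lemma continuous_add f g : continuous f -> continuous g ->
  continuous (fun x => f x + g x).
Proof. by move=> cf cg x; apply: cvgD; [exact: cf|exact: cg]. Qed.

Lemma continuous_sub f g : continuous f -> continuous g ->
  continuous (fun x => f x - g x).
Proof. by move=> cf cg x; apply: cvgB; [exact: cf|exact: cg]. Qed.

Lemma continuous_mul f g : continuous f -> continuous g ->
  continuous (fun x => f x * g x).
Proof. by move=> cf cg x; apply: cvgM; [exact: cf|exact: cg]. Qed.

Lemma continuous_exp f k : continuous f -> continuous (fun x => f x ^+ k).
Proof.
move=> cf; elim: k => [|k IH]; first exact: cst_continuous.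
by under eq_fun do rewrite exprS; exact: continuous_mul.
Qed.

Lemma continuous_sum (I : Type) (r : seq I) (P : pred I) (F : I -> T -> R) :
  (forall i, continuous (F i)) -> continuous (fun x => \sum_(i <- r | P i) F i x).
Proof.
move=> cF; elim: r => [|i r IH].
  by under eq_fun do rewrite big_nil; exact: cst_continuous.
under eq_fun do rewrite big_cons; case: (P i) => //.
exact: continuous_add.
Qed.

Lemma continuous_prod (I : Type) (r : seq I) (P : pred I) (F : I -> T -> R) :
  (forall i, continuous (F i)) -> continuous (fun x => \prod_(i <- r | P i) F i x).
Proof.
move=> cF; elim: r => [|i r IH].
  by under eq_fun do rewrite big_nil; exact: cst_continuous.
under eq_fun do rewrite big_cons; case: (P i) => //.
exact: continuous_mul.
Qed.

Lemma continuous_row n (F : T -> 'rV[R]_n) :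
  (forall j, continuous (fun x => F x 0 j)) -> continuous F.
Proof.
by move=> cF x; apply: cvg_row => j; exact: cF.
Qed.

End ContinuousCombinators.

Section SmoothFunctions.
Context {R : realType}.

Definition ev {n} (i : 'I_n) : 'rV[R]_n := delta_mx 0 i.

Lemma coord_continuous n (j : 'I_n) : continuous (fun x : 'rV[R]_n => x 0 j).
Proof. exact: coord_continuous. Qed.

(** Only partial derivatives along the axes appear, which keeps closure under sums, products and
    composition an induction on [k]; their continuity is what yields the chain rule. Functions are
    total, so no domain has to be carried along. *)
Fixpoint Cn n k (f : 'rV[R]_n -> R) : Prop :=
  continuous f /\
  if k is k'.+1 then forall i, (forall x, derivable f x (ev i)) /\ Cn k' ('D_(ev i) f)
  else True.

Section Cn.
Context {n : nat}.
Implicit Types (f g : 'rV[R]_n -> R) (k : nat) (x v : 'rV[R]_n).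

Lemma Cn_continuous k f : Cn k f -> continuous f.
Proof. by case: k => [|k] []. Qed.

Lemma Cn_is_derive k f x i : Cn k.+1 f -> is_derive x (ev i) f ('D_(ev i) f x).
Proof. by move=> [_ /(_ i)[/(_ x)]] d _; exact: derivableP. Qed.

Lemma Cn_derive k f i : Cn k.+1 f -> Cn k ('D_(ev i) f).
Proof. by move=> [_ /(_ i)[]]. Qed.

Lemma CnW k f : Cn k.+1 f -> Cn k f.
Proof.
elim: k f => [|k IH] f [cf df]; first by split.
by split=> // i; have [d c] := df i; split=> //; exact: IH.
Qed.

Lemma Cn_intro k f (g : 'I_n -> 'rV[R]_n -> R) : continuous f ->
  (forall i x, is_derive x (ev i) f (g i x)) -> (forall i, Cn k (g i)) -> Cn k.+1 f.
Proof.
move=> cf df cg; split=> // i; split; first by move=> x; have := df i x => H; exact: ex_derive.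
suff -> : 'D_(ev i) f = g i by [].
by apply/funext => x; have := df i x => H; exact: derive_val.
Qed.

Lemma Cn_cst k c : Cn k (fun _ : 'rV[R]_n => c).
Proof.
elim: k c => [|k IH] c; first by split=> //; exact: cst_continuous.
by apply: (@Cn_intro k (fun=> c) (fun _ _ => 0)) => //; exact: cst_continuous.
Qed.

Lemma Cn_add k f g : Cn k f -> Cn k g -> Cn k (fun x => f x + g x).
Proof.
elim: k f g => [|k IH] f g Hf Hg; have cf := Cn_continuous Hf; have cg := Cn_continuous Hg.
  by split=> //; exact: continuous_add.
apply: (@Cn_intro _ _ (fun i x => 'D_(ev i) f x + 'D_(ev i) g x)).
- exact: continuous_add.
- by move=> i x; apply: is_deriveD; [exact: Cn_is_derive Hf|exact: Cn_is_derive Hg].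
- by move=> i; apply: IH; exact: Cn_derive.
Qed.

Lemma Cn_mul k f g : Cn k f -> Cn k g -> Cn k (fun x => f x * g x).
Proof.
elim: k f g => [|k IH] f g Hf Hg; have cf := Cn_continuous Hf; have cg := Cn_continuous Hg.
  by split=> //; exact: continuous_mul.
apply: (@Cn_intro _ _ (fun i x => f x * 'D_(ev i) g x + g x * 'D_(ev i) f x)).
- exact: continuous_mul.
- move=> i x; apply: is_deriveM; [exact: Cn_is_derive Hf|exact: Cn_is_derive Hg].
- by move=> i; apply: Cn_add; apply: IH; try exact: Cn_derive; exact: CnW.
Qed.

Lemma Cn_sum (I : Type) (r : seq I) (P : pred I) k (F : I -> 'rV[R]_n -> R) :
  (forall i, Cn k (F i)) -> Cn k (fun x => \sum_(i <- r | P i) F i x).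
Proof.
move=> cF; elim: r => [|i r IH].
  by under eq_fun do rewrite big_nil; exact: Cn_cst.
under eq_fun do rewrite big_cons; case: (P i) => //.
exact: Cn_add.
Qed.

Lemma Cn_prod (I : Type) (r : seq I) (P : pred I) k (F : I -> 'rV[R]_n -> R) :
  (forall i, Cn k (F i)) -> Cn k (fun x => \prod_(i <- r | P i) F i x).
Proof.
move=> cF; elim: r => [|i r IH].
  by under eq_fun do rewrite big_nil; exact: Cn_cst.
under eq_fun do rewrite big_cons; case: (P i) => //.
exact: Cn_mul.
Qed.

Lemma is_derive_coord (x v : 'rV[R]_n) (j : 'I_n) :
  is_derive x v (fun x : 'rV[R]_n => x 0 j) (v 0 j).
Proof.
suff L : (fun h : R => h^-1 *: (((fun x : 'rV[R]_n => x 0 j) \o shift x) (h *: v) - x 0 j))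
    @ 0^' --> v 0 j.
  by apply: DeriveDef; [apply/cvg_ex; exists (v 0 j)|exact/cvg_lim].
apply: (@cvg_trans _ ((fun=> v 0 j) @ 0^')); last exact: cvg_cst.
apply: near_eq_cvg; near=> h.
have h0 : h != 0 by near: h; exact: nbhs_dnbhs_neq.
by rewrite /= !mxE addrK [RHS]mulrA mulVf// mul1r.
Unshelve. all: by end_near.
Qed.

Lemma Cn_coord k (j : 'I_n) : Cn k (fun x : 'rV[R]_n => x 0 j).
Proof.
have c := @coord_continuous n j.
case: k => [|k]; first by split.
apply: (@Cn_intro _ _ (fun i x => ev i 0 j)) => //.
- by move=> i x; exact: is_derive_coord.
- by move=> i; exact: Cn_cst.
Qed.

Lemma is_derive_comp1 (phi : R -> R) f x v d df :
  is_derive (f x) 1 phi d -> is_derive x v f df ->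
  is_derive x v (fun y => phi (f y)) (d * df).
Proof.
move=> dphi /is_derive_line0 H; apply/is_derive_line0.
by apply: is_derive1_comp; rewrite /= ?scale0r ?add0r.
Qed.

Lemma Cn_trig k f : Cn k f -> Cn k (fun x => sin (f x)) /\ Cn k (fun x => cos (f x)).
Proof.
elim: k f => [|k IH] f Hf; have cf := Cn_continuous Hf.
  by split; split=> //; apply: continuous_comp_fun cf _;
    [exact: continuous_sin|exact: continuous_cos].
have [IH1 IH2] := IH _ (CnW Hf).
split.
- apply: (@Cn_intro _ _ (fun i x => cos (f x) * 'D_(ev i) f x)).
  + by apply: continuous_comp_fun cf _; exact: continuous_sin.
  + by move=> i x; apply: is_derive_comp1; exact: Cn_is_derive Hf.
  + by move=> i; apply: Cn_mul => //; exact: Cn_derive.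
- apply: (@Cn_intro _ _ (fun i x => - 1 * sin (f x) * 'D_(ev i) f x)).
  + by apply: continuous_comp_fun cf _; exact: continuous_cos.
  + by move=> i x; rewrite mulN1r; apply: is_derive_comp1; exact: Cn_is_derive Hf.
  + move=> i; apply: Cn_mul; last exact: Cn_derive.
    by apply: Cn_mul => //; exact: Cn_cst.
Qed.

Lemma Cn_inv k f : (forall x, f x != 0) -> Cn k f -> Cn k (fun x => (f x)^-1).
Proof.
move=> f0; elim: k => [|k IH] Hf; have cf := Cn_continuous Hf.
  by split=> // x; exact: (cvgV (f0 x) (cf x)).
apply: (@Cn_intro _ _ (fun i x => - 1 * ((f x)^-1 * (f x)^-1) * 'D_(ev i) f x)).
- by move=> x; exact: (cvgV (f0 x) (cf x)).
- move=> i x; have := Cn_is_derive x i Hf => H.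
  have -> : -1 * ((f x)^-1 * (f x)^-1) * 'D_(ev i) f x = - (f x) ^- 2 *: 'D_(ev i) f x.
    by rewrite /GRing.scale/= -exprVn expr2 mulN1r.
  by apply: DeriveDef; [exact: derivableV|rewrite deriveV].
- move=> i; apply: Cn_mul; last exact: Cn_derive.
  apply: Cn_mul; first exact: Cn_cst.
  by have := IH (CnW Hf) => H; apply: Cn_mul.
Qed.

(* Telescope along the coordinate directions and apply the mean value theorem to
   each step. *)
Lemma mean_value_coord f x y : Cn 1 f ->
  exists2 xi : 'I_n -> 'rV[R]_n, forall l, `|xi l - x| <= `|y - x| &
    f y - f x = \sum_l 'D_(ev l) f (xi l) * (y 0 l - x 0 l).
Proof.
move=> Hf.
pose z (m : nat) : 'rV[R]_n := \row_j if (j < m)%N then y 0 j else x 0 j.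
have zS (l : 'I_n) : z l.+1 = (y 0 l - x 0 l) *: ev l + z l.
  apply/rowP => j; rewrite !mxE /= ltnS leq_eqVlt -val_eqE /=.
  by case: eqVneq => [/val_inj->|_]; rewrite /= ?ltnn ?mulr1 ?subrK// mulr0 add0r.
have H (l : 'I_n) : exists2 c, `|c| <= `|y 0 l - x 0 l| &
    f (z l.+1) - f (z l) = 'D_(ev l) f (c *: ev l + z l) * (y 0 l - x 0 l).
  have dl (t : R) : is_derive t 1 (fun t : R => f (t *: ev l + z l)) ('D_(ev l) f (t *: ev l + z l)).
    by apply: (iffRL (is_derive_line f _ _ _ _)); exact: Cn_is_derive Hf.
  have [c cb e] := MVT_line (y 0 l - x 0 l) dl.
  by exists c => //; rewrite zS -e scale0r add0r.
pose c l := s2val (cid2 (H l)).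
exists (fun l => c l *: ev l + z l) => [l|].
  rewrite [leLHS]mx_normrE; apply: bigmax_le => // -[i j] _.
  rewrite (ord1 i) !mxE eqxx /= => {i}.
  have L (a : 'I_n) : `|y 0 a - x 0 a| <= `|y - x|.
    rewrite [leRHS]mx_normrE; apply: le_trans (le_bigmax _ _ (0, a)).
    by rewrite !mxE.
  have [->|jl] := eqVneq j l.
    rewrite mulr1 ltnn addrK; apply: le_trans (L l).
    exact: (s2valP (cid2 (H l))).
  rewrite mulr0 add0r; case: ifP => _; last by rewrite subrr normr0.
  exact: L.
transitivity (\sum_(l < n) (f (z l.+1) - f (z l))).
  rewrite -(big_mkord xpredT (fun l => f (z l.+1) - f (z l))) telescope_sumr//.
  congr (f _ - f _); apply/rowP => j; rewrite mxE ?ltn_ord//.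
by apply: eq_bigr => l _; exact: (s2valP' (cid2 (H l))).
Qed.

End Cn.

(** [mean_value_coord] writes the increment of [f] along [S] as a sum of partial derivatives at
    intermediate points times increments of the coordinates of [S]. The intermediate points are no
    farther from [S x] than the end point, so they tend to [S x], where the partial derivatives are
    continuous. *)
Lemma is_derive_chain n (V : normedModType R) (f : 'rV[R]_n -> R)
    (S : V -> 'rV[R]_n) (dS : 'I_n -> R) x v :
  Cn 1 f -> (forall l, is_derive x v (fun y => S y 0 l) (dS l)) ->
  is_derive x v (fun y => f (S y)) (\sum_l 'D_(ev l) f (S x) * dS l).
Proof.
move=> Hf HS; apply/is_derive_line0.
pose s (t : R) := S (t *: v + x).
have s0 : s 0 = S x by rewrite /s scale0r add0r.
have Hs l : is_derive (0 : R) 1 (fun t => s t 0 l) (dS l).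
  by apply/is_derive_line0; exact: HS.
have cs : s t @[t --> 0] --> s 0.
  by apply: cvg_row => j; exact: is_derive_continuous (Hs j).
pose xi t := s2val (cid2 (mean_value_coord (s 0) (s t) Hf)).
have xiP t l : `|xi t l - s 0| <= `|s t - s 0| by exact: (s2valP (cid2 (mean_value_coord (s 0) (s t) Hf))).
have xiE t : f (s t) - f (s 0) = \sum_l 'D_(ev l) f (xi t l) * (s t 0 l - s 0 0 l).
  exact: (s2valP' (cid2 (mean_value_coord (s 0) (s t) Hf))).
have cxi l : xi t l @[t --> 0] --> s 0.
  apply/cvgrPdist_le => e e0; move/cvgrPdist_le : cs => /(_ _ e0).
  by apply: filterS => t; rewrite distrC [X in _ -> X <= _]distrC; exact: le_trans.
suff L : (fun h : R => h^-1 *: (((fun t => f (s t)) \o shift 0) (h *: 1) - f (s 0)))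
    @ 0^' --> \sum_l 'D_(ev l) f (S x) * dS l.
  by apply: DeriveDef; [apply/cvg_ex; exists (\sum_l 'D_(ev l) f (S x) * dS l)|exact/cvg_lim].
have -> : (fun h : R => h^-1 *: (((fun t => f (s t)) \o shift 0) (h *: 1) - f (s 0))) =
  (fun h => \sum_l 'D_(ev l) f (xi h l) * (h^-1 *: (((fun t => s t 0 l) \o shift 0) (h *: 1) - s 0 0 l))).
  apply/funext => h /=; rewrite addr0 [h *: 1]mulr1 xiE scaler_sumr.
  by apply: eq_bigr => l _; rewrite -![_ *: _]/(_ * _) mulrCA.
rewrite -s0; apply: cvg_bigsum => l; apply: cvgM.
  apply: (@cvg_comp _ _ _ (fun t => xi t l) ('D_(ev l) f) _ (nbhs (s 0))).
    exact: cvg_within_filter (cxi l).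
  exact: (Cn_continuous (Cn_derive l Hf)).
by have [D <-] := Hs l.
Qed.

Lemma Cn_comp n m k (f : 'rV[R]_n -> R) (S : 'rV[R]_m -> 'rV[R]_n) :
  Cn k f -> (forall l, Cn k (fun x => S x 0 l)) -> Cn k (fun x => f (S x)).
Proof.
elim: k f => [|k IH] f Hf HS; have cf := Cn_continuous Hf;
  have cS : continuous S := continuous_row (fun j => Cn_continuous (HS j)).
 by split=> //; exact: (continuous_comp_fun cS cf).
have Hf1 : Cn 1 f by elim: k Hf {IH HS} => // k IH /CnW.
apply: (@Cn_intro _ _ _ (fun i x => \sum_l 'D_(ev l) f (S x) * 'D_(ev i) (fun x => S x 0 l) x)).
- exact: (continuous_comp_fun cS cf).
- by move=> i x; apply: is_derive_chain => // l; exact: Cn_is_derive (HS l).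
- move=> i; apply: Cn_sum => l; apply: Cn_mul; last exact: (Cn_derive _ (HS l)).
  exact: (IH _ (Cn_derive l Hf) (fun a => CnW (HS a))).
Qed.

End SmoothFunctions.

(** * Symmetry of second derivatives and box mollification *)

Section Mollifier.
Context {R : realType} {n : nat}.
Implicit Types (f g h : 'rV[R]_n -> R) (x v w : 'rV[R]_n) (d : R) (js : seq 'I_n).

Lemma is_derive_translate f x v w df :
  is_derive (w + x) v f df -> is_derive x v (fun y => f (w + y)) df.
Proof.
move=> /is_derive_line0 H; apply/is_derive_line0.
by under eq_fun do rewrite addrCA.
Qed.

Lemma line_continuous g v : continuous g ->
  continuous (fun p : 'rV[R]_n * R => g (p.2 *: v + p.1)).
Proof.
move=> cg; apply: (@continuous_comp_fun _ _ _ (fun p : 'rV[R]_n * R => p.2 *: v + p.1) _ _ cg).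
by move=> p; apply: cvgD; [apply: cvgZr_tmp; exact: cvg_snd|exact: cvg_fst].
Qed.

Lemma line_continuous1 g v x : continuous g -> continuous (fun s : R => g (s *: v + x)).
Proof.
move=> cg; pose F (y : 'rV[R]_n) (s : R) := g (s *: v + y).
have H : continuous (fun p : 'rV[R]_n * R => F p.1 p.2) by exact: line_continuous.
exact: (uncurry_continuous2 (x := x) H).
Qed.

Lemma translate_continuous g w : continuous g -> continuous (fun x => g (w + x)).
Proof.
move=> cg; apply: (@continuous_comp_fun _ _ _ (fun x => w + x) _ _ cg).
by move=> x; exact: (cvgD (cvg_cst w) (@cvg_id _ (nbhs x))).
Qed.

Lemma Cn_translate k g w : Cn k g -> Cn k (fun x => g (w + x)).
Proof.
move=> Hg; apply: (Cn_comp Hg) => l.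
have -> : (fun x : 'rV[R]_n => (w + x) 0 l) = (fun x => w 0 l + x 0 l).
  by apply/funext => x; rewrite mxE.
by apply: Cn_add; [exact: Cn_cst|exact: Cn_coord].
Qed.

Lemma is_derive_oint_line g v x (s : R) : continuous g ->
  is_derive s 1 (oint (fun t => g (t *: v + x)) 0) (g (s *: v + x)).
Proof. by move=> cg; have := is_derive_oint 0 s (line_continuous1 (v := v) (x := x) cg). Qed.

Lemma is_derive_oint_line0 g v x : continuous g ->
  is_derive (0 : R) 1 (oint (fun t => g (t *: v + x)) 0) (g x).
Proof. by move=> cg; have := is_derive_oint_line v x 0 cg; rewrite scale0r add0r. Qed.

Lemma oint_derive_line g v x (s : R) (g' : 'rV[R]_n -> R) : continuous g' ->
  (forall y, is_derive y v g (g' y)) ->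
  oint (fun t => g' (t *: v + x)) 0 s = g (s *: v + x) - g x.
Proof.
move=> cg' dg; have dl (t : R) : is_derive t 1 (fun t : R => g (t *: v + x)) (g' (t *: v + x)).
  by apply: (iffRL (is_derive_line g x v t _)); exact: dg.
by rewrite (ointP _ _ (line_continuous1 (v := v) (x := x) cg') dl) scale0r add0r.
Qed.

(** Differentiate [f (s e_j + x) - f x], the integral of ['D_(ev j) f] from 0 to [s], along [e_i]
    under the integral sign; differentiating the resulting identity in [s] at 0 exchanges the two
    derivatives. *)
Lemma schwarz f x i j : Cn 2 f ->
  'D_(ev i) ('D_(ev j) f) x = 'D_(ev j) ('D_(ev i) f) x.
Proof.
move=> Hf; have dj : continuous ('D_(ev j) f) := Cn_continuous (Cn_derive j Hf).
have dij : continuous ('D_(ev i) ('D_(ev j) f)) := Cn_continuous (Cn_derive i (Cn_derive j Hf)).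
have E (s : R) : 'D_(ev i) f (s *: ev j + x) =
    'D_(ev i) f x + oint (fun t => 'D_(ev i) ('D_(ev j) f) (t *: ev j + x)) 0 s.
  have L : is_derive x (ev i) (fun y => oint (fun t => 'D_(ev j) f (t *: ev j + y)) 0 s)
      (oint (fun t => 'D_(ev i) ('D_(ev j) f) (t *: ev j + x)) 0 s).
    apply: (@is_derive_under_oint _ _ (fun y t => 'D_(ev j) f (t *: ev j + y))
        (fun y t => 'D_(ev i) ('D_(ev j) f) (t *: ev j + y))).
    - exact: (line_continuous (v := ev j) dj).
    - exact: (line_continuous (v := ev j) dij).
    - move=> y t; apply: (is_derive_translate (f := 'D_(ev j) f) (w := t *: ev j)).
      exact: Cn_is_derive (Cn_derive j Hf).
  have : is_derive x (ev i) (fun y => f (s *: ev j + y) - f y)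
      ('D_(ev i) f (s *: ev j + x) - 'D_(ev i) f x).
    apply: is_deriveB; last exact: Cn_is_derive Hf.
    by apply: (is_derive_translate (f := f) (w := s *: ev j)); exact: Cn_is_derive Hf.
  under eq_fun do rewrite -(oint_derive_line _ _ dj (fun y => Cn_is_derive y j Hf)).
  by move: L => [_ e1] [_ e2]; rewrite -e1 e2 [RHS]addrC subrK.
have : is_derive (0 : R) 1 (fun s : R => 'D_(ev i) f (s *: ev j + x)) ('D_(ev j) ('D_(ev i) f) x).
  apply: (iffRL (is_derive_line0 ('D_(ev i) f) x (ev j) _)).
  exact: Cn_is_derive (Cn_derive i Hf).
under eq_fun do rewrite E.
have D : is_derive (0 : R) 1 (fun s : R => 'D_(ev i) f x + oint (fun t => 'D_(ev i) ('D_(ev j) f) (t *: ev j + x)) 0 s)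
    (0 + 'D_(ev i) ('D_(ev j) f) x).
  apply: is_deriveD.
  exact: (is_derive_oint_line0 (ev j) x dij).
by move=> [_ e2]; rewrite (@derive_val _ _ _ _ _ _ _ D) add0r in e2.
Qed.

(** For [d > 0], the mean over the segment from [x] to [x + d e_i]. Iterated over all coordinates it
    becomes [mol], the mean over the cube with [x] as its lowest corner; with this choice the parts
    of a bisected cube are of the same kind. *)
Definition avg d i g x : R := d^-1 * oint (fun s => g (s *: ev i + x)) 0 d.
Definition avgs d js g := foldr (avg d) g js.
Definition dquot d i g x : R := d^-1 * (g (d *: ev i + x) - g x).
Definition mol d g := avgs d (enum 'I_n) g.

Lemma avg_continuous d i g : continuous g -> continuous (avg d i g).
Proof.
move=> cg; apply: continuous_mul; first exact: cst_continuous.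
pose F (y : 'rV[R]_n) (s : R) := g (s *: ev i + y).
have H : continuous (fun p : 'rV[R]_n * R => F p.1 p.2) by exact: line_continuous.
exact: (oint_continuous (F := F)).
Qed.

Lemma avgs_continuous d js g : continuous g -> continuous (avgs d js g).
Proof. by move=> cg; elim: js => //= i js; exact: avg_continuous. Qed.

Lemma avg_lin d i (a b : R) g h : continuous g -> continuous h ->
  avg d i (fun x => a * g x + b * h x) = (fun x => a * avg d i g x + b * avg d i h x).
Proof.
move=> cg ch; apply/funext => x.
rewrite /avg oint_lin; [|exact: line_continuous1|exact: line_continuous1].
by rewrite mulrDr !(mulrCA d^-1).
Qed.

Lemma avgs_lin d js (a b : R) g h : continuous g -> continuous h ->
  avgs d js (fun x => a * g x + b * h x) = (fun x => a * avgs d js g x + b * avgs d js h x).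
Proof.
by move=> cg ch; elim: js => //= i js ->; rewrite avg_lin//; exact: avgs_continuous.
Qed.

Lemma avg_translate d i g w : avg d i (fun x => g (w + x)) = (fun x => avg d i g (w + x)).
Proof.
by apply/funext => x; rewrite /avg; congr (_ * oint _ _ _); apply/funext => s; rewrite addrCA.
Qed.

Lemma avgs_translate d js g w :
  avgs d js (fun x => g (w + x)) = (fun x => avgs d js g (w + x)).
Proof. by elim: js => //= i js ->; rewrite avg_translate. Qed.

Lemma dquotE d i g : dquot d i g = (fun x => d^-1 * g (d *: ev i + x) + (- d^-1) * g x).
Proof. by apply/funext => x; rewrite /dquot; ring. Qed.

Lemma dquot_continuous d i g : continuous g -> continuous (dquot d i g).
Proof.
move=> cg; rewrite dquotE; apply: continuous_add; apply: continuous_mul => //;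
  [exact: cst_continuous|exact: translate_continuous|exact: cst_continuous].
Qed.

Lemma avgs_dquot d js i g : continuous g ->
  avgs d js (dquot d i g) = dquot d i (avgs d js g).
Proof.
move=> cg; rewrite !dquotE avgs_lin//; last exact: translate_continuous.
by rewrite avgs_translate.
Qed.

(** A mean over a moving segment changes at the rate given by its two end values: this is the gain
    of one derivative on a merely continuous [g]. *)
Lemma is_derive_avg_same d i g x : continuous g ->
  is_derive x (ev i) (avg d i g) (dquot d i g x).
Proof.
move=> cg; apply/is_derive_line0.
have E : (fun t : R => avg d i g (t *: ev i + x)) =
    (fun t => d^-1 * (oint (fun s => g (s *: ev i + x)) 0 (d + t) -
                      oint (fun s => g (s *: ev i + x)) 0 t)).
  apply/funext => t; rewrite /avg; congr (_ * _).
  have -> : (fun s : R => g (s *: ev i + (t *: ev i + x))) = (fun s => g ((s + t) *: ev i + x)).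
    by apply/funext => s; rewrite scalerDl addrA.
  rewrite (@oint_shift _ (fun s => g (s *: ev i + x))); last exact: line_continuous1.
  by rewrite add0r /oint; ring.
rewrite E; apply: is_deriveZ; apply: is_deriveB; last first.
  exact: (is_derive_oint_line0 (ev i) x cg).
rewrite -[X in is_derive _ _ _ X]mulr1.
apply: (@is_derive1_comp _ (oint (fun s : R => g (s *: ev i + x)) 0) (fun t => d + t)).
  by rewrite addr0; exact: (is_derive_oint_line (ev i) x d cg).
by rewrite -[X in is_derive _ _ _ X]add0r; apply: is_deriveD.
Qed.

Lemma is_derive_avg d i g g' v x : continuous g -> continuous g' ->
  (forall y, is_derive y v g (g' y)) -> is_derive x v (avg d i g) (avg d i g' x).
Proof.
move=> cg cg' dg; apply: is_deriveZ.
apply: (@is_derive_under_oint _ _ (fun y s => g (s *: ev i + y)) (fun y s => g' (s *: ev i + y))).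
- exact: (line_continuous (v := ev i) cg).
- exact: (line_continuous (v := ev i) cg').
- by move=> y s; apply: (is_derive_translate (f := g) (w := s *: ev i)); exact: dg.
Qed.

Lemma is_derive_avgs d js g g' v x : continuous g -> continuous g' ->
  (forall y, is_derive y v g (g' y)) -> is_derive x v (avgs d js g) (avgs d js g' x).
Proof.
move=> cg cg' dg; elim: js x => //= i js IH x.
by apply: is_derive_avg => //; exact: avgs_continuous.
Qed.

(** The average along [e_i] becomes a difference quotient, with which the other averages commute,
    being linear and translation invariant. What remains is the mean of that quotient over a face
    orthogonal to [e_i]. *)
Lemma is_derive_avgs_mem d js i g x : continuous g -> i \in js ->
  is_derive x (ev i) (avgs d js g) (avgs d (rem i js) (dquot d i g) x).
Proof.
move=> cg; elim: js x => //= j js IH x; rewrite in_cons eq_sym.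
case: eqVneq => [->|ji] /= ijs.
  by rewrite avgs_dquot//; apply: is_derive_avg_same; exact: avgs_continuous.
apply: is_derive_avg; first exact: avgs_continuous.
  by apply: avgs_continuous; exact: dquot_continuous.
by move=> y; exact: IH.
Qed.

Lemma Cn_avgs k d js g : Cn k g -> Cn k (avgs d js g).
Proof.
elim: k g => [|k IH] g Hg; have cg := Cn_continuous Hg.
  by split=> //; exact: avgs_continuous.
apply: (@Cn_intro _ _ _ _ (fun i => avgs d js ('D_(ev i) g))).
- exact: avgs_continuous.
- move=> i x; apply: is_derive_avgs => //; first exact: (Cn_continuous (Cn_derive i Hg)).
  by move=> y; exact: Cn_is_derive Hg.
- by move=> i; apply: IH; exact: Cn_derive.
Qed.

Lemma Cn_dquot k d i g : Cn k g -> Cn k (dquot d i g).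
Proof.
move=> Hg; rewrite dquotE; apply: Cn_add; apply: Cn_mul => //;
  [exact: Cn_cst|exact: Cn_translate|exact: Cn_cst].
Qed.

Lemma is_derive_mol d i g x : continuous g ->
  is_derive x (ev i) (mol d g) (avgs d (rem i (enum 'I_n)) (dquot d i g) x).
Proof. by move=> cg; apply: is_derive_avgs_mem => //; rewrite mem_enum. Qed.

Lemma Cn_mol k d g : Cn k g -> Cn k.+1 (mol d g).
Proof.
move=> Hg; have cg := Cn_continuous Hg.
apply: (@Cn_intro _ _ _ _ (fun i => avgs d (rem i (enum 'I_n)) (dquot d i g))).
- exact: avgs_continuous.
- by move=> i x; exact: is_derive_mol.
- by move=> i; apply: Cn_avgs; exact: Cn_dquot.
Qed.

End Mollifier.

(** * Goursat's lemma *)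

Section Goursat.
Context {R : realType} {n : nat}.
Implicit Types (f g h : 'rV[R]_n -> R) (x y v w : 'rV[R]_n) (d : R) (js : seq 'I_n).

Definition cube x d y := forall j : 'I_n, x 0 j <= y 0 j <= x 0 j + d.

(** The average sees only the face of the cube spanned by the directions in [js]. Keeping this
    restriction lets [flux_small] place both [y] and [d e_i + y] in the cube. *)
Lemma avgs_le d js g x C : continuous g -> uniq js -> 0 < d ->
  (forall y, (forall j, j \notin js -> y 0 j = x 0 j) -> cube x d y -> `|g y| <= C) ->
  `|avgs d js g x| <= C.
Proof.
move=> cg + d0; elim: js x => [|j js IH] x /=.
  move=> _; apply => // j; by rewrite lexx lerDl ltW.
move=> /andP[jjs ujs] H; rewrite /avg normrM gtr0_norm ?invr_gt0//.
rewrite mulrC ler_pdivrMr// -[X in _ * X]subr0; apply: oint_le (ltW d0) _.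
  by apply: line_continuous1; exact: avgs_continuous.
move=> s /andP[s0 sd]; apply: IH => // y y1 y2; apply: H => a.
  rewrite in_cons negb_or => /andP[aj ajs].
  by rewrite y1// !mxE eqxx/= (negbTE aj) mulr0 add0r.
have [ajs|ajs] := boolP (a \in js).
  have := y2 a; rewrite !mxE eqxx/=.
  have [aj|] := eqVneq a j; first by move: jjs; rewrite -aj ajs.
  by rewrite mulr0 add0r.
rewrite y1// !mxE eqxx/=; case: eqVneq => _; rewrite ?mulr1 ?mulr0 ?add0r.
  by rewrite lerDr s0 addrC lerD2l.
by rewrite lexx lerDl ltW.
Qed.

(** Through [avg_double] this is the splitting of a segment of length [2 d] into halves; [bisects]
    over all directions is the splitting of a cube into [2 ^ n] subcubes. *)
Definition bisect d j g x : R := 2^-1 * g x + 2^-1 * g (d *: ev j + x).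
Definition bisects d js g := foldr (bisect d) g js.

Lemma avg_bisect d e j a g : continuous g ->
  avg d j (bisect e a g) = bisect e a (avg d j g).
Proof.
move=> cg; rewrite avg_lin//; last exact: translate_continuous.
by apply/funext => x; rewrite avg_translate.
Qed.

Lemma bisect_continuous d j g : continuous g -> continuous (bisect d j g).
Proof.
move=> cg; apply: continuous_add; apply: continuous_mul => //;
  [exact: cst_continuous|exact: cst_continuous|exact: translate_continuous].
Qed.

Lemma bisects_continuous d js g : continuous g -> continuous (bisects d js g).
Proof. by move=> cg; elim: js => //= j js; exact: bisect_continuous. Qed.

Lemma avg_bisects d e j js g : continuous g ->
  avg d j (bisects e js g) = bisects e js (avg d j g).
Proof.
move=> cg; elim: js => //= a js <-; rewrite avg_bisect//; exact: bisects_continuous.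
Qed.

Lemma avg_double d j g : continuous g -> avg (d + d) j g = bisect d j (avg d j g).
Proof.
move=> cg; apply/funext => x; rewrite /avg /bisect.
have cl := line_continuous1 (v := ev j) (x := x) cg.
have -> : (fun s : R => g (s *: ev j + (d *: ev j + x))) = (fun s => g ((s + d) *: ev j + x)).
  by apply/funext => s; rewrite scalerDl addrA.
rewrite (oint_shift _ _ _ cl) (oint_chasles _ 0 d (d + d)) add0r.
have -> : (d + d)^-1 = 2^-1 * d^-1 by rewrite -invfM; congr (_^-1); ring.
ring.
Qed.

Lemma bisects_bisect d js j g : bisects d js (bisect d j g) = bisect d j (bisects d js g).
Proof.
elim: js => //= a js ->; rewrite /bisect; apply/funext => x.
by rewrite (addrCA (d *: ev j)); ring.
Qed.

Lemma avgs_double d js g : continuous g -> avgs (d + d) js g = bisects d js (avgs d js g).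
Proof.
move=> cg; elim: js => //= j js ->.
rewrite avg_bisects; last exact: avgs_continuous.
rewrite avg_double; last exact: avgs_continuous.
by rewrite bisects_bisect.
Qed.

Lemma is_derive_bisects d js g g' v x : (forall y, is_derive y v g (g' y)) ->
  is_derive x v (bisects d js g) (bisects d js g' x).
Proof.
move=> dg; elim: js x => //= j js IH x.
apply: is_deriveD; apply: is_deriveZ.
by apply: (is_derive_translate (f := bisects d js g) (w := d *: ev j)).
Qed.

Lemma bisects_sum (I : Type) (r : seq I) d js (F : I -> 'rV[R]_n -> R) x :
  \sum_(i <- r) bisects d js (F i) x = bisects d js (fun y => \sum_(i <- r) F i y) x.
Proof.
elim: js x => //= j js IH x.
by rewrite /bisect big_split /= -!mulr_sumr !IH.
Qed.

(** A mean of finitely many values is dominated by one of them: in each direction keep the half with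
    the larger absolute value. *)
Lemma bisects_le d js g x : 0 <= d -> uniq js -> exists y,
  [/\ `|bisects d js g x| <= `|g y|, cube x d y & forall j, j \notin js -> y 0 j = x 0 j].
Proof.
move=> d0; elim: js x => /= [|j js IH] x.
  by move=> _; exists x; split=> // j; rewrite lexx lerDl.
move=> /andP[jjs ujs].
have [z zx H] : exists2 z, z = x \/ z = d *: ev j + x &
    `|bisect d j (bisects d js g) x| <= `|bisects d js g z|.
  have T : `|bisect d j (bisects d js g) x| <= 2^-1 * `|bisects d js g x| +
      2^-1 * `|bisects d js g (d *: ev j + x)|.
    by rewrite (le_trans (ler_normD _ _))// !normrM ger0_norm.
  have [ab|ab] := leP `|bisects d js g x| `|bisects d js g (d *: ev j + x)|.
    by exists (d *: ev j + x); [right|lra].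
  by exists x; [left|lra].
have [y [yH yc yj]] := IH z ujs.
have zj a : a != j -> z 0 a = x 0 a.
  move=> aj; case: zx => ->//; by rewrite !mxE eqxx/= (negbTE aj) mulr0 add0r.
exists y; split; first exact: le_trans yH.
  move=> a; have [->|aj] := eqVneq a j; last by rewrite -zj.
  rewrite yj//; case: zx => ->; first by rewrite lexx lerDl.
  by rewrite !mxE !eqxx/= mulr1 lerDr d0 addrC lexx.
by move=> a; rewrite in_cons negb_or => /andP[aj ajs]; rewrite yj// zj.
Qed.

(* The divergence of the mollified field, equivalently the flux of [Y] through
   the faces of the cube at [x], divided by its volume. *)
Definition flux d (Y : 'I_n -> 'rV[R]_n -> R) x :=
  \sum_i avgs d (rem i (enum 'I_n)) (dquot d i (Y i)) x.

(** Additivity of the flux, the contributions of inner faces cancelling. No face is ever handled: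
    both sides are derivatives of the same average, which [avgs_double] writes in two ways. *)
Lemma flux_double d Y : (forall i, continuous (Y i)) ->
  flux (d + d) Y = bisects d (enum 'I_n) (flux d Y).
Proof.
move=> cY; apply/funext => x; rewrite -bisects_sum; apply: eq_bigr => i _.
have := is_derive_mol (d + d) i x (cY i).
rewrite /mol avgs_double// => -[_ <-].
by have [_ ->] := is_derive_bisects d (enum 'I_n) x (fun y => is_derive_mol d i y (cY i)).
Qed.

Lemma avgs_cst d js c x : d != 0 -> avgs d js (fun=> c) x = c.
Proof.
move=> d0; elim: js x => //= j js IH x; rewrite /avg.
by under eq_fun do rewrite IH; rewrite oint_cst subr0 mulrCA mulVf// mulr1.
Qed.

(** Since [flux] is normalised by the volume, the flux of a cube is the mean over its subcubes and
    no factor [2 ^ n] is lost. *)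
Lemma flux_halving d Y x : (forall i, continuous (Y i)) -> 0 <= d ->
  exists y, [/\ cube x (d / 2) y & `|flux d Y x| <= `|flux (d / 2) Y y|].
Proof.
move=> cY d0; have E : d = d / 2 + d / 2 by rewrite -splitr.
have d20 : 0 <= d / 2 by rewrite divr_ge0.
have [y [H1 H2 _]] := bisects_le (flux (d / 2) Y) x d20 (enum_uniq 'I_n).
by exists y; split=> //; rewrite {1}E flux_double.
Qed.

(** The affine part of [Y i] at [p] contributes ['D_(ev i) (Y i) p] to the flux, and these sum to 0.
    The remainder is at most [eta * d] at each end of a difference quotient with denominator [d],
    hence [2 * eta] for each of the [n] directions. *)
Lemma flux_small p Y (eta : R) : (forall i, continuous (Y i)) ->
  (forall i, differentiable (Y i) p) -> \sum_i 'D_(ev i) (Y i) p = 0 -> 0 < eta ->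
  exists2 r, 0 < r & forall d x, 0 < d -> d < r -> cube x d p ->
    `|flux d Y x| <= 2 * eta * n%:R.
Proof.
move=> cY dY divY eta0.
have [r r0 Hr] : exists2 r, 0 < r & forall i u, `|u| < r ->
    `|Y i (u + p) - (Y i p + 'd (Y i) p u)| <= eta * `|u|.
  have : \forall u \near (0 : 'rV[R]_n), forall i,
      `|Y i (u + p) - (Y i p + 'd (Y i) p u)| <= eta * `|u|.
    have FF : Filter (nbhs (0 : 'rV[R]_n)) by exact: nbhs_filter.
    apply: (@filter_forall _ _ (fun i u =>
      `|Y i (u + p) - (Y i p + 'd (Y i) p u)| <= eta * `|u|) (nbhs (0 : 'rV[R]_n))) => i; have := diff_locally (dY i).
    by move=> /eqaddoP/(_ _ eta0).
  case/nbhs_ballP => r /= r0 Hr; exists r => // i u ur; apply: Hr.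
  by rewrite -ball_normE /= sub0r normrN.
exists r => // d x d0 dr xp.
have near_p y : cube x d y -> `|y - p| <= d.
  move=> xy; rewrite [leLHS]mx_normrE; apply: bigmax_le; first exact: ltW.
  move=> [i j] _; rewrite (ord1 i) !mxE.
  have /andP[a b] := xy j; have /andP[a' b'] := xp j.
  by rewrite ler_norml; lra.
rewrite -[flux d Y x]subr0 -divY -sumrB (le_trans (ler_norm_sum _ _ _))//.
apply: (@le_trans _ _ (\sum_(i < n) 2 * eta)); last by rewrite sumr_const card_ord mulr_natr.
apply: ler_sum => i _.
have cd : continuous (dquot d i (Y i)) by exact: dquot_continuous (cY i).
have -> : avgs d (rem i (enum 'I_n)) (dquot d i (Y i)) x - 'D_(ev i) (Y i) p =
    avgs d (rem i (enum 'I_n)) (fun y => 1 * dquot d i (Y i) y + (-1) * (fun=> 'D_(ev i) (Y i) p) y) x.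
  rewrite avgs_lin//; last exact: cst_continuous.
  by rewrite avgs_cst ?gt_eqF// mul1r mulN1r.
apply: avgs_le => //.
- apply: continuous_add; apply: continuous_mul => //; exact: cst_continuous.
- exact/rem_uniq/enum_uniq.
move=> y y1 y2; rewrite mul1r mulN1r /dquot deriveE//.
have y3 : cube x d (d *: ev i + y).
  move=> j; rewrite !mxE eqxx/=; have [->|_] := eqVneq j i; last first.
    by rewrite mulr0 add0r; exact: y2.
  rewrite mulr1 y1; first by rewrite lerDr ltW// addrC lexx.
  by rewrite mem_rem_uniqF// enum_uniq.
have B z : cube x d z -> `|Y i z - (Y i p + 'd (Y i) p (z - p))| <= eta * d.
  move=> xz; have := Hr i (z - p); rewrite subrK => /(_ (le_lt_trans (near_p _ xz) dr)).
  by move=> /le_trans; apply; rewrite ler_wpM2l ?(ltW eta0) ?near_p.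
have L : 'd (Y i) p (d *: ev i + y - p) = d * 'd (Y i) p (ev i) + 'd (Y i) p (y - p).
  by rewrite -addrA linearD linearZ.
have E : d^-1 * (Y i (d *: ev i + y) - Y i y) - 'd (Y i) p (ev i) =
  d^-1 * ((Y i (d *: ev i + y) - (Y i p + 'd (Y i) p (d *: ev i + y - p))) -
          (Y i y - (Y i p + 'd (Y i) p (y - p)))).
  by rewrite L; field; rewrite gt_eqF.
rewrite E normrM gtr0_norm ?invr_gt0// mulrC ler_pdivrMr//.
apply: le_trans (ler_normB _ _) _.
by have := B _ y2; have := B _ y3; lra.
Qed.

Theorem goursat d Y x : (forall i, continuous (Y i)) -> 0 < d ->
  (forall y, cube x d y ->
     (forall i, differentiable (Y i) y) /\ \sum_i 'D_(ev i) (Y i) y = 0) ->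
  flux d Y x = 0.
Proof.
move=> cY d0 HY; apply/eqP/contraT => F0.
pose dk k := d / 2 ^+ k.
have dk0 k : 0 < dk k by rewrite divr_gt0// exprn_gt0.
have dkS k : dk k.+1 = dk k / 2 by rewrite /dk exprSr invfM mulrA.
(* The lower corner of a half-sized cube on which the flux has not decreased, picked by choice among
   those given by [flux_halving]. *)
pose next k y := xget y [set z | cube y (dk k.+1) z /\ `|flux (dk k) Y y| <= `|flux (dk k.+1) Y z|].
have nextP k y : cube y (dk k.+1) (next k y) /\ `|flux (dk k) Y y| <= `|flux (dk k.+1) Y (next k y)|.
  rewrite /next; case: xgetP => [z _ //|H]; exfalso.
  have [z [z1 z2]] := flux_halving y cY (ltW (dk0 k)).
  by apply: (H z); split; rewrite dkS.
pose X := fix X k := if k is k'.+1 then next k' (X k') else x.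
(* The lower corners increase in each coordinate, and the increments from stage [k] on telescope to
   at most [dk k - dk (m + k)]; so the cubes are nested. *)
have Xinc m k j : X k 0 j <= X (m + k)%N 0 j <= X k 0 j + (dk k - dk (m + k)%N).
  elim: m => [|m IH]; first by rewrite add0n subrr addr0 lexx.
  have [/(_ j)/andP[a b] _] := nextP (m + k)%N (X (m + k)%N).
  move: IH => /andP[a' b']; rewrite addSn /=.
  by move: a b; rewrite dkS => a b; apply/andP; split; lra.
have Xflux k : `|flux d Y x| <= `|flux (dk k) Y (X k)|.
  elim: k => [|k IH]; first by rewrite /dk expr0 divr1.
  by apply: le_trans IH _; have [_] := nextP k (X k).
(* The common point of the nested cubes, as the supremum of their lower corners. *)
pose p : 'rV[R]_n := \row_j sup (range (fun k => X k 0 j)).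
have Xp k : cube (X k) (dk k) p.
  have ub k' j m : X m 0 j <= X k' 0 j + dk k'.
    have [/subnK <-|/ltnW /subnK mk] := leqP k' m.
      by have /andP[_ h] := Xinc (m - k')%N k' j; have := dk0 (m - k' + k')%N; lra.
    have /andP[h _] := Xinc (k' - m)%N m j; move: h; rewrite mk => h.
    by have := dk0 k'; lra.
  move=> j; rewrite mxE; apply/andP; split.
    apply: sup_ubound; last by exists k.
    by exists (X k 0 j + dk k) => _ [m _ <-].
  by apply: ge_sup => [|_ [m _ <-]//]; exists (X 0 0 j), 0.
have [dp divp] : (forall i, differentiable (Y i) p) /\ \sum_i 'D_(ev i) (Y i) p = 0.
  by apply: HY; have := Xp 0; rewrite /dk expr0 divr1.
have F1 : 0 < `|flux d Y x| by rewrite normr_gt0.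
(* Chosen to make the bound [2 * eta * n%:R] of [flux_small] strictly less than the absolute value
   of the flux; the summand 1 gives strictness. *)
pose eta := `|flux d Y x| / (2 * (n%:R + 1)).
have n1 : 0 < n%:R + 1 :> R by rewrite ltr_wpDl.
have eta0 : 0 < eta by rewrite divr_gt0// mulr_gt0.
have [r r0 Hr] := flux_small cY dp divp eta0.
have [k kr] : exists k, dk k < r.
  have : dk k @[k --> \oo] --> 0.
    rewrite -(mulr0 d); apply: cvgMr.
    under eq_fun do rewrite -exprVn.
    by apply: cvg_expr; rewrite ger0_norm ?invr_ge0// invf_lt1// ltr1n.
  move=> /cvgrPdist_lt/(_ _ r0)[k _ /(_ k (leqnn k))]; rewrite sub0r normrN => kr.
  by exists k; apply: le_lt_trans kr; exact: ler_norm.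
have := le_trans (Xflux k) (Hr _ _ (dk0 k) kr (Xp k)).
rewrite /eta leNgt => /negP; case.
rewrite -subr_gt0; have -> : `|flux d Y x| - 2 * (`|flux d Y x| / (2 * (n%:R + 1))) * n%:R =
   `|flux d Y x| / (n%:R + 1) by field; rewrite gt_eqF.
exact: divr_gt0.
Qed.

End Goursat.

(** * Approximation by smooth regular functions *)

Section RegularApproximation.
Context {R : realType} {n m p : nat}.
Implicit Types (g h : 'rV[R]_n -> R) (x y v w : 'rV[R]_n) (d e : R) (js : seq 'I_n).

Definition laplacian g x := \sum_i 'D_(ev i) ('D_(ev i) g) x.

(** The Dirac equation in coordinates, [L i] being the matrix that multiplies a row vector by the
    [i]-th unit. Left and right regularity are two choices of [L]. *)
Definition regular_at (L : 'I_n -> 'M[R]_(m, p)) (f : 'I_m -> 'rV[R]_n -> R) y :=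
  forall l, \sum_i \sum_k 'D_(ev i) (f k) y * L i k l = 0.

Lemma avgs_sum (I : Type) (r : seq I) d js (c : I -> R) (F : I -> 'rV[R]_n -> R) :
  (forall i, continuous (F i)) ->
  avgs d js (fun x => \sum_(i <- r) c i * F i x) = (fun x => \sum_(i <- r) c i * avgs d js (F i) x).
Proof.
move=> cF; elim: r => [|i r IH].
  under eq_fun do rewrite big_nil; under [RHS]eq_fun do rewrite big_nil.
  elim: js => //= j js ->; apply/funext => x; rewrite /avg.
  by rewrite oint_cst mul0r mulr0.
under eq_fun do rewrite big_cons; under [RHS]eq_fun do rewrite big_cons.
have := @avgs_lin _ _ d js (c i) 1 (F i) (fun x => \sum_(j <- r) c j * F j x) (cF i).
under [X in avgs _ _ X]eq_fun do rewrite mul1r.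
move=> ->.
  by apply/funext => x; rewrite IH mul1r.
by apply: continuous_sum => j; apply: continuous_mul => //; exact: cst_continuous.
Qed.

Lemma is_derive_bigsum (V : normedModType R) (I : Type) (r : seq I) (F : I -> V -> R) (dF : I -> R)
    (x v : V) : (forall i, is_derive x v (F i) (dF i)) ->
  is_derive x v (fun z => \sum_(i <- r) F i z) (\sum_(i <- r) dF i).
Proof.
move=> H; elim: r => [|i r IH].
  by under eq_fun do rewrite big_nil; rewrite big_nil; exact: is_derive_cst.
under eq_fun do rewrite big_cons; rewrite big_cons; exact: is_deriveD.
Qed.

(** The [l]-th equation says that the field [Y i = \sum_k L i k l * f k] is divergence free. By
    [goursat] its flux vanishes, and the flux is the divergence of the averaged field, that is, the
    [l]-th equation for the averages of the [f k]. *)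
Lemma mol_regular L f d x : (forall k, continuous (f k)) -> 0 < d ->
  (forall y, cube x d y -> (forall k, differentiable (f k) y) /\ regular_at L f y) ->
  regular_at L (fun k => mol d (f k)) x.
Proof.
move=> cf d0 H l.
pose Y i y := \sum_k L i k l * f k y.
have cY i : continuous (Y i).
  by apply: continuous_sum => k; apply: continuous_mul => //; exact: cst_continuous.
have dY i y : (forall k, differentiable (f k) y) ->
    differentiable (Y i) y /\ 'D_(ev i) (Y i) y = \sum_k 'D_(ev i) (f k) y * L i k l.
  move=> df; split.
    rewrite /Y; have -> : (fun y => \sum_k L i k l * f k y) = \sum_k (L i k l \*: f k).
      by apply/funext => z; rewrite fct_sumE.
    by apply: differentiable_sum => k; exact: differentiableZ.
  apply: derive_val; apply: is_derive_bigsum => k.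
  rewrite mulrC; apply: is_deriveZ; apply: derivableP; exact: diff_derivable.
have F0 : flux d Y x = 0.
  apply: goursat => // y xy; have [df rf] := H y xy; split.
    by move=> i; have [] := dY i y df.
  by apply: etrans (rf l); apply: eq_bigr => i _; have [] := dY i y df.
apply: etrans F0; apply: eq_bigr => i _.
have [_ <-] := is_derive_mol d i x (cY i).
symmetry; apply: derive_val.
rewrite /mol /Y avgs_sum//; apply: is_derive_bigsum => k.
rewrite mulrC; apply: is_deriveZ; have H1 := is_derive_mol d i x (cf k).
by apply: derivableP; exact: ex_derive.
Qed.

(** The second averaging acts on functions of class [C^1], where differentiation passes under the
    average; so the equation itself can be averaged. *)
Lemma mol_regular_C1 L f d x : (forall k, Cn 1 (f k)) -> 0 < d ->
  (forall y, cube x d y -> regular_at L f y) ->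
  regular_at L (fun k => mol d (f k)) x.
Proof.
move=> Hf d0 H l.
have cf k := Cn_continuous (Hf k).
have cdf i k : continuous ('D_(ev i) (f k)) := Cn_continuous (Cn_derive i (Hf k)).
have E i k : 'D_(ev i) (mol d (f k)) x = mol d ('D_(ev i) (f k)) x.
  by apply: derive_val; apply: is_derive_avgs => // y; exact: Cn_is_derive (Hf k).
under eq_bigr do under eq_bigr do rewrite E mulrC.
have c1 i : continuous (fun x => \sum_k L i k l * 'D_(ev i) (f k) x).
  by apply: continuous_sum => k; apply: continuous_mul; [exact: cst_continuous|exact: cdf].
have -> : \sum_i \sum_k L i k l * mol d ('D_(ev i) (f k)) x =
    \sum_i 1 * mol d (fun x => \sum_k L i k l * 'D_(ev i) (f k) x) x.
  by apply: eq_bigr => i _; rewrite /mol avgs_sum// mul1r.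
have -> : \sum_i 1 * mol d (fun x => \sum_k L i k l * 'D_(ev i) (f k) x) x =
    mol d (fun x => \sum_i 1 * \sum_k L i k l * 'D_(ev i) (f k) x) x.
  by rewrite /mol avgs_sum.
apply/eqP; rewrite -normr_le0; apply: avgs_le => //.
- by apply: continuous_sum => i; apply: continuous_mul => //; exact: cst_continuous.
- exact: enum_uniq.
move=> y _ /H/(_ l) e; rewrite normr_le0; apply/eqP; apply: etrans e.
by apply: eq_bigr => i _; rewrite mul1r; apply: eq_bigr => k _; rewrite mulrC.
Qed.

(* The hypothesis says that the conjugate Dirac operator times the Dirac operator
   is the Laplacian. *)
Lemma regular_harmonic L f x :
  (forall i j, L i *m (L j)^T + L j *m (L i)^T = (if i == j then 2 else 0)%:M) ->
  (forall k, Cn 2 (f k)) -> (\forall y \near x, regular_at L f y) ->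
  forall k, laplacian (f k) x = 0.
Proof.
move=> HL Hf rf k0.
have E j l : \sum_i \sum_k 'D_(ev j) ('D_(ev i) (f k)) x * L i k l = 0.
  have D : is_derive x (ev j) (fun y => \sum_i \sum_k 'D_(ev i) (f k) y * L i k l)
      (\sum_i \sum_k 'D_(ev j) ('D_(ev i) (f k)) x * L i k l).
    apply: is_derive_bigsum => i; apply: is_derive_bigsum => k.
    under eq_fun do rewrite mulrC; rewrite mulrC; apply: is_deriveZ.
    exact: Cn_is_derive (Cn_derive i (Hf k)).
  have [_ <-] := D.
  rewrite (@near_eq_derive _ _ _ _ (fun=> 0)).
    exact: derive_cst.
  by apply: filterS rf => y; exact.
(* Contracting the [j]-th derivative of the equation with [(L j)^T] pairs the second derivatives
   with [L i *m (L j)^T]. As they are symmetric in [i] and [j], the matrices can be symmetrised too,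
   and by [HL] only twice the Laplacian survives. *)
pose q i j k := 'D_(ev j) ('D_(ev i) (f k)) x.
have S0 : \sum_i \sum_j \sum_k q i j k * (L i *m (L j)^T) k k0 = 0.
  rewrite exchange_big; apply: big1 => j _ /=.
  transitivity (\sum_l L j k0 l * \sum_i \sum_k q i j k * L i k l); last first.
    by apply: big1 => l _; rewrite E mulr0.
  under [RHS]eq_bigr do rewrite mulr_sumr.
  rewrite [RHS]exchange_big; apply: eq_bigr => i _ /=.
  under [RHS]eq_bigr do rewrite mulr_sumr.
  rewrite [RHS]exchange_big; apply: eq_bigr => k _ /=.
  rewrite mxE mulr_sumr; apply: eq_bigr => l _; rewrite mxE; ring.
have S1 : \sum_i \sum_j \sum_k q i j k * (L j *m (L i)^T) k k0 = 0.
  rewrite exchange_big -[RHS]S0; apply: eq_bigr => i _; apply: eq_bigr => j _.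
  by apply: eq_bigr => k _; rewrite /q schwarz.
have : \sum_i \sum_j \sum_k q i j k * (if i == j then 2 else 0)%:M k k0 = 0 :> R.
  apply: etrans (etrans (congr2 +%R S0 S1) (addr0 0)).
  rewrite -big_split; apply: eq_bigr => i _.
  rewrite -big_split; apply: eq_bigr => j _; rewrite -big_split; apply: eq_bigr => k _.
  by rewrite -HL mxE mulrDr.
have -> : \sum_i \sum_j \sum_k q i j k * (if i == j then 2 else 0)%:M k k0 =
    2 * laplacian (f k0) x :> R.
  rewrite /laplacian mulr_sumr; apply: eq_bigr => i _.
  rewrite (bigD1 i)//= eqxx [X in _ + X]big1 ?addr0; last first.
    move=> j ji; apply: big1 => k _; rewrite eq_sym (negbTE ji).
    by rewrite mxE mul0rn mulr0.
  rewrite (bigD1 k0)//= big1 ?addr0; last first.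
    by move=> k kk; rewrite mxE (negbTE kk) mulr0.
  by rewrite mxE eqxx mulr1n mulrC.
by move=> /eqP; rewrite mulf_eq0 pnatr_eq0 => /eqP.
Qed.

Lemma compact_unif_continuous g (K : set 'rV[R]_n) e : continuous g -> compact K -> 0 < e ->
  exists2 r, 0 < r & forall x y, K x -> (forall j, `|y 0 j - x 0 j| < r) -> `|g y - g x| <= e.
Proof.
move=> cg /compact_near_coveringP cK e0.
pose P (u x' : 'rV[R]_n) := `|g (u + x') - g x'| <= e.
have /(cK _ (nbhs (0 : 'rV[R]_n)) P _) : forall x, K x ->
    \forall x' \near x & u \near (0 : 'rV[R]_n), P u x'.
  move=> x _; have e2 : 0 < e / 2 by rewrite divr_gt0.
  have /cvgrPdist_le/(_ _ e2) c1 := cg x.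
  have /cvgrPdist_le/(_ _ e2) c2 : g (q.1 + q.2) @[q --> ((0 : 'rV[R]_n), x)] --> g (0 + x).
    apply: (@cvg_comp _ _ _ (fun q : 'rV[R]_n * 'rV[R]_n => q.1 + q.2) g _ (nbhs (0 + x))).
      by apply: cvgD; [exact: cvg_fst|exact: cvg_snd].
    exact: cg.
  case: c2 => -[A B] /= [A1 B1] AB.
  exists ([set y | B y /\ `|g x - g y| <= e / 2], A) => /=.
    by split=> //; exact: filterI.
  move=> [x' u] /= [[Bx' gx'] Au].
  have /= := AB (u, x') (conj Au Bx'); rewrite add0r => h.
  rewrite /P /= -(subrKA (g x)) (le_trans (ler_normD _ _))// (splitr e) lerD// distrC//.
move=> /nbhs_ballP[r /= r0 Hr]; exists r => // x y Kx xy.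
have b : ball (0 : 'rV[R]_n) r (y - x).
  by split=> // a j; rewrite (ord1 a) /ball /= !mxE sub0r normrN; exact: xy.
by have := Hr _ b x Kx; rewrite /P subrK.
Qed.

Lemma cube_sub x y z d : cube x d y -> cube y d z -> cube x (d + d) z.
Proof.
by move=> h1 h2 j; have /andP[a b] := h1 j; have /andP[a' b'] := h2 j; apply/andP; split; lra.
Qed.

Lemma cube_norm x y d : 0 <= d -> cube x d y -> forall j, `|y 0 j - x 0 j| <= d.
Proof.
by move=> d0 h j; have /andP[a b] := h j; rewrite ler_norml; apply/andP; split; lra.
Qed.

Lemma mol_close g d e x : continuous g -> 0 < d ->
  (forall y, cube x (d + d) y -> `|g y - g x| <= e) -> `|mol d (mol d g) x - g x| <= e.
Proof.
move=> cg d0 H; have dn0 : d != 0 by rewrite gt_eqF.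
have cc c : continuous (fun _ : 'rV[R]_n => c : R) by exact: cst_continuous.
pose G y := 1 * g y + (-1) * g x.
have cG : continuous G.
  by apply: continuous_add; apply: continuous_mul.
have -> : mol d (mol d g) x - g x = mol d (mol d G) x.
  have mc : mol d (fun _ : 'rV[R]_n => g x) = (fun=> g x) by apply: funext => y; exact: avgs_cst dn0.
  have -> : mol d G = (fun y => 1 * mol d g y + (-1) * mol d (fun=> g x) y).
    exact: avgs_lin cg (cc _).
  have cm : continuous (mol d g) := avgs_continuous cg.
  have -> : mol d (fun y => 1 * mol d g y + (-1) * mol d (fun=> g x) y) =
      (fun y => 1 * mol d (mol d g) y + (-1) * mol d (mol d (fun=> g x)) y).
    by apply: avgs_lin cm _; rewrite mc; exact: cc.
  by rewrite !mc mul1r mulN1r.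
apply: avgs_le; [exact: avgs_continuous|exact: enum_uniq|by []|].
move=> y _ xy; apply: avgs_le => //; first exact: enum_uniq.
by move=> z _ yz; rewrite /G mul1r mulN1r; apply: H; exact: cube_sub yz.
Qed.

Theorem regular_approx L (f : 'I_m -> 'rV[R]_n -> R) (K : set 'rV[R]_n) eta e :
  (forall i j, L i *m (L j)^T + L j *m (L i)^T = (if i == j then 2 else 0)%:M) ->
  (forall k, continuous (f k)) -> compact K -> 0 < eta -> 0 < e ->
  (forall x y, K x -> (forall j, `|y 0 j - x 0 j| <= eta) ->
     (forall k, differentiable (f k) y) /\ regular_at L f y) ->
  exists h : 'I_m -> 'rV[R]_n -> R, [/\ forall k, Cn 2 (h k),
    forall k x, K x -> laplacian (h k) x = 0 & forall k x, K x -> `|h k x - f k x| <= e].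
Proof.
move=> HL cf cK eta0 e0 Hf.
have [r r0 Hr] : exists2 r, 0 < r & forall k x y, K x -> (forall j, `|y 0 j - x 0 j| < r) ->
    `|f k y - f k x| <= e.
  have H k := cid2 (compact_unif_continuous (cf k) cK e0).
  exists (\big[Num.min/1]_k s2val (H k)).
    apply: lt_bigmin => //; last by move=> k _; exact: (s2valP (H k)).
  move=> k x y Kx xy; apply: (s2valP' (H k)) => // j; apply: lt_le_trans (xy j) _.
  exact: bigmin_le.
(* Two averagings reach as far as [d + d]. This must be less than [r] for closeness, and at most
   [eta / 2] for regularity, the other [eta / 2] being spent on moving [x] to a nearby [y]: the
   equation is needed in a neighbourhood of [x]. *)
pose d := Num.min r (eta / 2) / 4.
have mn0 : 0 < Num.min r (eta / 2) by rewrite lt_min r0 divr_gt0.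
have d0 : 0 < d by rewrite divr_gt0.
have dr : d + d < r.
  have : Num.min r (eta / 2) <= r by rewrite ge_min lexx.
  rewrite /d; lra.
have de : d + d <= eta / 2.
  have : Num.min r (eta / 2) <= eta / 2 by rewrite ge_min lexx orbT.
  rewrite /d; lra.
exists (fun k => mol d (mol d (f k))); split.
- by move=> k; apply: Cn_mol; apply: Cn_mol; split.
- move=> k x Kx; apply: (regular_harmonic HL (f := fun k => mol d (mol d (f k)))).
    by move=> a; apply: Cn_mol; apply: Cn_mol; split.
  have eta2 : 0 < eta / 2 by rewrite divr_gt0.
  near=> y.
  have yx : forall j, `|y 0 j - x 0 j| <= eta / 2.
    move=> j; apply: le_trans (_ : `|y - x| <= _).
      rewrite [leRHS]mx_normrE; apply: le_trans (le_bigmax _ _ (0, j)).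
      by rewrite !mxE.
    rewrite distrC ltW//; near: y; exact: cvgr_dist_lt.
  apply: mol_regular_C1 => //; first by move=> a; apply: Cn_mol; split.
  move=> z yz; apply: mol_regular => // w zw.
  apply: (Hf x) => // j; have := cube_norm (ltW (addr_gt0 d0 d0)) (cube_sub yz zw) j.
  by move=> h; rewrite -(subrKA (y 0 j)) (le_trans (ler_normD _ _))//; have := yx j; lra.
- move=> k x Kx; apply: mol_close => // y xy; apply: Hr => // j.
  by apply: le_lt_trans dr; apply: cube_norm => //; rewrite addr_ge0// ltW.
Unshelve. all: by end_near.
Qed.

End RegularApproximation.

(** * Interior gradient estimate *)

Section DerivativeTests.
Context {R : realType}.
Implicit Types (g : R -> R) (r : R).

Lemma is_derive_gt0_near g (l : R) : is_derive (0 : R) 1 g l -> 0 < l -> exists2 r, 0 < r &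
  forall h, `|h| < r -> h != 0 -> 0 < h^-1 * (g h - g 0).
Proof.
move=> [/cvg_ex[/= l' dg] e] l0; have E : l' = l by rewrite -e; apply/esym/cvg_lim.
move: dg; rewrite E => /cvgrPdist_lt/(_ _ l0) [r /= r0 Hr]; exists r => // h hr h0.
have := Hr h; rewrite /ball_ /= sub0r normrN => /(_ hr h0).
rewrite addr0 [h *: 1]mulr1 -[_ *: _]/(_ * _) ltr_norml => /andP[_].
by rewrite gtrBl.
Qed.

Lemma derive_le0 g (l d : R) : is_derive (0 : R) 1 g l -> 0 < d -> g 0 = 0 ->
  (forall s, 0 < s <= d -> g s <= 0) -> l <= 0.
Proof.
move=> dg d0 g0 H; rewrite leNgt; apply/negP => l0.
have [r r0 Hr] := is_derive_gt0_near dg l0.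
pose h := Num.min (r / 2) d.
have h0 : 0 < h by rewrite lt_min d0 divr_gt0.
have hr : h < r by rewrite /h gt_min ltr_pdivrMr// ltr_pMr// ltr1n.
have := Hr h; rewrite gtr0_norm// => /(_ hr); rewrite gt_eqF// => /(_ isT).
rewrite g0 subr0 pmulr_rgt0 ?invr_gt0// ltNge H//.
by rewrite h0 /h ge_min lexx orbT.
Qed.

(** The derivative [g1] vanishes at the maximum. If [l] were positive, [g1] would be positive just
    to the right of 0, and [g] would exceed [g 0] there by the mean value theorem. *)
Lemma second_derivative_test g g1 (l r : R) : (forall s : R, is_derive s 1 g (g1 s)) ->
  is_derive (0 : R) 1 g1 l -> 0 < r -> (forall s, `|s| < r -> g s <= g 0) -> l <= 0.
Proof.
move=> dg dg1 r0 H; rewrite leNgt; apply/negP => l0.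
have r2 : 0 < r / 2 by rewrite divr_gt0.
have r2r : r / 2 < r by rewrite ltr_pdivrMr// ltr_pMr// ltr1n.
have g10 : g1 0 = 0.
  apply/eqP; rewrite eq_le; apply/andP; split.
    have dg' : is_derive (0 : R) 1 (fun s => g s - g 0) (g1 0).
      by rewrite -[X in is_derive _ _ _ X]subr0; apply: is_deriveB.
    apply: (derive_le0 dg' r2); rewrite ?subrr// => s /andP[s0 sr].
    by rewrite subr_le0 H// gtr0_norm// (le_lt_trans sr).
  have dg' : is_derive (0 : R) 1 (fun s => g (- s) - g 0) (- g1 0).
    rewrite -[X in is_derive _ _ _ X]subr0; apply: is_deriveB.
    by rewrite -mulrN1; apply: (@is_derive1_comp R g -%R); rewrite oppr0.
  rewrite -oppr_le0; apply: (derive_le0 dg' r2); rewrite ?oppr0 ?subrr// => s /andP[s0 sr].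
  by rewrite subr_le0 H// normrN gtr0_norm// (le_lt_trans sr).
have [r' r'0 Hr] := is_derive_gt0_near dg1 l0.
pose h := Num.min (r / 2) (r' / 2).
have h0 : 0 < h by rewrite lt_min r2 divr_gt0.
have hr : h < r by rewrite /h gt_min r2r.
have hr' : h < r' by rewrite /h gt_min orbC ltr_pdivrMr// ltr_pMr// ltr1n.
have cg : {within `[0, h], continuous g}.
  by apply: continuous_subspaceT => t; exact: is_derive_continuous (dg t).
have [c /itvP ch e] := MVT h0 (fun x _ => dg x) cg.
have c0 : 0 < c by rewrite ch.
have := Hr c; rewrite gtr0_norm// gt_eqF// g10 subr0 pmulr_rgt0 ?invr_gt0//.
have cr : c < r' by apply: lt_trans hr'; rewrite ch.
move=> /(_ cr isT) gc.
have := H h; rewrite gtr0_norm// => /(_ hr).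
by rewrite -subr_le0 e subr0 leNgt mulr_gt0.
Qed.

End DerivativeTests.

(** * Gradient bounds for harmonic functions by reflection and a barrier *)

Section GradientEstimate.
Context {R : realType} {n : nat}.
Implicit Types (u f : 'rV[R]_n -> R) (x y p : 'rV[R]_n).

Definition reflect_coord p i x : 'rV[R]_n := x - (2 * (x 0 i - p 0 i)) *: ev i.

Definition refl_sign (i j : 'I_n) : R := if j == i then -1 else 1.

Lemma reflect_coord_line p i j x (t : R) : reflect_coord p i (t *: ev j + x) =
  (refl_sign i j * t) *: ev j + reflect_coord p i x.
Proof.
apply/rowP => k; rewrite /reflect_coord /refl_sign !mxE eqxx /= (eq_sym i j).
have [->|ji] := eqVneq j i; first by case: eqVneq => _ /=; ring.
by rewrite /=; ring.
Qed.

Lemma reflect_coordE p i x k : reflect_coord p i x 0 k - p 0 k = refl_sign i k * (x 0 k - p 0 k).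
Proof.
rewrite /reflect_coord /refl_sign !mxE eqxx/=.
by case: eqVneq => [->|_] /=; ring.
Qed.

Lemma reflect_coord_continuous p i : continuous (reflect_coord p i).
Proof.
apply: continuous_row => k.
have -> : (fun x => reflect_coord p i x 0 k) = (fun x => refl_sign i k * (x 0 k - p 0 k) + p 0 k).
  by apply/funext => x; rewrite -reflect_coordE subrK.
apply: continuous_add; last exact: cst_continuous.
apply: continuous_mul; first exact: cst_continuous.
apply: continuous_add; [exact: coord_continuous|exact: cst_continuous].
Qed.

Lemma is_derive_reflect p i j f x d : is_derive (reflect_coord p i x) (ev j) f d ->
  is_derive x (ev j) (fun y => f (reflect_coord p i y)) (refl_sign i j * d).
Proof.
move=> /is_derive_line0 df; apply/is_derive_line0.
under eq_fun do rewrite reflect_coord_line.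
rewrite mulrC; apply: (@is_derive1_comp R (fun t => f (t *: ev j + reflect_coord p i x))
  (fun t => refl_sign i j * t)); first by rewrite mulr0.
by rewrite -[X in is_derive _ _ _ X]mulr1; apply: is_deriveZ.
Qed.

(* For [c = (n + 1) d] and [kappa = M / d ^ 2] this is superharmonic, nonnegative
   on the half cube [0 <= x_i - p_i <= d], [`|x_j - p_j| <= d], and at least [M] on
   all its faces but [x_i = p_i]. *)
Definition barrier (kappa c : R) p i x :=
  kappa * (\sum_j (if j == i then - n%:R else 1) * (x 0 j - p 0 j) ^+ 2 + c * (x 0 i - p 0 i)).

Lemma is_derive_barrier kappa c p i j x : is_derive x (ev j) (barrier kappa c p i)
  (kappa * (2 * (if j == i then - n%:R else 1) * (x 0 j - p 0 j) + c * (j == i)%:R)).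
Proof.
have dc k : is_derive x (ev j) (fun x : 'rV[R]_n => x 0 k - p 0 k) (j == k)%:R.
  rewrite -[X in is_derive _ _ _ X]subr0; apply: is_deriveB.
  have -> : (j == k)%:R = ev j 0 k :> R by rewrite !mxE eqxx /= eq_sym.
  exact: is_derive_coord.
apply: is_deriveZ; apply: is_deriveD.
have -> : 2 * (if j == i then - n%:R else 1) * (x 0 j - p 0 j) =
    \sum_k (if k == i then - n%:R else 1) * ((x 0 k - p 0 k) * (j == k)%:R + (x 0 k - p 0 k) * (j == k)%:R) :> R.
  rewrite (bigD1 j)//= eqxx big1 ?addr0/= ?mulr1; first by rewrite -mulrA mulr_natl -mulr2n mulrnAr.
  by move=> k kj; rewrite (eq_sym j) (negbTE kj) !mulr0 addr0 mulr0.
apply: is_derive_bigsum => k; apply: is_deriveZ.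
under eq_fun do rewrite expr2; exact: is_deriveM.
Qed.

Lemma is_derive_barrier2 kappa c p i j x :
  is_derive x (ev j) (fun x : 'rV[R]_n => kappa * (2 * (if j == i then - n%:R else 1) * (x 0 j - p 0 j) +
    c * (j == i)%:R)) (kappa * (2 * (if j == i then - n%:R else 1))).
Proof.
apply: is_deriveZ; rewrite -[X in is_derive _ _ _ X]addr0; apply: is_deriveD.
rewrite -[X in is_derive _ _ _ X]mulr1; apply: is_deriveZ.
rewrite -[X in is_derive _ _ _ X]subr0; apply: is_deriveB.
have -> : 1 = ev j 0 j :> R by rewrite !mxE !eqxx.
exact: is_derive_coord.
Qed.

(* On the face [x_i = p_i] of the half cube the odd part of [u] under reflection
   vanishes, so by the maximum principle it is dominated by the barrier; compare
   the derivatives at [p]. *)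
Lemma gradient_one_sided u p i d M : Cn 2 u -> 0 < d -> 0 < M ->
  (forall y, (forall j, `|y 0 j - p 0 j| <= d) -> `|u y| <= M /\ laplacian u y = 0) ->
  'D_(ev i) u p <= (n%:R + 1) * M / d.
Proof.
move=> Hu d0 M0 H.
pose kappa := M / d ^+ 2; pose c := (n%:R + 1) * d.
have kappa0 : 0 < kappa by rewrite divr_gt0// exprn_gt0.
pose rho := reflect_coord p i.
pose w x := 2^-1 * (u x - u (rho x)) - barrier kappa c p i x.
pose w1 j x := 2^-1 * ('D_(ev j) u x - refl_sign i j * 'D_(ev j) u (rho x)) -
  kappa * (2 * (if j == i then - n%:R else 1) * (x 0 j - p 0 j) + c * (j == i)%:R).
have dw j x : is_derive x (ev j) w (w1 j x).
  apply: is_deriveB; last exact: is_derive_barrier.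
  apply: is_deriveZ; apply: is_deriveB; first exact: Cn_is_derive Hu.
  by apply: is_derive_reflect; exact: Cn_is_derive Hu.
have dw1 j x : is_derive x (ev j) (w1 j) (2^-1 * ('D_(ev j) ('D_(ev j) u) x -
    refl_sign i j * (refl_sign i j * 'D_(ev j) ('D_(ev j) u) (rho x))) -
    kappa * (2 * (if j == i then - n%:R else 1))).
  apply: is_deriveB; last exact: is_derive_barrier2.
  apply: is_deriveZ; apply: is_deriveB; first exact: Cn_is_derive (Cn_derive j Hu).
  apply: is_deriveZ; apply: (is_derive_reflect (f := 'D_(ev j) u)).
  exact: Cn_is_derive (Cn_derive j Hu).
have cw : continuous w.
  have cb k : continuous (fun x : 'rV[R]_n => x 0 k - p 0 k).
    by apply: continuous_add; [exact: coord_continuous|exact: cst_continuous].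
  have cu := Cn_continuous Hu.
  have cr := continuous_comp_fun (reflect_coord_continuous (p := p) (i := i)) cu.
  have cst1 (a : R) : continuous (fun _ : 'rV[R]_n => a) by exact: cst_continuous.
  apply: (continuous_sub (continuous_mul (cst1 _) (continuous_sub cu cr))).
  apply: (continuous_mul (cst1 kappa)).
  apply: (continuous_add _ (continuous_mul (cst1 c) (cb i))).
  apply: continuous_sum => k; apply: (continuous_mul (cst1 _)).
  by under eq_fun do rewrite expr2; exact: (continuous_mul (cb k) (cb k)).
have wle x : (forall j, `|x 0 j - p 0 j| <= d) -> 0 <= x 0 i - p 0 i -> w x <= 0.
  (* The half cube as a product of segments, which makes it compact; [QP] returns to the description
     by norms. *)
  pose A j := if j == i then `[p 0 i, p 0 i + d]%classic else `[p 0 j - d, p 0 j + d]%classic.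
  pose Q := [set y : 'rV[R]_n | forall j, A j (y 0 j)].
  have QP y : Q y <-> (forall j, `|y 0 j - p 0 j| <= d) /\ 0 <= y 0 i - p 0 i.
    split=> [Qy|[y1 y2] j].
      have yi : 0 <= y 0 i - p 0 i <= d.
        by have := Qy i; rewrite /A eqxx /= in_itv/=; lra.
      split; last by case/andP: yi.
      move=> j; have := Qy j; rewrite /A; have [->|_] := eqVneq j i.
        by move=> _; rewrite ger0_norm; case/andP: yi.
      by rewrite /= in_itv/= ler_norml; lra.
    have := y1 j; rewrite /A; have [->|_] := eqVneq j i; rewrite /= in_itv/= ler_norml; lra.
  have cQ : compact Q.
    by apply: rV_compact => j; rewrite /A; case: ifP => _; exact: segment_compact.
  move=> x1 x2; have Qx : Q x by apply/QP.
  have cQw : {within Q, continuous w} by exact: continuous_subspaceT.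
  have [y /set_mem/QP[y1 y2] ymax] := EVT_max_rV (ex_intro _ x Qx) cQ cQw.
  apply: le_trans (ymax x (mem_set Qx)) _ => {x x1 x2 Qx}.
  have Mb (z : 'rV[R]_n) : (forall j, `|z 0 j - p 0 j| <= d) -> `|u z| <= M by move=> /H[].
  have ry : forall j, `|rho y 0 j - p 0 j| <= d.
    move=> j; rewrite /rho reflect_coordE normrM /refl_sign.
    by case: ifP => _; rewrite ?normrN normr1 mul1r.
  have phiM : 2^-1 * (u y - u (rho y)) <= M.
    by have := Mb _ y1; have := Mb _ ry; rewrite !ler_norml; lra.
  have zi : y 0 i - p 0 i <= d by apply: le_trans (y1 i); exact: ler_norm.
  have S : barrier kappa c p i y = kappa * (\sum_(j | j != i) (y 0 j - p 0 j) ^+ 2 +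
      (y 0 i - p 0 i) * (c - n%:R * (y 0 i - p 0 i))).
    rewrite /barrier (bigD1 i)//= eqxx; congr (_ * _).
    under eq_bigr => j ji do rewrite (negbTE ji) mul1r.
    ring.
  have S0 : 0 <= \sum_(j | j != i) (y 0 j - p 0 j) ^+ 2 by apply: sumr_ge0 => j _; exact: sqr_ge0.
  have nz : n%:R * (y 0 i - p 0 i) <= n%:R * d by rewrite ler_wpM2l.
  have P0 : 0 <= (y 0 i - p 0 i) * (c - n%:R * (y 0 i - p 0 i)).
    by apply: mulr_ge0 => //; rewrite /c; lra.
  have kd : kappa * d ^+ 2 = M by rewrite /kappa divfK// expf_eq0/= gt_eqF.
  have [yi0|yi0] := eqVneq (y 0 i - p 0 i) 0.
    have -> : w y = - barrier kappa c p i y.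
      rewrite /w /rho /reflect_coord yi0 mulr0 scale0r subr0 subrr mulr0; ring.
    by rewrite oppr_le0 S mulr_ge0 ?(ltW kappa0)// addr_ge0.
  have [yid|yid] := eqVneq (y 0 i - p 0 i) d.
    rewrite subr_le0; apply: le_trans phiM _; rewrite S yid -{1}kd ler_pM2l//.
    have -> : d * (c - n%:R * d) = d ^+ 2 by rewrite /c; ring.
    by rewrite lerDr.
  have [|/existsPn yj] := boolP [exists j, (j != i) && (`|y 0 j - p 0 j| == d)].
    move=> /existsP[j /andP[ji /eqP jd]].
    rewrite subr_le0; apply: le_trans phiM _; rewrite S -{1}kd ler_pM2l//.
    rewrite (bigD1 j)//= -(@real_normK _ (y 0 j - p 0 j)) ?num_real// jd -addrA lerDl.
    by rewrite addr_ge0//; apply: sumr_ge0 => k _; exact: sqr_ge0.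
  (* At an interior maximum all pure second derivatives of [w] are at most 0. Their sum is
     [2 * kappa > 0]: the odd part of [u] is harmonic, and the coefficients of the squares in the
     barrier add up to [- n + (n - 1) = - 1]. *)
  exfalso.
  have yint j : `|y 0 j - p 0 j| < d /\ (j == i -> 0 < y 0 j - p 0 j).
    have [->|ji] := eqVneq j i.
      rewrite ger0_norm// lt_neqAle yid zi; split=> // _.
      by rewrite lt_neqAle eq_sym yi0.
    split=> //; rewrite lt_neqAle y1 andbT.
    by have := yj j; rewrite ji.
  have neg j : 2^-1 * ('D_(ev j) ('D_(ev j) u) y -
    refl_sign i j * (refl_sign i j * 'D_(ev j) ('D_(ev j) u) (rho y))) -
    kappa * (2 * (if j == i then - n%:R else 1)) <= 0.
    pose r := Num.min (d - `|y 0 j - p 0 j|) (if j == i then y 0 j - p 0 j else 1).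
    have r0 : 0 < r.
      have [h1 h2] := yint j; rewrite lt_min subr_gt0 h1 /=.
      by case: ifP h2 => // _ /(_ isT).
    apply: (@second_derivative_test _ (fun s => w (s *: ev j + y)) (fun s => w1 j (s *: ev j + y)) _ r).
    - by move=> s; apply: (iffRL (is_derive_line _ _ _ _ _)); exact: dw.
    - by apply: (iffRL (is_derive_line0 _ _ _ _)); exact: dw1.
    - exact: r0.
    move=> s sr; rewrite scale0r add0r; apply: ymax; apply/mem_set/QP.
    have sd : `|s| < d - `|y 0 j - p 0 j| by apply: lt_le_trans sr _; rewrite /r ge_min lexx.
    split.
      move=> k; rewrite !mxE eqxx/=; have [->|kj] := eqVneq k j; last by rewrite mulr0 add0r.
      by rewrite mulr1 -addrA (le_trans (ler_normD _ _))//; lra.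
    rewrite !mxE eqxx/=; have [ij|ij] := eqVneq i j; last by rewrite mulr0 add0r.
    have : `|s| < y 0 j - p 0 j.
      by apply: lt_le_trans sr _; rewrite /r -ij eqxx ge_min lexx orbT.
    by rewrite ij mulr1 ltr_norml; lra.
  have : \sum_j (2^-1 * ('D_(ev j) ('D_(ev j) u) y -
    refl_sign i j * (refl_sign i j * 'D_(ev j) ('D_(ev j) u) (rho y))) -
    kappa * (2 * (if j == i then - n%:R else 1))) <= 0 by apply: sumr_le0 => j _; exact: neg.
  have rs j a : refl_sign i j * (refl_sign i j * a) = a.
    by rewrite /refl_sign; case: ifP => _; ring.
  under eq_bigr do rewrite rs.
  rewrite sumrB -mulr_sumr sumrB -/(laplacian u y) -/(laplacian u (rho y)).
  rewrite (H _ y1).2 (H _ ry).2 subrr mulr0 sub0r -mulr_sumr -mulr_sumr.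
  have -> : \sum_j (if j == i then - n%:R else 1) = - 1 :> R.
    rewrite (bigD1 i)//= eqxx.
    under eq_bigr => j ji do rewrite (negbTE ji).
    have := cardC1 i; rewrite card_ord sumr_const => ->.
    have n0 : (0 < n)%N by apply: leq_ltn_trans (ltn_ord i).
    by rewrite -{1}(prednK n0) -natr1; ring.
  by rewrite oppr_le0 leNgt => /negP; apply; rewrite mulrN1 mulrN -oppr_gt0 opprK mulr_gt0.
have E : is_derive (0 : R) 1 (fun s => w (s *: ev i + p)) (w1 i p).
  by apply: (iffRL (is_derive_line0 _ _ _ _)); exact: dw.
have rhop : rho p = p by rewrite /rho /reflect_coord subrr mulr0 scale0r subr0.
(* [w] is 0 at [p] and at most 0 on a segment leaving [p] along [e_i]. The odd part of [u] has the
   same [i]-th derivative at [p] as [u], and the barrier has [kappa * c], which is the asserted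
   bound. *)
have : w1 i p <= 0.
  apply: (derive_le0 E d0).
    rewrite scale0r add0r /w rhop subrr mulr0 /barrier subrr mulr0 addr0.
    by rewrite big1 ?mulr0 ?subr0// => j _; rewrite subrr expr0n mulr0.
  move=> s /andP[s0 sd]; apply: wle.
    move=> j; rewrite !mxE eqxx/= addrK; case: eqVneq => _; rewrite ?mulr1 ?mulr0.
      by rewrite gtr0_norm.
    by rewrite normr0 ltW.
  by rewrite !mxE !eqxx mulr1 addrK ltW.
rewrite /w1 rhop subrr mulr0 add0r eqxx mulr1 /refl_sign eqxx.
have -> : 2^-1 * ('D_(ev i) u p - -1 * 'D_(ev i) u p) = 'D_(ev i) u p by field.
rewrite subr_le0; suff -> : kappa * c = (n%:R + 1) * M / d by [].
by rewrite /kappa /c; field; rewrite gt_eqF.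
Qed.

Theorem gradient_estimate u p i d M : Cn 2 u -> 0 < d -> 0 < M ->
  (forall y, (forall j, `|y 0 j - p 0 j| <= d) -> `|u y| <= M /\ laplacian u y = 0) ->
  `|'D_(ev i) u p| <= (n%:R + 1) * M / d.
Proof.
move=> Hu d0 M0 H; rewrite ler_norml; apply/andP; split; last exact: gradient_one_sided.
have dN j f x : derivable f x (ev j) -> 'D_(ev j) (fun y => -1 * f y) x = -1 * 'D_(ev j) f x.
  by move=> df; apply: derive_val; apply: is_deriveZ; exact: derivableP.
have Hd j x : derivable u x (ev j) by have := Cn_is_derive x j Hu => D; exact: ex_derive.
have Hdd j x : derivable ('D_(ev j) u) x (ev j).
  by have := Cn_is_derive x j (Cn_derive j Hu) => D; exact: ex_derive.
have E j : 'D_(ev j) (fun y => -1 * u y) = (fun y => -1 * 'D_(ev j) u y).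
  by apply/funext => x; apply: dN; exact: Hd.
have Hu' : Cn 2 (fun y => -1 * u y) by exact: (Cn_mul (Cn_cst 2 (-1)) Hu).
have H' y : (forall j, `|y 0 j - p 0 j| <= d) ->
    `|-1 * u y| <= M /\ laplacian (fun y => -1 * u y) y = 0.
  move=> /H[h1 h2]; split; first by rewrite mulN1r normrN.
  transitivity (\sum_j -1 * 'D_(ev j) ('D_(ev j) u) y).
    by apply: eq_bigr => j _; rewrite E; apply: dN; exact: Hdd.
  by rewrite -mulr_sumr [X in _ * X]h2 mulr0.
rewrite lerNl; apply: le_trans (gradient_one_sided i Hu' d0 M0 H').
by rewrite (dN i u p (Hd i p)) mulN1r.
Qed.

End GradientEstimate.

(** * Determinants and the Piola identity *)

Section MatrixIdentities.
Context {F : numFieldType} {n : nat}.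
Implicit Types (A B J : 'M[F]_n).

Definition set_row A i (v : 'rV[F]_n) : 'M[F]_n :=
  \matrix_(r, k) if r == i then v 0 k else A r k.

Lemma row_coef A r k : row r A 0 k = A r k. Proof. by rewrite mxE. Qed.

Lemma det_set_row A i v : \det (set_row A i v) = \sum_k v 0 k * cofactor A i k.
Proof.
rewrite (expand_det_row _ i); apply: eq_bigr => k _.
rewrite !mxE eqxx; congr (_ * (_ * \det _)).
by apply/matrixP => r c; rewrite !mxE eq_sym (negbTE (neq_lift _ _)).
Qed.

(** Jacobi's formula for the derivative of the determinant at [J] in the direction [J *m B].
    Expansion along the replaced rows gives the trace of [J *m B *m \adj J], and the trace is
    cyclic. *)
Lemma sum_det_set_row J B :
  \sum_i \det (set_row J i (row i (J *m B))) = \tr B * \det J.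
Proof.
transitivity (\tr (J *m B *m \adj J)).
  apply: eq_bigr => i _; rewrite det_set_row [in RHS]mxE.
  by apply: eq_bigr => k _; rewrite !mxE.
by rewrite -mulmxA mxtrace_mulC -mulmxA mul_adj_mx mul_mx_scalar mxtraceZ mulrC.
Qed.

Lemma det_set_row_swap A i j u v : i != j ->
  \det (set_row (set_row A i u) j v) = - \det (set_row (set_row A i v) j u).
Proof.
move=> ij; have -> : set_row (set_row A i v) j u = xrow i j (set_row (set_row A i u) j v).
  apply/matrixP => r k; rewrite !mxE.
  have [->|rj] := eqVneq r j; first by rewrite tpermR (negbTE ij) eqxx.
  have [->|ri] := eqVneq r i; first by rewrite tpermL eqxx.
  have -> : tperm i j r = r by rewrite tpermD// eq_sym.
  by rewrite (negbTE rj) (negbTE ri).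
by rewrite xrowE det_mulmx det_perm odd_tperm ij expr1 mulN1r opprK.
Qed.

Lemma sum_antisym (g : 'I_n -> 'I_n -> F) : (forall i j, i != j -> g i j = - g j i) ->
  \sum_i \sum_(j | j != i) g i j = 0.
Proof.
move=> H; set S := LHS.
have : S = - S.
  rewrite {1}/S (exchange_big_dep xpredT)//= /S -sumrN; apply: eq_bigr => i _.
  rewrite -sumrN; apply: eq_big => j; first by rewrite eq_sym.
  by move=> ij; rewrite H// eq_sym.
by move=> /eqP; rewrite -addr_eq0 -mulr2n mulrn_eq0 => /eqP.
Qed.

End MatrixIdentities.

(** * Divergence of a field pulled back along a map *)

Section Piola.
Context {R : realType}.

Lemma is_derive_prod (V : normedModType R) n (F : 'I_n -> V -> R) (dF : 'I_n -> R) (x v : V) :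
  (forall i, is_derive x v (F i) (dF i)) ->
  is_derive x v (fun y => \prod_i F i y)
    (\sum_r \prod_i (if i == r then dF i else F i x)).
Proof.
elim: n F dF => [|n IH] F dF H.
  by rewrite big_ord0; under eq_fun do rewrite big_ord0; exact: is_derive_cst.
under eq_fun do rewrite big_ord_recl.
have D := is_deriveM (H ord0) (IH (fun i => F (lift ord0 i)) _ (fun i => H (lift ord0 i))).
apply: is_derive_eq D _.
rewrite big_ord_recl addrC; congr (_ + _).
  rewrite big_ord_recl eqxx [RHS]mulrC -[_ *: _]/(_ * _); congr (_ * _).
rewrite -[_ *: _]/(_ * _) mulr_sumr; apply: eq_bigr => r _.
rewrite big_ord_recl /=; congr (_ * _).
Qed.

Lemma is_derive_det (V : normedModType R) n (M : V -> 'M[R]_n) (dM : 'M[R]_n) (x v : V) :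
  (forall r k, is_derive x v (fun y => M y r k) (dM r k)) ->
  is_derive x v (fun y => \det (M y)) (\sum_r \det (set_row (M x) r (row r dM))).
Proof.
move=> H; rewrite exchange_big /=.
apply: is_derive_bigsum => s; rewrite -mulr_sumr; apply: is_deriveZ.
apply: is_derive_eq (is_derive_prod (fun i => H i (s i))) _.
apply: eq_bigr => r _; apply: eq_bigr => i _; rewrite !mxE.
by case: eqVneq => [->|].
Qed.

Lemma continuous_det (T : topologicalType) n (M : T -> 'M[R]_n) :
  (forall r k, continuous (fun y => M y r k)) -> continuous (fun y => \det (M y)).
Proof.
move=> H; apply: continuous_sum => s; apply: continuous_mul; first exact: cst_continuous.
by apply: continuous_prod => i; exact: H.
Qed.

Context {n : nat}.
Variables (G : 'rV[R]_n -> 'rV[R]_n) (a : 'rV[R]_n -> 'rV[R]_n) (B : 'rV[R]_n -> 'M[R]_n).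
Hypothesis G_C2 : forall k, Cn 2 (fun x => G x 0 k).
Hypothesis B_cont : forall l k, continuous (fun x => B x l k).
Hypothesis a_cont : forall k, continuous (fun x => a x 0 k).
Hypothesis trB : forall x, \tr (B x) = 0.

Definition jac x : 'M[R]_n := \matrix_(i, k) 'D_(ev i) (fun y => G y 0 k) x.

Hypothesis a_derive : forall x i k,
  is_derive x (ev i) (fun y => a y 0 k) ((jac x *m B x) i k).

(** Up to the sign [(-1) ^+ i], the coefficient omitting [dx_i] in the pull-back along [G] of the
    form of degree [n - 1] attached to the field [a]. Here [a] stands for a field on the target
    composed with [G], and [B] for the derivative of that field, so [trB] makes it divergence free;
    closedness of the pull-back is [sum_djac_field]. *)
Definition jac_field i x := \det (set_row (jac x) i (a x)).

Definition hess x i : 'M[R]_n :=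
  \matrix_(s, k) 'D_(ev i) ('D_(ev s) (fun y => G y 0 k)) x.

(** The product rule for the determinant: row [i] carries the derivative of [a], every other row a
    row of second derivatives of [G]. *)
Definition djac_field i x := \sum_r
  \det (set_row (set_row (jac x) i (a x)) r
    (row r (set_row (hess x i) i (row i (jac x *m B x))))).

Lemma jac_continuous i k : continuous (fun x => jac x i k).
Proof. by under eq_fun do rewrite mxE; exact: (Cn_continuous (Cn_derive i (G_C2 k))). Qed.

Lemma set_row_continuous (A : 'rV[R]_n -> 'M[R]_n) i (v : 'rV[R]_n -> 'rV[R]_n) :
  (forall r k, continuous (fun x => A x r k)) -> (forall k, continuous (fun x => v x 0 k)) ->
  forall r k, continuous (fun x => set_row (A x) i (v x) r k).
Proof. by move=> cA cv r k; under eq_fun do rewrite mxE; case: eqP => _; [exact: cv|exact: cA]. Qed.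

Lemma jac_field_continuous i : continuous (jac_field i).
Proof. apply: continuous_det; apply: set_row_continuous a_cont; exact: jac_continuous. Qed.

Lemma djac_field_continuous i : continuous (djac_field i).
Proof.
apply: continuous_sum => r; apply: continuous_det; apply: set_row_continuous.
  by apply: set_row_continuous a_cont; exact: jac_continuous.
move=> k; under eq_fun do rewrite [row _ _ _ _]mxE.
apply: set_row_continuous => {r k}.
  move=> r k; under eq_fun do rewrite mxE.
  exact: (Cn_continuous (Cn_derive i (Cn_derive r (G_C2 k)))).
move=> k; under eq_fun do rewrite !mxE; apply: continuous_sum => l.
by apply: continuous_mul; [exact: jac_continuous|exact: B_cont].
Qed.

Lemma is_derive_jac_field i x : is_derive x (ev i) (jac_field i) (djac_field i x).
Proof.
apply: is_derive_det => r k; under eq_fun do rewrite mxE; rewrite mxE.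
case: eqVneq => [_|_]; first by rewrite mxE; exact: a_derive.
under eq_fun do rewrite mxE; rewrite mxE.
exact: Cn_is_derive (Cn_derive r (G_C2 k)).
Qed.

(** The terms in which [a] is differentiated add up to [\tr (B x) * \det (jac x)], which is 0. Those
    in which a row of the Jacobian is differentiated cancel in pairs: exchanging [i] and [r] keeps
    the second derivatives and swaps two rows of the determinant. *)
Lemma sum_djac_field x : \sum_i djac_field i x = 0.
Proof.
pose g i r := \det (set_row (set_row (jac x) i (a x)) r (row r (hess x i))).
have E i : djac_field i x = \det (set_row (jac x) i (row i (jac x *m B x))) +
    \sum_(r | r != i) g i r.
  rewrite /djac_field (bigD1 i)//=; congr (\det _ + _).
    by apply/matrixP => s k; rewrite !mxE eqxx; case: eqVneq.
  apply: eq_bigr => r ri; congr (\det _).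
  by apply/matrixP => s k; rewrite !mxE (negbTE ri).
under eq_bigr do rewrite E.
rewrite big_split /= sum_det_set_row trB mul0r add0r; apply: sum_antisym => i j ij.
have hE r s k : hess x r s k = 'D_(ev r) ('D_(ev s) (fun y => G y 0 k)) x by rewrite mxE.
rewrite /g; have -> : row j (hess x i) = row i (hess x j).
  apply/rowP => k.
  exact (etrans (etrans (row_coef (hess x i) j k) (hE i j k)) (etrans (schwarz x i j (G_C2 k))
    (esym (etrans (row_coef (hess x j) i k) (hE j i k))))).
rewrite det_set_row_swap//; congr (- \det _).
apply/matrixP => s k; rewrite !mxE.
have [->|si] := eqVneq s i; have [sj|sj] := eqVneq _ j => //.
by move: ij; rewrite sj eqxx.
Qed.

End Piola.

(** * Iterated integrals over boxes *)

Section BoxIntegral.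
Context {R : realType} {n : nat} (lo hi : 'I_n -> R).
Implicit Types (F G : 'rV[R]_n -> R) (x y : 'rV[R]_n) (js : seq 'I_n) (i j : 'I_n) (t s : R).

(** Overwrites coordinate [i] by [t]; written as a point of a line, so that [is_derive_line]
    applies. *)
Definition setc x i t := (t - x 0 i) *: ev i + x.

Lemma setcE x i t k : setc x i t 0 k = if k == i then t else x 0 k.
Proof.
rewrite !mxE eqxx /=; case: eqVneq => [->|_]; first by rewrite mulr1 subrK.
by rewrite mulr0 add0r.
Qed.

Lemma setc_comm x i j s t : i != j -> setc (setc x i s) j t = setc (setc x j t) i s.
Proof.
move=> ij; apply/rowP => k; rewrite !setcE.
by case: eqVneq => [->|//]; rewrite eq_sym (negbTE ij).
Qed.

Lemma setc_line x i j s t : i != j -> setc (s *: ev j + x) i t = s *: ev j + setc x i t.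
Proof.
move=> ij; apply/rowP => k; rewrite setcE [in RHS]mxE [X in _ = _ + X]setcE !mxE eqxx/=.
by case: eqVneq => [->|//]; rewrite (negbTE ij) mulr0 add0r.
Qed.

Lemma setc_continuous i : continuous (fun p : 'rV[R]_n * R => setc p.1 i p.2).
Proof.
have cfst k : continuous (fun p : 'rV[R]_n * R => p.1 0 k).
  apply: (@continuous_comp_fun _ _ _ (fun p : 'rV[R]_n * R => p.1) (fun x => x 0 k)).
    by move=> p; exact: cvg_fst.
  exact: coord_continuous.
apply: continuous_row => k; under eq_fun do rewrite setcE.
by case: eqP => _; [move=> p; exact: cvg_snd|exact: cfst].
Qed.

Definition int1 i F x := oint (fun t => F (setc x i t)) (lo i) (hi i).
(** Still a function of the whole vector, constant in the coordinates of [js]: the others remain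
    available as parameters to differentiate in. *)
Definition ints js F := foldr int1 F js.

Lemma setc_comp_continuous i F : continuous F ->
  continuous (fun p : 'rV[R]_n * R => F (setc p.1 i p.2)).
Proof. by move=> cF; exact: (continuous_comp_fun (@setc_continuous i) cF). Qed.

Lemma setc_comp_continuous1 i F x : continuous F -> continuous (fun t => F (setc x i t)).
Proof.
move=> cF; pose H (y : 'rV[R]_n) (t : R) := F (setc y i t).
have cH : continuous (fun p : 'rV[R]_n * R => H p.1 p.2) by exact: setc_comp_continuous.
exact: (uncurry_continuous2 (x := x) cH).
Qed.

Lemma ints_continuous js F : continuous F -> continuous (ints js F).
Proof.
move=> cF; elim: js => //= i js IH.
pose H (y : 'rV[R]_n) (t : R) := ints js F (setc y i t).
have cH : continuous (fun p : 'rV[R]_n * R => H p.1 p.2) by exact: setc_comp_continuous.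
exact: (oint_continuous (F := H)).
Qed.

Lemma is_derive_ints js j F F' x : continuous F -> continuous F' -> j \notin js ->
  (forall y, is_derive y (ev j) F (F' y)) ->
  is_derive x (ev j) (ints js F) (ints js F' x).
Proof.
move=> cF cF' + dF; elim: js x => [|i js IH] x //=.
rewrite in_cons negb_or => /andP[ji jjs].
apply: (@is_derive_under_oint _ _ (fun y t => ints js F (setc y i t))
    (fun y t => ints js F' (setc y i t))).
- by apply: setc_comp_continuous; exact: ints_continuous.
- by apply: setc_comp_continuous; exact: ints_continuous.
move=> y t; apply: (iffLR (is_derive_line0 (fun y => ints js F (setc y i t)) y (ev j) _)).
under eq_fun do rewrite setc_line 1?eq_sym//.
by apply: (iffRL (is_derive_line0 _ _ _ _)); exact: IH.
Qed.

Lemma ints_boundary js i s t G : i \notin js ->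
  (forall x, G (setc x i s) = G (setc x i t)) ->
  forall x, ints js G (setc x i s) = ints js G (setc x i t).
Proof.
move=> + HG; elim: js => //= j js IH; rewrite in_cons negb_or => /andP[ij ijs] x.
by rewrite /int1; apply: eq_oint => u; rewrite (@setc_comm x i j s u ij) (@setc_comm x i j t u ij) IH.
Qed.

Lemma ints0 js x : ints js (fun=> 0) x = 0.
Proof.
elim: js x => //= i js IH x; rewrite /int1.
by under eq_fun do rewrite IH; rewrite oint_cst mul0r.
Qed.

(** When the turn of coordinate [i] comes, the inner integrals commute with the derivative, and the
    fundamental theorem leaves a difference of boundary values. The order of integration is never
    changed. *)
Lemma ints_derive0 js i G G' x : continuous G -> continuous G' -> uniq js -> i \in js ->
  (forall y, is_derive y (ev i) G (G' y)) ->
  (forall y, G (setc y i (lo i)) = G (setc y i (hi i))) -> ints js G' x = 0.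
Proof.
move=> cG cG' + + dG bG; elim: js x => //= j js IH x /andP[jjs ujs].
rewrite in_cons; have [ij _|ij /= ijs] := eqVneq i j; last first.
  by rewrite /int1; under eq_fun do rewrite IH//; rewrite oint_cst mul0r.
subst j; have dI (t : R) : is_derive t 1 (fun t => ints js G (setc x i t)) (ints js G' (setc x i t)).
  pose f (s : R) := ints js G (s *: ev i + x).
  rewrite -[X in is_derive _ _ _ X]mulr1.
  apply: (@is_derive1_comp R f (fun t => t - x 0 i)); last first.
    by rewrite -[X in is_derive _ _ _ X]subr0; apply: is_deriveB.
  apply: (iffRL (is_derive_line (ints js G) x (ev i) _ _)).
  exact: (@is_derive_ints js i G G' (setc x i t) cG cG' jjs dG).
rewrite /int1 (ointP _ _ _ dI).
  by rewrite (ints_boundary jjs bG) subrr.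
by apply: setc_comp_continuous1; exact: ints_continuous.
Qed.

Lemma ints_lin js k l F G : continuous F -> continuous G ->
  ints js (fun x => k * F x + l * G x) = (fun x => k * ints js F x + l * ints js G x).
Proof.
move=> cF cG; elim: js => //= i js ->; apply/funext => x.
by rewrite /int1 oint_lin//; apply: setc_comp_continuous1; exact: ints_continuous.
Qed.

Lemma ints_sum (I : Type) (r : seq I) js (F : I -> 'rV[R]_n -> R) x :
  (forall a, continuous (F a)) ->
  ints js (fun x => \sum_(a <- r) F a x) x = \sum_(a <- r) ints js (F a) x.
Proof.
move=> cF; elim: r => [|a r IH].
  by rewrite big_nil; under eq_fun do rewrite big_nil; exact: ints0.
rewrite big_cons -IH -[X in X + _]mul1r -[X in _ + X]mul1r.
have cS : continuous (fun x => \sum_(a <- r) F a x) by exact: continuous_sum.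
have := ints_lin js 1 1 (cF a) cS; move/(congr1 (fun f => f x)) => /= <-.
by congr (ints _ _ _); apply/funext => y; rewrite big_cons !mul1r.
Qed.

Lemma ints_le js F C x : (forall i, lo i <= hi i) -> continuous F ->
  (forall y, `|F y| <= C) -> `|ints js F x| <= C * \prod_(i <- js) (hi i - lo i).
Proof.
move=> lohi cF HF; elim: js x => [|i js IH] x; first by rewrite big_nil mulr1.
rewrite big_cons mulrCA mulrC /=; apply: oint_le => //.
by apply: setc_comp_continuous1; exact: ints_continuous.
Qed.

Fixpoint setcs x js (ts : seq R) := match js, ts with
  | i :: js', t :: ts' => setcs (setc x i t) js' ts'
  | _, _ => x
  end.

(** Links the Lebesgue integrals of the definitions to the oriented integrals on which the calculus
    is done. *)
Lemma iterated_integralE js F x : (forall i, lo i <= hi i) -> continuous F ->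
  iterated_integral [seq `[lo i, hi i]%classic | i <- js] (fun ts => F (setcs x js ts)) =
  ints js F x.
Proof.
move=> lohi cF; elim: js x => //= i js IH x.
under eq_Rintegral do rewrite IH.
by rewrite RintegralE//; apply: setc_comp_continuous1; exact: ints_continuous.
Qed.

End BoxIntegral.

(** * The solid angle form *)

Section SolidAngleField.
Context {R : realType} {n : nat} (b : 'I_n -> 'I_n -> R).
Implicit Types (w : 'rV[R]_n).

Definition sqnorm w := \sum_m w 0 m ^+ 2.

(* For each fixed [l], the [l]-th coordinate of [q0 w e_k], as a function of [k],
   is of this form, and likewise for [e_k q0 w]. *)
Definition angle_field w : 'rV[R]_n :=
  \row_k ((sqnorm w)^-1 ^+ 4 * \sum_m w 0 m * b m k).

(** Rows index the direction of differentiation, columns the component. The factor 8 arises from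
    differentiating the fourth power of the inverse of a sum of squares. *)
Definition angle_field_jac w : 'M[R]_n := \matrix_(l, k)
  ((sqnorm w)^-1 ^+ 4 * b l k - 8 * (sqnorm w)^-1 ^+ 5 * w 0 l * \sum_m w 0 m * b m k).

Lemma sqnorm_neq0 w : w != 0 -> sqnorm w != 0.
Proof.
apply: contraNneq => /eqP; rewrite psumr_eq0; last by move=> i _; exact: sqr_ge0.
move=> /allP H; apply/eqP/rowP => k; have := H k (mem_index_enum k).
by rewrite sqrf_eq0 mxE => /eqP.
Qed.

Lemma is_derive_invf (V : normedModType R) (f : V -> R) (x v : V) (d : R) :
  f x != 0 -> is_derive x v f d ->
  is_derive x v (fun y => (f y)^-1) (- ((f x)^-1 ^+ 2 * d)).
Proof.
move=> fx df; have D := @ex_derive _ _ _ _ _ _ _ df.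
apply: DeriveDef; first exact: derivableV.
by rewrite deriveV// derive_val exprVn -mulNr.
Qed.

Lemma is_derive_angle_field (V : normedModType R) (G : V -> 'rV[R]_n) (x v : V)
    (dG : 'rV[R]_n) k : (forall m, is_derive x v (fun y => G y 0 m) (dG 0 m)) ->
  G x != 0 -> is_derive x v (fun y => angle_field (G y) 0 k)
    ((dG *m angle_field_jac (G x)) 0 k).
Proof.
move=> HG /sqnorm_neq0 N0.
have dN : is_derive x v (fun y => sqnorm (G y)) (\sum_m (G x 0 m * dG 0 m + G x 0 m * dG 0 m)).
  apply: is_derive_bigsum => m; under eq_fun do rewrite expr2.
  exact: is_deriveM.
have dI := is_derive_invf (f := fun y => sqnorm (G y)) N0 dN.
have dI2 := is_deriveM dI dI; have dI4 := is_deriveM dI2 dI2.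
have dS : is_derive x v (fun y => \sum_m G y 0 m * b m k) (\sum_m b m k * dG 0 m).
  apply: is_derive_bigsum => m; under eq_fun do rewrite mulrC.
  exact: is_deriveZ.
have D := is_deriveM dI4 dS.
have -> : (fun y => angle_field (G y) 0 k) =
    (fun y => ((sqnorm (G y))^-1 * (sqnorm (G y))^-1 * ((sqnorm (G y))^-1 * (sqnorm (G y))^-1)) *
      \sum_m G y 0 m * b m k).
  by apply/funext => y; rewrite mxE -!expr2 -exprM.
apply: is_derive_eq D _; rewrite /GRing.scale /= mxE.
set I := (sqnorm _)^-1; set S := \sum_m _ * b m k.
rewrite big_split /= -/(sqnorm _).
have -> : \sum_l dG 0 l * angle_field_jac (G x) l k =
   I ^+ 4 * (\sum_m b m k * dG 0 m) - 8 * I ^+ 5 * S * \sum_m G x 0 m * dG 0 m.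
  rewrite [X in X - _]mulr_sumr [X in _ - X]mulr_sumr -sumrB.
  by apply: eq_bigr => l _; rewrite mxE -/I -/S; ring.
pose J y := (sqnorm (G y))^-1.
rewrite -[(J * J * (J * J)) x]/(I * I * (I * I)) -[(J * J) x]/(I * I); ring.
Qed.

Hypothesis n8 : n = 8%N.
Variable kappa : R.
Hypothesis bE : forall i j, b i j + b j i = if i == j then 2 * kappa else 0.

(** Only the symmetric part of [b], which is [kappa] times the identity, enters the trace. The first
    term gives [n * kappa] and the second [8 * kappa], both times [(sqnorm w)^-1 ^+ 4]; they agree
    because the dimension is 8. *)
Lemma angle_field_jac_trace w : w != 0 -> \tr (angle_field_jac w) = 0.
Proof.
move=> /sqnorm_neq0 N0.
have bd l : b l l = kappa by have := bE l l; rewrite eqxx; lra.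
set I := (sqnorm w)^-1.
have -> : \tr (angle_field_jac w) = I ^+ 4 * (\sum_l b l l) -
    8 * I ^+ 5 * \sum_l \sum_m w 0 l * w 0 m * b m l.
  rewrite /mxtrace [X in X - _]mulr_sumr [X in _ - X]mulr_sumr -sumrB; apply: eq_bigr => l _.
  rewrite mxE -/I; have -> : \sum_m w 0 l * w 0 m * b m l = w 0 l * \sum_m w 0 m * b m l.
    by rewrite mulr_sumr; apply: eq_bigr => m _; rewrite mulrA.
  ring.
have T : \sum_l \sum_m w 0 l * w 0 m * b m l = kappa * sqnorm w.
  set T := LHS; have : T + T = 2 * (kappa * sqnorm w).
    rewrite {1}/T exchange_big /T /= -big_split /sqnorm !mulr_sumr; apply: eq_bigr => l _.
    rewrite -big_split (bigD1 l)//= big1 ?addr0.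
      by rewrite -mulrDr bE eqxx; ring.
    move=> m ml.
    transitivity (w 0 l * w 0 m * (b m l + b l m)); first by ring.
    by rewrite bE (negbTE ml) mulr0.
  lra.
have -> : \sum_l b l l = 8 * kappa.
  by under eq_bigr do rewrite bd; rewrite sumr_const card_ord n8 mulr_natl.
rewrite T.
have II : I * sqnorm w = 1 by rewrite mulVf.
have -> : 8 * I ^+ 5 * (kappa * sqnorm w) = 8 * I ^+ 4 * kappa * (I * sqnorm w) by ring.
by rewrite II; ring.
Qed.

End SolidAngleField.

(** * Vanishing of the degree *)

Section ZeroDegree.
Context {R : realType}.
Implicit Types (x y w : 'rV[R]_8) (t : 'rV[R]_7).

Definition tail x : 'rV[R]_7 := \row_j x 0 (lift ord0 j).

(* With an eighth angle as the first coordinate, the spheres of all radii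
   at most [eps] are parametrised without leaving the ball, and the image of
   [x_0 = 0] is the centre. *)
Definition ball_param (c : 'rV[R]_8) (eps : R) x := sphere c (eps * sin (x 0 ord0)) (tail x).

Variables (c : 'rV[R]_8) (eps : R).
Local Notation S := (ball_param c eps).

Lemma ball_paramE x l : S x 0 l = c 0 l + eps * sin (x 0 ord0) *
  ((\prod_(j < 7 | (j < l)%N) sin (x 0 (lift ord0 j))) *
   (if (l < 7)%N then cos (x 0 (lift ord0 (inord l))) else 1)).
Proof.
rewrite /ball_param /sphere !mxE; congr (_ + _ * (_ * _)).
by apply: eq_bigr => j _; rewrite mxE.
Qed.

Lemma Cn_ball_param k l : Cn k (fun x => S x 0 l).
Proof.
have [cs cc] : (forall j, Cn k (fun x : 'rV[R]_8 => sin (x 0 j))) /\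
    (forall j, Cn k (fun x : 'rV[R]_8 => cos (x 0 j))).
  by split=> j; have [] := Cn_trig (Cn_coord (R := R) k j).
under eq_fun do rewrite ball_paramE.
apply: (Cn_add (Cn_cst _ _)); apply: Cn_mul; first exact: (Cn_mul (Cn_cst _ _) (cs _)).
apply: Cn_mul.
  exact: (Cn_prod _ _ (fun j : 'I_7 => cs (lift ord0 j))).
by case: (l < 7)%N; [exact: cc|exact: Cn_cst].
Qed.

(** Polar coordinates degenerate: every coordinate of the point that involves angle [j] carries the
    sines of the radial angle and of all angles before [j] as factors. *)
Lemma ball_param_invariant x (j : 'I_7) s :
  (sin (x 0 ord0) = 0 \/ exists2 j' : 'I_7, (j' < j)%N & sin (x 0 (lift ord0 j')) = 0) ->
  S (s *: ev (lift ord0 j) + x) = S x.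
Proof.
move=> H; apply/rowP => l; rewrite !ball_paramE.
have xE (a : 'I_7) : a != j -> (s *: ev (lift ord0 j) + x) 0 (lift ord0 a) = x 0 (lift ord0 a).
  by move=> aj; rewrite !mxE eqxx /= (inj_eq (@lift_inj _ _)) (negbTE aj) mulr0 add0r.
have x0E : (s *: ev (lift ord0 j) + x) 0 ord0 = x 0 ord0.
  by rewrite !mxE /= mulr0 add0r.
rewrite x0E; case: H => [->|[j' j'j sj']]; first by rewrite mulr0 !mul0r.
congr (_ + _ * _).
have jj' : j' != j by rewrite neq_ltn j'j.
have [j'l|lj'] := ltnP j' l.
  by rewrite (bigD1 j')//= [in RHS](bigD1 j')//= xE// sj' !mul0r.
congr (_ * _).
  apply: eq_bigr => a al; rewrite xE// neq_ltn (leq_trans al)//.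
  by rewrite (leq_trans lj')// ltnW.
case: ifP => // l7; rewrite xE//.
by rewrite -val_eqE /= inordK// neq_ltn (leq_ltn_trans lj').
Qed.

Lemma ball_param_periodic x : S ((2 * pi) *: ev ord_max + x) = S x.
Proof.
apply/rowP => l; rewrite !ball_paramE.
have xE a : ((2 * pi) *: ev ord_max + x) 0 a = x 0 a + (pi *+ 2) *+ (a == ord_max).
  rewrite !mxE eqxx /= addrC; case: eqVneq => _; first by rewrite mulr1 mulr_natl mulr1n.
  by rewrite mulr0 mulr0n.
have sE a : sin (((2 * pi) *: ev ord_max + x) 0 a) = sin (x 0 a).
  by rewrite xE; case: eqP => _; rewrite ?mulr1n ?mulr0n ?addr0 ?sinD2pi.
have cE a : cos (((2 * pi) *: ev ord_max + x) 0 a) = cos (x 0 a).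
  by rewrite xE; case: eqP => _; rewrite ?mulr1n ?mulr0n ?addr0 ?cosD2pi.
rewrite sE; congr (_ + _ * (_ * _)); first by apply: eq_bigr => j _; rewrite sE.
by rewrite cE.
Qed.

Variables (h : 'I_8 -> 'rV[R]_8 -> R) (b : 'I_8 -> 'I_8 -> R) (kappa : R).
Hypothesis h_C2 : forall k, Cn 2 (h k).
Hypothesis bE : forall i j, b i j + b j i = if i == j then 2 * kappa else 0.

Definition row_fun w : 'rV[R]_8 := \row_k h k w.
Definition pulled x := row_fun (S x).
Hypothesis pulled_neq0 : forall x, pulled x != 0.

Definition lo (i : 'I_8) : R := 0.
Definition hi (i : 'I_8) : R := if i == ord_max then 2 * pi else pi.
(** The radial angle [ord0] is left out; it stays as the parameter in which the integral is shown to
    be constant. *)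
Definition angles : seq 'I_8 := [seq lift ord0 j | j <- enum 'I_7].

Lemma pulled_C2 k : Cn 2 (fun x => pulled x 0 k).
Proof.
under eq_fun do rewrite mxE.
exact: (Cn_comp (h_C2 k) (fun l => Cn_ball_param 2 l)).
Qed.

Local Notation Q := (jac_field pulled (fun x => angle_field b (pulled x))).
Local Notation dQ := (djac_field pulled (fun x => angle_field b (pulled x))
  (fun x => angle_field_jac b (pulled x))).

Lemma sqnorm_pulled_inv : Cn 2 (fun x => (sqnorm (pulled x))^-1).
Proof.
apply: Cn_inv; first by move=> x; exact: sqnorm_neq0.
apply: Cn_sum => m; under eq_fun do rewrite expr2.
by apply: Cn_mul; exact: pulled_C2.
Qed.

Let cI : continuous (fun x => (sqnorm (pulled x))^-1) := Cn_continuous sqnorm_pulled_inv.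
Let cI4 : continuous (fun x => (sqnorm (pulled x))^-1 ^+ 4).
Proof. exact: continuous_exp. Qed.
Let cI5 : continuous (fun x => (sqnorm (pulled x))^-1 ^+ 5).
Proof. exact: continuous_exp. Qed.
Let cG k : continuous (fun x => pulled x 0 k) := Cn_continuous (pulled_C2 k).
Let ccst (a : R) : continuous (fun _ : 'rV[R]_8 => a).
Proof. exact: cst_continuous. Qed.
Let cB k : continuous (fun x => \sum_m pulled x 0 m * b m k).
Proof. by apply: continuous_sum => m; exact: (continuous_mul (@cG m) (@ccst (b m k))). Qed.

Let ca k : continuous (fun x => angle_field b (pulled x) 0 k).
Proof. by under eq_fun do rewrite mxE; exact: (continuous_mul cI4 (@cB k)). Qed.

Let cJ l k : continuous (fun x => angle_field_jac b (pulled x) l k).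
Proof.
under eq_fun do rewrite mxE.
apply: (continuous_sub (continuous_mul cI4 (@ccst (b l k)))).
exact: (continuous_mul (continuous_mul (continuous_mul (@ccst 8) cI5) (@cG l)) (@cB k)).
Qed.

Let da x i k : is_derive x (ev i) (fun y => angle_field b (pulled y) 0 k)
  ((jac pulled x *m angle_field_jac b (pulled x)) i k).
Proof.
have D := @is_derive_angle_field _ _ b _ pulled x (ev i) (row i (jac pulled x)) k.
rewrite -row_mul in D.
have -> : (jac pulled x *m angle_field_jac b (pulled x)) i k =
   row i (jac pulled x *m angle_field_jac b (pulled x)) 0 k by rewrite row_coef.
apply: D => // m; have -> : row i (jac pulled x) 0 m = 'D_(ev i) (fun y => pulled y 0 m) x.
  by rewrite row_coef mxE.
exact: Cn_is_derive (pulled_C2 m).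
Qed.

Lemma jac_row0 x (j : 'I_7) :
  (sin (x 0 ord0) = 0 \/ exists2 j' : 'I_7, (j' < j)%N & sin (x 0 (lift ord0 j')) = 0) ->
  row (lift ord0 j) (jac pulled x) = 0.
Proof.
move=> H; apply/rowP => k; rewrite row_coef !mxE; apply: derive_val.
apply/is_derive_line0; under eq_fun do rewrite /pulled (ball_param_invariant _ H).
exact: is_derive_cst.
Qed.

Lemma jac_field_row0 i r x : r != i -> row r (jac pulled x) = 0 -> Q i x = 0.
Proof.
move=> ri r0; rewrite /jac_field (expand_det_row _ r) big1// => k _.
have : row r (jac pulled x) 0 k = 0 by rewrite r0 mxE.
by rewrite row_coef [set_row _ _ _ _ _]mxE (negbTE ri) => ->; rewrite mul0r.
Qed.

(** For the last angle the two values agree by periodicity. For any other angle both are 0: at its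
    ends 0 and [pi] the sine vanishes, so the point no longer depends on the next angle, and the
    corresponding row of the Jacobian, which is not the replaced one, is 0. *)
Lemma jac_field_boundary (j : 'I_7) y :
  Q (lift ord0 j) (setc y (lift ord0 j) (lo (lift ord0 j))) =
  Q (lift ord0 j) (setc y (lift ord0 j) (hi (lift ord0 j))).
Proof.
have [j6|j6] := ltnP j 6; last first.
  have jm : lift ord0 j = ord_max.
    by apply: val_inj => /=; rewrite /bump /= add1n; apply/eqP; rewrite eqn_leq (ltn_ord j) ltnS.
  rewrite jm /hi eqxx /lo.
  set z := setc y ord_max 0.
  have -> : setc y ord_max (2 * pi) = (2 * pi) *: ev ord_max + z.
    apply/rowP => k; rewrite setcE [in RHS]mxE [X in _ = _ + X]setcE !mxE eqxx /=.
    by case: eqVneq => _; rewrite ?mulr1 ?mulr0 ?addr0 ?add0r.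
  have P x : pulled ((2 * pi) *: ev ord_max + x) = pulled x.
    by rewrite /pulled ball_param_periodic.
  have jE : jac pulled ((2 * pi) *: ev ord_max + z) = jac pulled z.
    apply/matrixP => i k; rewrite /jac [LHS]mxE [RHS]mxE.
    have D1 := Cn_is_derive ((2 * pi) *: ev ord_max + z) i (pulled_C2 k).
    have := is_derive_translate (f := fun y => pulled y 0 k) (w := (2 * pi) *: ev ord_max) D1.
    under eq_fun do rewrite P.
    by move=> D2; exact: esym (@derive_val _ _ _ _ _ _ _ D2).
  by rewrite /jac_field jE P.
have j7 : (j.+1 < 7)%N by rewrite ltnS.
have rr : lift ord0 (Ordinal j7) != lift ord0 j.
  by rewrite (inj_eq (@lift_inj _ _)) -val_eqE /= neq_ltn ltnSn orbT.
have Z (t : R) : sin t = 0 -> Q (lift ord0 j) (setc y (lift ord0 j) t) = 0.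
  move=> st; apply: (jac_field_row0 rr); apply: jac_row0; right; exists j => //.
  by rewrite setcE eqxx.
have hj : hi (lift ord0 j) = pi.
  rewrite /hi; case: eqVneq => // e; have := congr1 val e.
  by rewrite /= /bump /= add1n => ej; have := j7; rewrite ej ltnn.
by rewrite !Z ?hj ?sinpi ?sin0.
Qed.

Lemma pulled_field_continuous i : continuous (Q i).
Proof. exact: jac_field_continuous pulled_C2 ca _. Qed.

(* By the Piola identity the derivative in the radial angle is minus a sum of
   integrals of derivatives in the other angles, each zero by the boundary values. *)
Theorem zero_degree x : ints lo hi angles (Q ord0) x = 0.
Proof.
have G2 := pulled_C2.
have cQ i : continuous (Q i) by exact: jac_field_continuous.
have cdQ i : continuous (dQ i) by exact: djac_field_continuous.
have dQi i y : is_derive y (ev i) (Q i) (dQ i y) by exact: is_derive_jac_field.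
have ua : uniq angles by rewrite map_inj_uniq ?enum_uniq//; exact: lift_inj.
have a0 : ord0 \notin angles by apply/negP => /mapP[j _ e]; have := neq_lift ord0 j; rewrite -e eqxx.
have D y : is_derive y (ev ord0) (ints lo hi angles (Q ord0)) 0.
  have <- : ints lo hi angles (dQ ord0) y = 0; last exact: is_derive_ints.
  have : ints lo hi angles (fun y => \sum_i dQ i y) y = 0.
    rewrite (_ : (fun y => _) = fun=> 0); first exact: ints0.
    by apply/funext => z; apply: sum_djac_field => // w; exact: (angle_field_jac_trace _ bE).
  rewrite ints_sum// (bigD1 ord0)//= big1 ?addr0// => i i0.
  have [j ->] : exists j, i = lift ord0 j.
    by case: (unliftP ord0 i) i0 => [j ->|->]; [exists j|rewrite eqxx].
  have ja : lift ord0 j \in angles by apply: map_f; rewrite mem_enum.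
  exact: (@ints_derive0 _ _ _ _ _ _ (Q (lift ord0 j)) (dQ (lift ord0 j)) y
    (cQ _) (cdQ _) ua ja (dQi _) (jac_field_boundary j)).
(* The integral is constant in the radial angle and can be evaluated at 0, where the sphere shrinks
   to its centre. *)
pose g (s : R) := ints lo hi angles (Q ord0) (s *: ev ord0 + setc x ord0 0).
have dg (s : R) : is_derive s 1 g 0.
  by apply: (iffRL (is_derive_line (ints lo hi angles (Q ord0)) _ _ _ _)); exact: D.
have -> : x = (x 0 ord0) *: ev ord0 + setc x ord0 0.
  apply/rowP => k; rewrite [in RHS]mxE [X in _ = _ + X]setcE !mxE eqxx /=.
  by case: eqVneq => [->|_]; rewrite ?mulr1 ?addr0 ?mulr0 ?add0r.
rewrite -/(g _) (is_derive0_cst dg _ 0) /g scale0r add0r.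
(* At radial angle 0 the row of the first angle in the Jacobian is 0, and it differs from the
   replaced row [ord0]. The integrand itself vanishes, and the outer integrations keep the radial
   angle at 0. *)
have Z js y : ord0 \notin js -> y 0 ord0 = 0 -> ints lo hi js (Q ord0) y = 0.
  elim: js y => [|j js IH] y /=.
    move=> _ y0; apply: (@jac_field_row0 ord0 (lift ord0 ord0)); first by rewrite eq_sym neq_lift.
    by apply: jac_row0; left; rewrite y0 sin0.
  rewrite in_cons negb_or => /andP[j0 js0] y0; rewrite /int1.
  under eq_fun do rewrite IH// ?setcE ?(negbTE j0)//.
  by rewrite oint_cst mul0r.
by apply: Z => //; rewrite setcE eqxx.
Qed.

End ZeroDegree.

(** * Uniform convergence *)

Section UniformConvergence.
Context {R : realType} {T : Type}.
Implicit Types (F G : T -> R) (e : R) (n : nat) (t : T).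

Definition uniformly_cvg (F_ : nat -> T -> R) F :=
  forall e, 0 < e -> exists N, forall n t, (N <= n)%N -> `|F_ n t - F t| <= e.

(** Boundedness of the limit is what makes uniform convergence stable under products. *)
Definition bounded_cvg (F_ : nat -> T -> R) F :=
  (exists C, forall t, `|F t| <= C) /\ uniformly_cvg F_ F.

Lemma bounded_cvg_cst F : (exists C, forall t, `|F t| <= C) -> bounded_cvg (fun=> F) F.
Proof. by split=> // e e0; exists 0 => n t _; rewrite subrr normr0 ltW. Qed.

Lemma bounded_cvg_add (F_ G_ : nat -> T -> R) F G : bounded_cvg F_ F -> bounded_cvg G_ G ->
  bounded_cvg (fun n t => F_ n t + G_ n t) (fun t => F t + G t).
Proof.
move=> [[C HC] HF] [[D HD] HG]; split.
  by exists (C + D) => t; rewrite (le_trans (ler_normD _ _))// lerD.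
move=> e e0; have e2 : 0 < e / 2 by rewrite divr_gt0.
have [N HN] := HF _ e2; have [M HM] := HG _ e2.
exists (maxn N M) => n t; rewrite geq_max => /andP[Nn Mn].
rewrite opprD addrACA (le_trans (ler_normD _ _))// (splitr e) lerD//.
  exact: HN.
exact: HM.
Qed.

Lemma bounded_cvg_mul (F_ G_ : nat -> T -> R) F G : bounded_cvg F_ F -> bounded_cvg G_ G ->
  bounded_cvg (fun n t => F_ n t * G_ n t) (fun t => F t * G t).
Proof.
move=> [[C HC] HF] [[D HD] HG]; split.
  by exists (C * D) => t; rewrite normrM ler_pM.
move=> e e0; pose C' := `|C| + 1; pose D' := `|D| + 1.
have C0 : 0 < C' by rewrite /C' ltr_wpDl.
have D0 : 0 < D' by rewrite /D' ltr_wpDl.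
(* The product of the two errors is at most [e1 * 1] because of the minimum with 1, so the three
   error terms add up to at most [e1 * (C' + D' + 1)]. *)
pose e1 := Num.min 1 (e / (C' + D' + 1)).
have s0 : 0 < C' + D' + 1 by rewrite addr_gt0// addr_gt0.
have e10 : 0 < e1 by rewrite lt_min ltr01 divr_gt0.
have [N HN] := HF _ e10; have [M HM] := HG _ e10.
exists (maxn N M) => n t; rewrite geq_max => /andP[Nn Mn].
have f1 := HN n t Nn; have g1 := HM n t Mn.
have -> : F_ n t * G_ n t - F t * G t =
  (F_ n t - F t) * (G_ n t - G t) + (F_ n t - F t) * G t + F t * (G_ n t - G t) by ring.
have Ft : `|F t| <= C' by apply: le_trans (HC t) _; rewrite ler_wpDr// ler_norm.
have Gt : `|G t| <= D' by apply: le_trans (HD t) _; rewrite ler_wpDr// ler_norm.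
have e11 : e1 <= 1 by rewrite ge_min lexx.
have e1e : e1 * (C' + D' + 1) <= e by rewrite -ler_pdivlMr// ge_min lexx orbT.
apply: le_trans (ler_normD _ _) _.
have h1 : `|(F_ n t - F t) * (G_ n t - G t) + (F_ n t - F t) * G t| <= e1 * 1 + e1 * D'.
  rewrite (le_trans (ler_normD _ _))// !normrM lerD// ler_pM// (le_trans g1)//.
have h2 : `|F t * (G_ n t - G t)| <= C' * e1 by rewrite normrM ler_pM.
lra.
Qed.

Lemma bounded_cvg_sum (I : Type) (r : seq I) (F_ : I -> nat -> T -> R) (F : I -> T -> R) :
  (forall i, bounded_cvg (F_ i) (F i)) ->
  bounded_cvg (fun n t => \sum_(i <- r) F_ i n t) (fun t => \sum_(i <- r) F i t).
Proof.
move=> H; elim: r => [|i r IH].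
  have -> : (fun n t => \sum_(i <- [::]) F_ i n t) = (fun _ _ => 0).
    by apply/funext => n; apply/funext => t; rewrite big_nil.
  rewrite (_ : (fun t => \sum_(i <- [::]) F i t) = (fun=> 0)); last first.
    by apply/funext => t; rewrite big_nil.
  by apply: (bounded_cvg_cst (F := fun=> 0)); exists 0 => t; rewrite normr0.
have -> : (fun n t => \sum_(i <- i :: r) F_ i n t) =
    (fun n t => F_ i n t + \sum_(i <- r) F_ i n t).
  by apply/funext => n; apply/funext => t; rewrite big_cons.
rewrite (_ : (fun t => \sum_(i <- i :: r) F i t) = (fun t => F i t + \sum_(i <- r) F i t)); last first.
  by apply/funext => t; rewrite big_cons.
exact: bounded_cvg_add.
Qed.

Lemma bounded_cvg_prod (I : Type) (r : seq I) (F_ : I -> nat -> T -> R) (F : I -> T -> R) :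
  (forall i, bounded_cvg (F_ i) (F i)) ->
  bounded_cvg (fun n t => \prod_(i <- r) F_ i n t) (fun t => \prod_(i <- r) F i t).
Proof.
move=> H; elim: r => [|i r IH].
  have -> : (fun n t => \prod_(i <- [::]) F_ i n t) = (fun _ _ => 1).
    by apply/funext => n; apply/funext => t; rewrite big_nil.
  rewrite (_ : (fun t => \prod_(i <- [::]) F i t) = (fun=> 1)); last first.
    by apply/funext => t; rewrite big_nil.
  by apply: (bounded_cvg_cst (F := fun=> 1)); exists 1 => t; rewrite normr1.
have -> : (fun n t => \prod_(i <- i :: r) F_ i n t) =
    (fun n t => F_ i n t * \prod_(i <- r) F_ i n t).
  by apply/funext => n; apply/funext => t; rewrite big_cons.
rewrite (_ : (fun t => \prod_(i <- i :: r) F i t) = (fun t => F i t * \prod_(i <- r) F i t)); last first.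
  by apply/funext => t; rewrite big_cons.
exact: bounded_cvg_mul.
Qed.

Lemma bounded_cvg_inv (F_ : nat -> T -> R) F mu : 0 < mu -> (forall t, mu <= `|F t|) -> bounded_cvg F_ F ->
  bounded_cvg (fun n t => (F_ n t)^-1) (fun t => (F t)^-1).
Proof.
move=> mu0 Hmu [_ HF]; split.
  by exists mu^-1 => t; rewrite normrV ?unitfE -?normr_gt0 ?(lt_le_trans mu0)// lef_pV2 ?posrE// (lt_le_trans mu0).
(* The first entry keeps the absolute value of [F_ n t] at least [mu / 2]; then the product in the
   denominator is at least [mu ^+ 2 / 2], which the second entry compensates. *)
move=> e e0; pose e1 := Num.min (mu / 2) (e * (mu ^+ 2 / 2)).
have e10 : 0 < e1 by rewrite lt_min !divr_gt0//= mulr_gt0// divr_gt0// exprn_gt0.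
have [N HN] := HF _ e10; exists N => n t Nn.
have f1 := HN n t Nn; have m1 := Hmu t.
have e1m : e1 <= mu / 2 by rewrite ge_min lexx.
have e1e : e1 <= e * (mu ^+ 2 / 2) by rewrite ge_min lexx orbT.
have m2 : mu / 2 <= `|F_ n t|.
  have : `|F t| <= `|F t - F_ n t| + `|F_ n t| by rewrite -{1}(subrK (F_ n t) (F t)) ler_normD.
  by rewrite distrC; lra.
have Ft0 : F t != 0 by rewrite -normr_gt0 (lt_le_trans mu0).
have mu20 : 0 < mu / 2 by rewrite divr_gt0.
have Fn0 : F_ n t != 0 by rewrite -normr_gt0 (lt_le_trans mu20).
have -> : (F_ n t)^-1 - (F t)^-1 = (F t - F_ n t) / (F_ n t * F t) by field; rewrite Ft0 Fn0.
rewrite normrM normfV normrM distrC ler_pdivrMr ?mulr_gt0 ?normr_gt0//.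
apply: le_trans f1 _; apply: le_trans e1e _; rewrite ler_pM2l// expr2 mulrAC.
by apply: ler_pM => //; rewrite ltW.
Qed.

Lemma bounded_cvg_det m (M_ : nat -> T -> 'M[R]_m) (M : T -> 'M[R]_m) :
  (forall i j, bounded_cvg (fun n t => M_ n t i j) (fun t => M t i j)) ->
  bounded_cvg (fun n t => \det (M_ n t)) (fun t => \det (M t)).
Proof.
move=> H; apply: bounded_cvg_sum => s; apply: bounded_cvg_mul; last first.
  exact: bounded_cvg_prod.
by apply: (bounded_cvg_cst (F := fun=> _)); exists 1 => t; rewrite normrX normrN1 expr1n.
Qed.

Lemma uniformly_cauchy_cvg (F_ : nat -> T -> R) :
  (forall e, 0 < e -> exists N, forall n m t, (N <= n)%N -> (N <= m)%N ->
     `|F_ n t - F_ m t| <= e) ->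
  exists F, uniformly_cvg F_ F.
Proof.
move=> H.
have cv t : cvg (F_ ^~ t @ \oo).
  apply/cauchy_cvgP/cauchyP => e e0; have e2 : 0 < e / 2 by rewrite divr_gt0.
  have [N HN] := H _ e2; exists (F_ N t); exists N => // n /= Nn.
  rewrite /ball /= distrC; apply: le_lt_trans (HN n N t Nn (leqnn N)) _.
  by rewrite ltr_pdivrMr// ltr_pMr// ltr1n.
exists (fun t => lim (F_ ^~ t @ \oo)) => e e0.
have [N HN] := H _ e0; exists N => n t Nn.
apply/ler_addgt0Pr => d d0.
have /cvgrPdist_le/(_ _ d0)[M _ HM] := cv t.
have := HM (maxn N M) (leq_maxr _ _); rewrite /= => h1.
have h2 := HN n (maxn N M) t Nn (leq_maxl _ _).
by rewrite -(subrKA (F_ (maxn N M) t)) (le_trans (ler_normD _ _))// lerD// distrC.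
Qed.

Lemma uniformly_cvg_bounded (F_ : nat -> T -> R) F : (forall n, exists C, forall t, `|F_ n t| <= C) ->
  uniformly_cvg F_ F -> bounded_cvg F_ F.
Proof.
move=> HB HF; split=> //; have [N HN] := HF 1 ltr01.
have [C HC] := HB N; exists (1 + C) => t.
rewrite -(subrK (F_ N t) (F t)) (le_trans (ler_normD _ _))// lerD//.
by rewrite distrC; exact: HN.
Qed.

End UniformConvergence.

(** * Continuity and derivatives of uniform limits *)

Lemma uniformly_cvg_continuous (R : realType) (T : topologicalType) (F_ : nat -> T -> R) (F : T -> R) :
  (forall n, continuous (F_ n)) -> uniformly_cvg F_ F -> continuous F.
Proof.
move=> cF HF x; apply/cvgrPdist_le => e e0.
have e3 : 0 < e / 3 by rewrite divr_gt0.
have [N HN] := HF _ e3.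
have /cvgrPdist_le/(_ _ e3) := cF N x; apply: filterS => y Hy.
have h1 := HN N x (leqnn N); have h2 := HN N y (leqnn N).
have -> : F x - F y = - (F_ N x - F x) + (F_ N x - F_ N y) + (F_ N y - F y) by ring.
rewrite (le_trans (ler_normD _ _))//.
have : `|- (F_ N x - F x) + (F_ N x - F_ N y)| <= e / 3 + e / 3.
  by rewrite (le_trans (ler_normD _ _))// normrN lerD.
move: h2; lra.
Qed.

(** Pass to the limit in [phi_ n s - phi_ n 0 = oint (dphi_ n) 0 s]; the limit of the derivatives is
    continuous, so the integral form can be differentiated back. *)
Lemma is_derive_uniform_limit (R : realType) (phi_ dphi_ : nat -> R -> R) (phi dphi : R -> R) :
  (forall n (s : R), is_derive s 1 (phi_ n) (dphi_ n s)) -> (forall n, continuous (dphi_ n)) ->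
  (forall s, phi_ n s @[n --> \oo] --> phi s) -> uniformly_cvg dphi_ dphi ->
  is_derive (0 : R) 1 phi (dphi 0).
Proof.
move=> dF cF HF HdF; have cd := uniformly_cvg_continuous cF HdF.
suff E s : phi s = phi 0 + oint dphi 0 s.
  have -> : phi = (fun s => phi 0 + oint dphi 0 s) by apply/funext.
  rewrite -[X in is_derive _ _ _ X]add0r; apply: is_deriveD; exact: is_derive_oint.
have L1 : phi_ n s - phi_ n 0 @[n --> \oo] --> phi s - phi 0 by apply: cvgB; exact: HF.
suff L2 : phi_ n s - phi_ n 0 @[n --> \oo] --> oint dphi 0 s.
  have := cvg_unique _ L1 L2 => /(_ _) <-; first by rewrite addrC subrK.
  exact: norm_hausdorff.
have -> : (fun n => phi_ n s - phi_ n 0) = (fun n => oint (dphi_ n) 0 s).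
  by apply/funext => n; rewrite (ointP _ _ (cF n) (dF n)).
apply/cvgrPdist_le => e e0.
have s1 : 0 < `|s| + 1 by rewrite ltr_wpDl//.
have e1 : 0 < e / (`|s| + 1) by rewrite divr_gt0.
have [N HN] := HdF _ e1; exists N => // n /= Nn.
rewrite distrC -oint_sub//.
have cs : continuous (fun x => dphi_ n x - dphi x).
  by move=> x; apply: cvgB; [exact: cF|exact: cd].
have B a b : a <= b -> `|oint (fun x => dphi_ n x - dphi x) a b| <= e / (`|s| + 1) * (b - a).
  by move=> ab; apply: oint_le => // x _; exact: HN.
have K : e / (`|s| + 1) * `|s| <= e.
  by rewrite mulrAC ler_pdivrMr// ler_pM2l// lerDl.
have [s0|/ltW s0] := leP 0 s.
  by apply: le_trans (B _ _ s0) _; rewrite subr0 -{2}(ger0_norm s0).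
have -> : oint (fun x => dphi_ n x - dphi x) 0 s = - oint (fun x => dphi_ n x - dphi x) s 0.
  by rewrite /oint opprB.
by rewrite normrN; apply: le_trans (B _ _ s0) _; rewrite sub0r -(ler0_norm s0).
Qed.

(** * Balls and spheres *)

Section Balls.
Context {R : realType}.
Local Notation O := (octonion R).
Implicit Types (c z w x y : 'rV[R]_8) (a e r : R).

(** A ball for the octonion norm; for the norm of row vectors a closed ball is a cube. *)
Definition cball c a : set 'rV[R]_8 := [set z | onorm (z - c) <= a].

Lemma sqr_onorm z : onorm z ^+ 2 = sqnorm z.
Proof. by rewrite sqr_sqrtr// sumr_ge0// => i _; exact: sqr_ge0. Qed.

Lemma onormZ a z : onorm (a *: z) = `|a| * onorm z.
Proof.
rewrite -sqrtr_sqr -sqrtrM ?sqr_ge0// mulr_sumr; congr Num.sqrt.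
by apply: eq_bigr => i _; rewrite mxE exprMn.
Qed.

Lemma onorm_continuous c : continuous (fun z => onorm (z - c)).
Proof.
apply: (@continuous_comp_fun _ _ _ (fun z => sqnorm (z - c)) Num.sqrt); last exact: sqrt_continuous.
apply: continuous_sum => i; apply: continuous_exp.
under eq_fun do rewrite !mxE.
by apply: (continuous_sub (@coord_continuous R 8 i)); exact: cst_continuous.
Qed.

Lemma oball_open c a : open (oball c a).
Proof.
have -> : oball c a = (fun z => onorm (z - c)) @^-1` [set x | x < a] by [].
by apply: open_comp; [move=> z _; exact: onorm_continuous|exact: open_lt].
Qed.

Lemma cball_compact c a : compact (cball c a).
Proof.
pose Q := [set z : 'rV[R]_8 | forall i, `[c 0 i - a, c 0 i + a]%classic (z 0 i)].
apply: (@subclosed_compact _ _ Q).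
- have -> : cball c a = (fun z => onorm (z - c)) @^-1` [set x | x <= a] by [].
  by apply: closed_comp; [move=> z _; exact: onorm_continuous|exact: closed_le].
- by apply: (rV_compact (A := fun i => `[c 0 i - a, c 0 i + a]%classic)) => i; exact: segment_compact.
move=> z /= za i; have := le_trans (coord_le_onorm (z - c) i) za.
by rewrite !mxE => zi; rewrite /= in_itv /=; move: zi; rewrite ler_norml; lra.
Qed.

(** A point [z] of the closed ball is approached by the points [s *: (z - c) + c] with [s < 1],
    which lie in the open ball. *)
Lemma cball_sub_closure c e : 0 < e -> cball c e `<=` closure (oball c e).
Proof.
move=> e0 z ze B nB.
have cl : continuous (fun s : R => s *: (z - c) + c).
  move=> s; apply: cvgD; last exact: cvg_cst.
  by apply: cvgZr_tmp; exact: cvg_id.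
have z1 : 1 *: (z - c) + c = z by rewrite scale1r subrK.
have /nbhs_ballP[r /= r0 Hr] : nbhs (1 : R) ((fun s : R => s *: (z - c) + c) @^-1` B).
  by apply: cl; rewrite z1.
pose s := Num.max 0 (1 - r / 2).
have r2 : 0 < r / 2 by rewrite divr_gt0.
have s0 : 0 <= s by rewrite le_max lexx.
have s1 : s < 1 by rewrite gt_max ltr01 ltrBlDr ltrDl.
exists (s *: (z - c) + c); split.
  rewrite /oball /= addrK onormZ ger0_norm//.
  apply: le_lt_trans (_ : s * e < _); first by rewrite ler_wpM2l.
  by rewrite -[ltRHS]mul1r ltr_pM2r.
apply: Hr; rewrite /ball /= ger0_norm ?subr_ge0 ?(ltW s1)// ltrBlDl -ltrBlDr.
apply: (@lt_le_trans _ _ (1 - r / 2)); last by rewrite le_max lexx orbT.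
by rewrite ltrD2l ltrN2 ltr_pdivrMr// ltr_pMr// ltr1n.
Qed.

Lemma compact_thickening n (K G : set 'rV[R]_n) : compact K -> open G -> K `<=` G ->
  exists2 r, 0 < r & forall x y : 'rV[R]_n, K x -> (forall j, `|y 0 j - x 0 j| < r) -> G y.
Proof.
move=> /compact_near_coveringP cK oG KG.
pose P (u x : 'rV[R]_n) := G (u + x).
have /(cK _ (nbhs (0 : 'rV[R]_n)) P _) : forall x : 'rV[R]_n, K x ->
    \forall x' \near x & u \near (0 : 'rV[R]_n), P u x'.
  move=> x Kx.
  have : nbhs (0 + x) G by rewrite add0r; exact: open_nbhs_nbhs (conj oG (KG _ Kx)).
  have c2 : q.1 + q.2 @[q --> ((0 : 'rV[R]_n), x)] --> 0 + x.
    by apply: cvgD; [exact: cvg_fst|exact: cvg_snd].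
  move=> /c2 [[A B] /= [A1 B1] AB]; exists (B, A) => //.
  by move=> [x' u] /= [Bx' Au]; exact: (AB (u, x')).
move=> /nbhs_ballP[r /= r0 Hr]; exists r => // x y Kx xy.
have b : ball (0 : 'rV[R]_n) r (y - x).
  by split=> // i j; rewrite (ord1 i) /ball /= !mxE sub0r normrN; exact: xy.
by have := Hr _ b x Kx; rewrite /P subrK.
Qed.

Lemma cball_gap c a e : a < e -> exists2 r, 0 < r & forall x y, cball c a x ->
  (forall j, `|y 0 j - x 0 j| <= r) -> oball c e y.
Proof.
move=> ae; have [|r r0 Hr] := compact_thickening (cball_compact (c := c) (a := a)) (@oball_open c e).
  by move=> z za; exact: (le_lt_trans za ae).
exists (r / 2); first by rewrite divr_gt0.
move=> x y ax xy; apply: (Hr x) => // j; apply: le_lt_trans (xy j) _.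
by rewrite ltr_pdivrMr// ltr_pMr// ltr1n.
Qed.

Lemma cball_enlarge (G : set 'rV[R]_8) c e : open G -> 0 < e -> cball c e `<=` G ->
  exists2 e1, e < e1 & cball c e1 `<=` G.
Proof.
move=> oG e0 eG; have [r r0 Hr] := compact_thickening (cball_compact (c := c) (a := e)) oG eG.
have r2 : 0 < r / 2 by rewrite divr_gt0.
exists (e + r / 2); first by rewrite ltrDl.
move=> z ze1; pose s := e / (e + r / 2).
have er : 0 < e + r / 2 by rewrite addr_gt0.
have s0 : 0 < s by rewrite divr_gt0.
apply: (Hr (s *: (z - c) + c)).
  rewrite /cball /= addrK onormZ gtr0_norm// -[leRHS](@divfK _ (e + r / 2)) ?gt_eqF//.
  by rewrite ler_pM2l.
move=> j; have zj := le_trans (coord_le_onorm (z - c) j) ze1; move: zj; rewrite !mxE => zj.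
have -> : z 0 j - (s * (z 0 j - c 0 j) + c 0 j) = (r / 2) / (e + r / 2) * (z 0 j - c 0 j).
  by rewrite /s; field; rewrite gt_eqF//; lra.
rewrite normrM gtr0_norm ?divr_gt0// mulrAC ltr_pdivrMr//.
apply: le_lt_trans (_ : r / 2 * (e + r / 2) < _); first by rewrite ler_wpM2l ?(ltW r2).
by rewrite ltr_pM2r// ltr_pdivrMr// ltr_pMr// ltr1n.
Qed.

(** The radial retraction onto [cball c e]. Composing with it turns a function continuous on the
    ball into one continuous everywhere, unchanged on the ball. *)
Definition retract c e z := (e / Num.max e (onorm (z - c))) *: (z - c) + c.

Lemma retract_continuous c e : 0 < e -> continuous (retract c e).
Proof.
move=> e0; apply: continuous_row => j.
have -> : (fun z => retract c e z 0 j) =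
    (fun z => e * (Num.max e (onorm (z - c)))^-1 * (z 0 j - c 0 j) + c 0 j).
  by apply/funext => z; rewrite !mxE.
have cc a : continuous (fun _ : 'rV[R]_8 => a) by exact: cst_continuous.
apply: (continuous_add _ (@cc (c 0 j))).
apply: continuous_mul; last exact: (continuous_sub (@coord_continuous R 8 j) (@cc (c 0 j))).
apply: (continuous_mul (@cc e)) => z.
have m0 : Num.max e (onorm (z - c)) != 0 by rewrite gt_eqF// lt_max e0.
have cm : Num.max e (onorm (y - c)) @[y --> z] --> Num.max e (onorm (z - c)).
  exact: (@continuous_max _ _ (fun=> e) (fun y => onorm (y - c)) z (@cc e z) (@onorm_continuous c z)).
exact: (cvgV m0 cm).
Qed.

Lemma retract_cball c e z : 0 < e -> cball c e (retract c e z).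
Proof.
move=> e0; rewrite /cball /= /retract addrK onormZ.
have m0 : 0 < Num.max e (onorm (z - c)) by rewrite lt_max e0.
rewrite gtr0_norm ?divr_gt0// mulrAC ler_pdivrMr// ler_pM2l//.
by rewrite le_max lexx orbT.
Qed.

Lemma retract_id c e z : 0 < e -> cball c e z -> retract c e z = z.
Proof.
move=> e0 ze; rewrite /retract (max_idPl _)// divff ?gt_eqF// scale1r subrK//.
Qed.

(** With [p k] the product of the first [k] squared sines, the square of coordinate [l] is
    [p l - p l.+1], and that of the last coordinate is [p 7]; the sum telescopes to [p 0]. *)
Lemma sqnorm_usphere (t : 'rV[R]_7) : sqnorm (usphere t) = 1.
Proof.
pose p k := \prod_(j < 7 | (j < k)%N) sin (t 0 j) ^+ 2.
have pS k : (k < 7)%N -> p k.+1 = p k * sin (t 0 (inord k)) ^+ 2.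
  move=> k7; rewrite /p (bigD1 (inord k)) /=; last by rewrite inordK.
  rewrite mulrC; congr (_ * _); apply: eq_bigl => j.
  by rewrite -val_eqE /= inordK// ltnS ltn_neqAle andbC.
have E (l : 'I_8) : usphere t 0 l ^+ 2 = p l - (if (l < 7)%N then p l.+1 else 0).
  rewrite mxE exprMn -prodrXl -/(p l); case: ifP => [l7|_].
    by rewrite pS// sin2cos2; ring.
  by rewrite expr1n mulr1 subr0.
have T m : \sum_(i < m) (p i - p i.+1) = p 0 - p m.
  by elim: m => [|m IH]; rewrite ?big_ord0 ?subrr// big_ord_recr /= IH; ring.
rewrite /sqnorm; under eq_bigr do rewrite E.
rewrite big_ord_recr /= subr0.
under eq_bigr => i _ do rewrite (ltn_ord i).
by rewrite T subrK /p big_pred0.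
Qed.

Lemma onorm_sphere c e t : onorm (sphere c e t - c) = `|e|.
Proof.
rewrite /sphere addrC addKr onormZ.
suff -> : onorm (usphere t) = 1 by rewrite mulr1.
by rewrite /onorm -/(sqnorm _) sqnorm_usphere sqrtr1.
Qed.

Lemma ball_param_cball c e x : 0 < e -> cball c e (ball_param c e x).
Proof.
move=> e0; rewrite /cball /= onorm_sphere normrM gtr0_norm//.
rewrite -[leRHS]mulr1 ler_wpM2l ?(ltW e0)// ler_norml.
by rewrite sin_geN1 sin_le1.
Qed.

Lemma prod_norm_le1 (I : Type) (r : seq I) (F : I -> R) : (forall i, `|F i| <= 1) ->
  `|\prod_(i <- r) F i| <= 1.
Proof.
move=> H; elim: r => [|i r IH]; first by rewrite big_nil normr1.
by rewrite big_cons normrM -[leRHS]mulr1 ler_pM.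
Qed.

Lemma norm_sin_le1 a : `|sin a| <= 1.
Proof. by rewrite ler_norml sin_geN1 sin_le1. Qed.

Lemma norm_cos_le1 a : `|cos a| <= 1.
Proof. by rewrite ler_norml cos_geN1 cos_le1. Qed.

Definition sphere_angles c e l (t : 'rV[R]_7) : R := sphere c e t 0 l.

(** The product runs over all angles, padded with 1, to match the product rule [is_derive_prod]. *)
Lemma sphere_anglesE c e l : sphere_angles c e l = (fun t => c 0 l + e *
  ((\prod_(j < 7) (if (j < l)%N then sin (t 0 j) else 1)) *
   (if (l < 7)%N then cos (t 0 (inord l)) else 1))).
Proof. by apply/funext => t; rewrite /sphere_angles /sphere !mxE big_mkcond. Qed.

Lemma Cn_sphere_angles k c e l : Cn k (sphere_angles c e l).
Proof.
have [cs cc] : (forall j, Cn k (fun t : 'rV[R]_7 => sin (t 0 j))) /\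
    (forall j, Cn k (fun t : 'rV[R]_7 => cos (t 0 j))).
  by split=> j; have [] := Cn_trig (Cn_coord (R := R) k j).
rewrite sphere_anglesE.
apply: (Cn_add (Cn_cst _ _)); apply: (Cn_mul (Cn_cst _ _)).
apply: Cn_mul.
  have H (j : 'I_7) : Cn k (fun t : 'rV[R]_7 => if (j < l)%N then sin (t 0 j) else 1).
    by case: (j < l)%N; [exact: cs|exact: Cn_cst].
  exact: (Cn_prod _ _ H).
by case: (l < 7)%N; [exact: cc|exact: Cn_cst].
Qed.

(** The product rule over seven padded sine factors and one cosine factor gives eight terms, each
    made of factors at most 1 in absolute value. *)
Lemma derive_sphere_angles_le c e l j t : 0 <= e -> `|'D_(ev j) (sphere_angles c e l) t| <= e * 8.
Proof.
move=> e0.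
have dt i : is_derive t (ev j) (fun t : 'rV[R]_7 => t 0 i) (i == j)%:R.
  have -> : (i == j)%:R = ev j 0 i :> R by rewrite mxE eqxx.
  exact: is_derive_coord.
pose dF (i : 'I_7) : R := if (i < l)%N then cos (t 0 i) * (i == j)%:R else 0.
pose F (i : 'I_7) (t : 'rV[R]_7) : R := if (i < l)%N then sin (t 0 i) else 1.
have HF i : is_derive t (ev j) (F i) (dF i).
  rewrite /F /dF; case: (i < l)%N; last exact: is_derive_cst.
  exact: (is_derive_comp1 (is_derive_sin (t 0 i)) (dt i)).
pose dC : R := if (l < 7)%N then - sin (t 0 (inord l)) * (inord l == j)%:R else 0.
pose C (t : 'rV[R]_7) : R := if (l < 7)%N then cos (t 0 (inord l)) else 1.
have HC : is_derive t (ev j) C dC.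
  rewrite /C /dC; case: (l < 7)%N; last exact: is_derive_cst.
  exact: (is_derive_comp1 (is_derive_cos (t 0 (inord l))) (dt (inord l))).
have D := is_deriveD (is_derive_cst (c 0 l) t (ev j)) (is_deriveZ e (is_deriveM (is_derive_prod HF) HC)).
have b1 (b : bool) : `|b%:R : R| <= 1 by case: b; rewrite ?normr1 ?normr0.
have FF i : `|F i t| <= 1 by rewrite /F; case: ifP => _; rewrite ?normr1 ?norm_sin_le1.
have dFF i : `|dF i| <= 1.
  rewrite /dF; case: ifP => _; rewrite ?normr0// normrM -[leRHS]mulr1.
  by rewrite ler_pM// norm_cos_le1.
have CC : `|C t| <= 1 by rewrite /C; case: ifP => _; rewrite ?normr1 ?norm_cos_le1.
have dCC : `|dC| <= 1.
  rewrite /dC; case: ifP => _; rewrite ?normr0// normrM normrN -[leRHS]mulr1.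
  by rewrite ler_pM// norm_sin_le1.
rewrite sphere_anglesE (@derive_val _ _ _ _ _ _ _ D) add0r normrM ger0_norm// ler_wpM2l//.
have -> : 8 = 1 + 7 :> R by ring.
rewrite /GRing.scale /=; apply: le_trans (ler_normD _ _) _; apply: lerD.
  by rewrite normrM -[leRHS]mulr1 ler_pM// prod_norm_le1.
rewrite normrM -[leRHS]mul1r ler_pM//.
apply: le_trans (ler_norm_sum _ _ _) _.
apply: (@le_trans _ _ (\sum_(r < 7) 1)); last by rewrite sumr_const card_ord.
by apply: ler_sum => r _; apply: prod_norm_le1 => i; case: ifP.
Qed.

End Balls.

(** * Integrals over the parametrised sphere *)

Section SphereIntegral.
Context {R : realType}.
Implicit Types (x y w : 'rV[R]_8) (t : 'rV[R]_7).

Lemma setcs_notin n (js : seq 'I_n) (x : 'rV[R]_n) s i : i \notin js -> setcs x js s 0 i = x 0 i.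
Proof.
elim: js x s => //= j js IH x [|u s]//; rewrite in_cons negb_or => /andP[ij ijs].
by rewrite IH// setcE (negbTE ij).
Qed.

Lemma setcs_in n (js : seq 'I_n) (x : 'rV[R]_n) s i : uniq js -> i \in js -> x 0 i = 0 ->
  setcs x js s 0 i = nth 0 s (index i js).
Proof.
elim: js x s => //= j js IH x [|u s]; first by move=> _ _ ->; rewrite nth_nil.
move=> /andP[jjs ujs]; rewrite in_cons eq_sym; case: eqVneq => [<- _ _|ji /= ijs x0].
  by rewrite setcs_notin// setcE eqxx.
by rewrite IH// setcE eq_sym (negbTE ji).
Qed.

Definition lo7 (j : 'I_7) : R := lo (lift ord0 j).
Definition hi7 (j : 'I_7) : R := hi (lift ord0 j).

Lemma lo_hi (i : 'I_8) : lo i <= hi i :> R.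
Proof. by rewrite /lo /hi; case: ifP => _; rewrite ?mulr_ge0 ?pi_ge0. Qed.

Lemma angle_boxE : [seq `[lo7 j, hi7 j]%classic | j <- enum 'I_7] = angle_box.
Proof.
apply: (@eq_from_nth _ set0) => [|i]; rewrite size_map size_enum_ord //.
move=> i7; rewrite (nth_map (Ordinal i7)) ?size_enum_ord//.
have -> : nth (Ordinal i7) (enum 'I_7) i = Ordinal i7.
  by apply: val_inj; rewrite /= nth_enum_ord.
by rewrite /lo7 /hi7 /hi /lo -val_eqE /=; move: i i7; do 7 case=> //.
Qed.

Lemma iterated_integral_row (I : 'rV[R]_7 -> R) : continuous I ->
  iterated_integral angle_box (fun s => I (\row_j nth 0 s j)) = ints lo7 hi7 (enum 'I_7) I 0.
Proof.
move=> cI; rewrite -iterated_integralE//; last by move=> i; exact: lo_hi.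
rewrite angle_boxE; congr (iterated_integral _ _); apply/funext => s; congr (I _).
apply/rowP => j; rewrite mxE setcs_in ?enum_uniq ?mem_enum ?mxE//.
by rewrite index_enum_ord.
Qed.

Lemma iterated_integral_angles (F : 'rV[R]_8 -> R) x : continuous F ->
  iterated_integral angle_box (fun s => F (setcs x angles s)) = ints lo hi angles F x.
Proof.
move=> cF; rewrite -iterated_integralE//; last exact: lo_hi.
by rewrite -angle_boxE /angles -map_comp.
Qed.

(** The volume form contracted with [angle_field b], evaluated on the rows of [V]; [form_coefE] is
    the same number as a determinant with the field as its first row. *)
Definition form_coef (b : 'I_8 -> 'I_8 -> R) w (V : 'M[R]_(7, 8)) : R :=
  \sum_j angle_field b w 0 j * ((-1) ^+ j * \det (col' j V)).

Lemma form_coefE b w (J : 'M[R]_8) (V : 'M[R]_(7, 8)) : (forall j k, J (lift ord0 j) k = V j k) ->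
  \det (set_row J ord0 (angle_field b w)) = form_coef b w V.
Proof.
move=> JV; rewrite det_set_row; apply: eq_bigr => k _; congr (_ * (_ * \det _)).
by apply/matrixP => i l; rewrite !mxE JV.
Qed.

Lemma form_coef_continuous (T : topologicalType) b (w : T -> 'rV[R]_8) (V : T -> 'M[R]_(7, 8)) :
  (forall k, continuous (fun z => w z 0 k)) -> (forall j k, continuous (fun z => V z j k)) ->
  (forall z, w z != 0) -> continuous (fun z => form_coef b (w z) (V z)).
Proof.
move=> cw cV w0; have cc (a : R) : continuous (fun _ : T => a) by exact: cst_continuous.
apply: continuous_sum => j; apply: continuous_mul.
  under eq_fun do rewrite mxE; apply: continuous_mul; last first.
    by apply: continuous_sum => m; exact: (continuous_mul (@cw m) (@cc (b m j))).
  apply: continuous_exp => z.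
  have cs : continuous (fun z => sqnorm (w z)).
    by apply: continuous_sum => m; exact: continuous_exp.
  exact: (cvgV (sqnorm_neq0 (w0 z)) (cs z)).
apply: (continuous_mul (@cc _)); apply: continuous_det => r k.
by under eq_fun do rewrite mxE; exact: cV.
Qed.

(** This is [zero_degree] at radial angle [pi / 2], whose sine is 1, so that [ball_param] traces the
    sphere of radius [eps] itself. *)
Lemma zero_degree_sphere b kappa c eps (h : 'I_8 -> 'rV[R]_8 -> R) : 0 < eps ->
  (forall i j, b i j + b j i = if i == j then 2 * kappa else 0) ->
  (forall k, Cn 2 (h k)) -> (forall x, cball c eps x -> row_fun h x != 0) ->
  ints lo7 hi7 (enum 'I_7) (fun t => form_coef b (row_fun h (sphere c eps t))
    (\matrix_(j, k) 'D_(ev j) (fun t => h k (sphere c eps t)) t)) 0 = 0.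
Proof.
move=> e0 bE Hh h0.
have hs k : Cn 2 (fun t => h k (sphere c eps t)).
  by apply: (Cn_comp (Hh k)) => l; exact: (Cn_sphere_angles 2 c eps l).
have p0 x : pulled c eps h x != 0 by apply: h0; exact: ball_param_cball.
have nz t : row_fun h (sphere c eps t) != 0.
  by apply: h0; rewrite /cball /= onorm_sphere gtr0_norm.
have cI : continuous (fun t => form_coef b (row_fun h (sphere c eps t))
    (\matrix_(j, k) 'D_(ev j) (fun t => h k (sphere c eps t)) t)).
  apply: (form_coef_continuous (w := fun t => row_fun h (sphere c eps t))
    (V := fun t => \matrix_(j, k) 'D_(ev j) (fun t => h k (sphere c eps t)) t)) => //.
    by move=> k; under eq_fun do rewrite mxE; exact: (Cn_continuous (hs k)).
  move=> j k; under eq_fun do rewrite mxE; exact: (Cn_continuous (Cn_derive j (hs k))).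
rewrite -iterated_integral_row//.
have E y : y 0 ord0 = pi / 2 ->
    jac_field (pulled c eps h) (fun x => angle_field b (pulled c eps h x)) ord0 y =
    form_coef b (row_fun h (sphere c eps (tail y)))
      (\matrix_(j, k) 'D_(ev j) (fun t => h k (sphere c eps t)) (tail y)).
  move=> y0.
  have SE x : x 0 ord0 = pi / 2 -> ball_param c eps x = sphere c eps (tail x).
    by move=> x0; rewrite /ball_param x0 sin_pihalf mulr1.
  rewrite /jac_field /pulled SE//; apply: form_coefE => j k; rewrite [RHS]mxE /jac [LHS]mxE.
  apply: derive_val; apply/is_derive_line0.
  have -> : (fun s : R => row_fun h (ball_param c eps (s *: ev (lift ord0 j) + y)) 0 k) =
      (fun s => h k (sphere c eps (s *: ev j + tail y))).
    apply/funext => s; rewrite mxE SE; last by rewrite !mxE eqxx /= mulr0 add0r.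
    congr (h k (sphere _ _ _)); apply/rowP => i; rewrite !mxE eqxx /=.
    by rewrite (inj_eq (@lift_inj _ _)).
  apply: (iffRL (is_derive_line0 (fun t => h k (sphere c eps t)) (tail y) (ev j) _)).
  exact: Cn_is_derive (hs k).
pose x0 : 'rV[R]_8 := (pi / 2) *: ev ord0.
have ua : uniq angles by rewrite map_inj_uniq ?enum_uniq//; exact: lift_inj.
have a0 : ord0 \notin angles by apply/negP => /mapP[j _ e]; have := neq_lift ord0 j; rewrite -e eqxx.
have Q0 := zero_degree Hh bE p0 x0.
rewrite -iterated_integral_angles in Q0; last exact: pulled_field_continuous.
rewrite -[RHS]Q0; congr (iterated_integral _ _); apply/funext => s.
rewrite E; last by rewrite setcs_notin// !mxE eqxx mulr1.
suff -> : tail (setcs x0 angles s) = \row_j nth 0 s j by [].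
apply/rowP => j; rewrite [LHS]mxE [RHS]mxE setcs_in//.
- by rewrite index_map ?index_enum_ord//; exact: lift_inj.
- by apply: map_f; rewrite mem_enum.
- by rewrite !mxE /= mulr0.
Qed.

End SphereIntegral.

(** * Passage to the limit *)

Section LimitIntegral.
Context {R : realType}.
Implicit Types (t : 'rV[R]_7).

Lemma continuous_compact_bounded n (F : 'rV[R]_n -> R) (K : set 'rV[R]_n) :
  continuous F -> compact K -> exists C, forall x, K x -> `|F x| <= C.
Proof.
move=> cF cK; have [[x0 Kx0]|K0] := pselect (K !=set0); last first.
  by exists 0 => x Kx; exfalso; apply: K0; exists x.
have cN : {within K, continuous (fun x => `|F x|)}.
  by apply: continuous_subspaceT => x; exact: (cvg_norm (cF x)).
have [y _ Hy] := EVT_max_rV (ex_intro _ x0 Kx0) cK cN.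
by exists `|F y| => x Kx; apply: Hy; exact: mem_set.
Qed.

Variables (b : 'I_8 -> 'I_8 -> R) (kappa : R) (c : 'rV[R]_8) (eps : R).
Hypothesis bE : forall i j, b i j + b j i = if i == j then 2 * kappa else 0.
Hypothesis eps0 : 0 < eps.
Variables (h_ : nat -> 'I_8 -> 'rV[R]_8 -> R) (g : 'I_8 -> 'rV[R]_8 -> R).
Hypothesis h_C2 : forall n k, Cn 2 (h_ n k).
Hypothesis h_neq0 : forall n x, cball c eps x -> row_fun (h_ n) x != 0.
Hypothesis h_cvg : forall k e, 0 < e -> exists N, forall n x, (N <= n)%N ->
  cball c eps x -> `|h_ n k x - g k x| <= e.
Hypothesis dh_cauchy : forall i k e, 0 < e -> exists N, forall n m x, (N <= n)%N -> (N <= m)%N ->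
  cball c eps x -> `|'D_(ev i) (h_ n k) x - 'D_(ev i) (h_ m k) x| <= e.
Hypothesis g_cont : forall k, continuous (g k).
Hypothesis g_neq0 : forall x, onorm (x - c) = eps -> row_fun g x != 0.

Local Notation S := (sphere c eps).

Let S_ball t : cball c eps (S t).
Proof. by rewrite /cball /= onorm_sphere gtr0_norm. Qed.

Let hS_C2 n k : Cn 2 (fun t => h_ n k (S t)).
Proof. by apply: (Cn_comp (h_C2 n k)) => l; exact: (Cn_sphere_angles 2 c eps l). Qed.

Let dh_ n j k t := 'D_(ev j) (fun t => h_ n k (S t)) t.

Let dhE n j k t : dh_ n j k t =
  \sum_l 'D_(ev l) (h_ n k) (S t) * 'D_(ev j) (sphere_angles c eps l) t.
Proof.
apply: derive_val; apply: is_derive_chain; first exact: (CnW (h_C2 n k)).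
by move=> l; exact: Cn_is_derive (Cn_sphere_angles 1 c eps l).
Qed.

Let dh_bounded n j k : exists C, forall t, `|dh_ n j k t| <= C.
Proof.
have cD l : continuous ('D_(ev l) (h_ n k)) := Cn_continuous (Cn_derive l (h_C2 n k)).
have B l := cid (continuous_compact_bounded (@cD l) (cball_compact (c := c) (a := eps))).
exists (\sum_l sval (B l) * (eps * 8)) => t; rewrite dhE.
rewrite (le_trans (ler_norm_sum _ _ _))// ler_sum// => l _.
rewrite normrM ler_pM//; first exact: (svalP (B l)).
exact: derive_sphere_angles_le (ltW eps0).
Qed.

Let dh_limit j k : exists psi, uniformly_cvg (fun n => dh_ n j k) psi.
Proof.
apply: uniformly_cauchy_cvg => e e0.
(* The chain rule has eight terms, each with a derivative of the sphere bounded by [eps * 8]. *)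
have s0 : 0 < 8 * (eps * 8) by rewrite !mulr_gt0.
have e1 : 0 < e / (8 * (eps * 8)) by rewrite divr_gt0.
have N l := cid (dh_cauchy l k e1).
exists (\max_l sval (N l)) => n m t nN mN.
rewrite !dhE -sumrB (le_trans (ler_norm_sum _ _ _))//.
apply: (@le_trans _ _ (\sum_(l < 8) e / (8 * (eps * 8)) * (eps * 8))).
  apply: ler_sum => l _; rewrite -mulrBl normrM ler_pM//.
    have lN : (sval (N l) <= \max_l sval (N l))%N by exact: leq_bigmax.
    by apply: (svalP (N l)); [exact: leq_trans nN|exact: leq_trans mN|].
  exact: derive_sphere_angles_le (ltW eps0).
have K (a : R) : a *+ 8 = 8 * a by rewrite mulr_natl.
rewrite sumr_const card_ord K le_eqVlt; apply/orP; left; apply/eqP.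
by field; rewrite gt_eqF.
Qed.

(** The limit is differentiated only along the sphere: there the partial derivatives of the [h_ n]
    converge uniformly, and their limit [psi] is the derivative of [g]. As [g] is bounded away from
    0 on the sphere, the integrands converge uniformly too. Derivability and continuity are recorded
    for the translation back to [chain_integral]. *)
Theorem limit_integral :
  (forall k t j, derivable (fun t => g k (S t)) t (ev j)) /\
  ints lo7 hi7 (enum 'I_7) (fun t => form_coef b (row_fun g (S t))
    (\matrix_(j, k) 'D_(ev j) (fun t => g k (S t)) t)) 0 = 0 /\
  continuous (fun t => form_coef b (row_fun g (S t))
    (\matrix_(j, k) 'D_(ev j) (fun t => g k (S t)) t)).
Proof.
pose psi j k := sval (cid (dh_limit j k)).
have psiP j k : uniformly_cvg (fun n => dh_ n j k) (psi j k) := svalP (cid (dh_limit j k)).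
have cdh n j k : continuous (dh_ n j k) := Cn_continuous (Cn_derive j (hS_C2 n k)).
have dg k t j : is_derive t (ev j) (fun t => g k (S t)) (psi j k t).
  apply: (iffLR (is_derive_line0 (fun t => g k (S t)) t (ev j) _)).
  have -> : psi j k t = psi j k ((0 : R) *: ev j + t) by rewrite scale0r add0r.
  apply: (@is_derive_uniform_limit R (fun n (s : R) => h_ n k (S (s *: ev j + t)))
    (fun n s => dh_ n j k (s *: ev j + t)) _ (fun s => psi j k (s *: ev j + t))).
  - move=> n s; apply: (iffRL (is_derive_line (fun t => h_ n k (S t)) _ _ _ _)).
    exact: Cn_is_derive (hS_C2 n k).
  - by move=> n; apply: line_continuous1; exact: cdh.
  - move=> s; apply/cvgrPdist_le => e e0; have [N HN] := h_cvg k e0.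
    by exists N => // n /= Nn; rewrite distrC; exact: HN.
  - by move=> e e0; have [N HN] := psiP j k e e0; exists N => n s Nn; exact: HN.
have Ddg j k t : 'D_(ev j) (fun t => g k (S t)) t = psi j k t.
  by have := dg k t j => D; exact: derive_val.
have derg k t j : derivable (fun t => g k (S t)) t (ev j).
  by have := dg k t j => D; exact: ex_derive.
have bpsi j k : bounded_cvg (fun n => dh_ n j k) (psi j k).
  by apply: uniformly_cvg_bounded => // n; exact: dh_bounded.
have bg k : bounded_cvg (fun n t => h_ n k (S t)) (fun t => g k (S t)).
  apply: uniformly_cvg_bounded.
    move=> n; have [C HC] := continuous_compact_bounded (Cn_continuous (h_C2 n k))
      (cball_compact (c := c) (a := eps)).
    by exists C => t; exact: HC.
  by move=> e e0; have [N HN] := h_cvg k e0; exists N => n t Nn; exact: HN.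
pose I t := form_coef b (row_fun g (S t)) (\matrix_(j, k) psi j k t).
pose I_ n t := form_coef b (row_fun (h_ n) (S t)) (\matrix_(j, k) dh_ n j k t).
have IE : (fun t => form_coef b (row_fun g (S t))
    (\matrix_(j, k) 'D_(ev j) (fun t => g k (S t)) t)) = I.
  apply/funext => t; congr (form_coef _ _ _); apply/matrixP => j k.
  by rewrite [LHS]mxE [RHS]mxE Ddg.
rewrite IE.
have cS : continuous S := continuous_row (fun l => Cn_continuous (Cn_sphere_angles 0 c eps l)).
have cgS k : continuous (fun t => g k (S t)) := continuous_comp_fun cS (@g_cont k).
have cpsi j k : continuous (psi j k) := uniformly_cvg_continuous (fun n => @cdh n j k) (psiP j k).
have gS0 t : row_fun g (S t) != 0 by apply: g_neq0; rewrite onorm_sphere gtr0_norm.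
have cI : continuous I.
  apply: (form_coef_continuous (w := fun t => row_fun g (S t)) (V := fun t => \matrix_(j, k) psi j k t)) => //.
    by move=> k; under eq_fun do rewrite mxE; exact: cgS.
  by move=> j k; under eq_fun do rewrite mxE; exact: cpsi.
have cI_ n : continuous (I_ n).
  apply: (form_coef_continuous (w := fun t => row_fun (h_ n) (S t))
    (V := fun t => \matrix_(j, k) dh_ n j k t)).
  - by move=> k; under eq_fun do rewrite mxE; exact: (Cn_continuous (hS_C2 n k)).
  - by move=> j k; under eq_fun do rewrite mxE; exact: cdh.
  - by move=> t; exact: h_neq0.
have I_0 n : ints lo7 hi7 (enum 'I_7) (I_ n) 0 = 0.
  exact: (zero_degree_sphere eps0 bE (h_C2 n) (@h_neq0 n)).
(* The minimum over the compact sphere, positive because [g] has no zero on it; this controls the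
   inverse powers in the kernel. *)
have [mu mu0 Hmu] : exists2 mu, 0 < mu & forall t, mu <= `|sqnorm (row_fun g (S t))|.
  pose K : set 'rV[R]_8 := cball c eps `&` [set x | onorm (x - c) = eps].
  have cK : compact K.
    apply: compact_closedI; first exact: cball_compact.
    have -> : [set x : 'rV[R]_8 | onorm (x - c) = eps] =
        (fun x => onorm (x - c)) @^-1` [set eps] by [].
    by apply: closed_comp; [move=> z _; exact: onorm_continuous|exact: closed_eq].
  have cN : {within K, continuous (fun x => sqnorm (row_fun g x))}.
    apply: continuous_subspaceT; apply: continuous_sum => m; apply: continuous_exp.
    by under eq_fun do rewrite mxE; exact: g_cont.
  have SK t : K (S t) by split; [exact: S_ball|rewrite /= onorm_sphere gtr0_norm].
  have [y /set_mem[_ ye] Hy] := EVT_min_rV (ex_intro _ (S 0) (SK 0)) cK cN.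
  exists (sqnorm (row_fun g y)).
    rewrite lt_def; apply/andP; split; first by apply: sqnorm_neq0; exact: g_neq0.
    by apply: sumr_ge0 => i _; exact: sqr_ge0.
  by move=> t; apply: le_trans (ler_norm _); apply: Hy; exact: mem_set (SK t).
have bI : bounded_cvg I_ I.
  have bw k : bounded_cvg (fun n t => row_fun (h_ n) (S t) 0 k) (fun t => row_fun g (S t) 0 k).
    have -> : (fun n t => row_fun (h_ n) (S t) 0 k) = (fun n t => h_ n k (S t)).
      by apply/funext => n; apply/funext => t; rewrite mxE.
    have -> : (fun t => row_fun g (S t) 0 k) = (fun t => g k (S t)).
      by apply/funext => t; rewrite mxE.
    exact: bg.
  have bc (a : R) : bounded_cvg (fun _ _ => a) (fun _ : 'rV[R]_7 => a).
    by apply: (bounded_cvg_cst (F := fun=> a)); exists `|a|.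
  apply: bounded_cvg_sum => j; apply: bounded_cvg_mul.
    have E (u : 'rV[R]_8) : angle_field b u 0 j =
      (sqnorm u)^-1 * (sqnorm u)^-1 * ((sqnorm u)^-1 * (sqnorm u)^-1) * \sum_m u 0 m * b m j.
      by rewrite mxE -!expr2 -exprM.
    have -> : (fun n t => angle_field b (row_fun (h_ n) (S t)) 0 j) = (fun n t =>
      (sqnorm (row_fun (h_ n) (S t)))^-1 * (sqnorm (row_fun (h_ n) (S t)))^-1 *
      ((sqnorm (row_fun (h_ n) (S t)))^-1 * (sqnorm (row_fun (h_ n) (S t)))^-1) *
      \sum_m row_fun (h_ n) (S t) 0 m * b m j).
      by apply/funext => n; apply/funext => t; rewrite E.
    have -> : (fun t => angle_field b (row_fun g (S t)) 0 j) = (fun t =>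
      (sqnorm (row_fun g (S t)))^-1 * (sqnorm (row_fun g (S t)))^-1 *
      ((sqnorm (row_fun g (S t)))^-1 * (sqnorm (row_fun g (S t)))^-1) *
      \sum_m row_fun g (S t) 0 m * b m j).
      by apply/funext => t; rewrite E.
    have bN : bounded_cvg (fun n t => (sqnorm (row_fun (h_ n) (S t)))^-1)
        (fun t => (sqnorm (row_fun g (S t)))^-1).
      apply: (bounded_cvg_inv mu0 Hmu); apply: bounded_cvg_sum => m.
      exact: (bounded_cvg_mul (bw m) (bw m)).
    apply: bounded_cvg_mul; first by do 2 apply: bounded_cvg_mul.
    by apply: bounded_cvg_sum => m; exact: (bounded_cvg_mul (bw m) (bc _)).
  apply: bounded_cvg_mul; first exact: bc.
  apply: bounded_cvg_det => r k.
  have -> : (fun n t => col' j (\matrix_(j, k) dh_ n j k t) r k) = (fun n t => dh_ n r (lift j k) t).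
    by apply/funext => n; apply/funext => t; rewrite mxE [LHS]mxE.
  have -> : (fun t => col' j (\matrix_(j, k) psi j k t) r k) = psi r (lift j k).
    by apply/funext => t; rewrite mxE [LHS]mxE.
  exact: bpsi.
split; first exact: derg.
split; last exact: cI.
apply/eqP; rewrite -normr_le0; apply/ler_addgt0Pr => e e0; rewrite add0r.
pose V : R := \prod_(i <- enum 'I_7) (hi7 i - lo7 i).
have V0 : 0 <= V by apply: prodr_ge0 => i _; rewrite subr_ge0; exact: lo_hi.
have e1 : 0 < e / (V + 1) by rewrite divr_gt0// ltr_wpDl.
have [N HN] := bI.2 _ e1.
have := ints_lin lo7 hi7 (enum 'I_7) 1 (-1) cI (@cI_ N).
move/(congr1 (fun F => F 0)) => /=; rewrite I_0 mulr0 addr0 mul1r => <-.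
apply: le_trans (ints_le (C := e / (V + 1)) _ _ (fun i => lo_hi (lift ord0 i)) _ _) _.
- have cc (a : R) : continuous (fun _ : 'rV[R]_7 => a) by exact: cst_continuous.
  exact: (continuous_add (continuous_mul (@cc 1) cI) (continuous_mul (@cc (-1)) (@cI_ N))).
- by move=> t; rewrite mul1r mulN1r distrC; exact: HN.
rewrite -/V mulrAC ler_pdivrMr ?ltr_wpDl// ler_pM2l//; lra.
Qed.

End LimitIntegral.

(** * Sequences of regular functions *)

Lemma near_eq_differentiable (R : numFieldType) (V W : normedModType R) (f g : V -> W) (x : V) :
  {near x, f =1 g} -> differentiable f x -> differentiable g x.
Proof.
move=> fg df; have fgx : f x = g x := nbhs_singleton fg.
have E : g \o shift x = cst (g x) + 'd f x +o_ 0 id.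
  apply/eqaddoP => e e0; have /eqaddoP/(_ _ e0) := diff_locally df.
  have : \forall y \near (0 : V), f (y + x) = g (y + x).
    by move: fg; rewrite (near_shift 0) subr0.
  apply: filterS2 => y /= e1; rewrite -[X in X -> _]/(is_true (`|f (y + x) - (f x + 'd f x y)| <= e * `|y|)).
  by rewrite e1 fgx.
have D := diff_unique (diff_continuous df) E.
by apply/diff_locallyP; rewrite D; split=> //; exact: diff_continuous.
Qed.

Section RegularSequence.
Context {R : realType}.
Local Notation O := (octonion R).

Lemma mx_coord_le n (z : 'rV[R]_n) k : `|z 0 k| <= `|z|.
Proof. by rewrite [leRHS]mx_normrE; exact: (le_bigmax _ (fun ij => `|z ij.1 ij.2|) (0, k)). Qed.

Lemma derive_coord n (V : normedModType R) (f : V -> 'rV[R]_n) (x v : V) k : derivable f x v ->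
  'D_v (fun y => f y 0 k) x = ('D_v f x) 0 k.
Proof. by move=> df; rewrite (derive_mx df) mxE. Qed.

Lemma differentiable_coord_fun n (V : normedModType R) (f : V -> 'rV[R]_n) (x : V) k :
  differentiable f x -> differentiable (fun y => f y 0 k) x.
Proof.
move=> df; apply: (@differentiable_comp _ _ _ _ f (fun z : 'rV[R]_n => z 0 k)) => //.
exact: differentiable_coord.
Qed.

Lemma uniform_cvg_coord (K : set O) (f_ : nat -> O -> O) (f : O -> O) e :
  {uniform K, f_ @ \oo --> f} -> 0 < e ->
  exists N, forall n x k, (N <= n)%N -> K x -> `|f_ n x 0 k - f x 0 k| <= e.
Proof.
move=> H e0.
have : nbhs (f : {uniform` K -> O}) [set h | forall y, K y -> `|f y - h y| < e].
  apply/uniform_nbhs; exists [set xy : O * O | ball xy.1 e xy.2]; split.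
    by rewrite -entourage_ballE; exists e.
  by move=> h /= Hh y /Hh; rewrite -ball_normE.
move=> /H [N _ HN]; exists N => n x k Nn Kx; have := HN n Nn x Kx.
move=> /ltW; apply: le_trans; rewrite distrC.
by have := mx_coord_le (f x - f_ n x) k; rewrite !mxE.
Qed.

Variables (G : set O) (f_ : nat -> O -> O) (f : O -> O) (c : O) (eps : R).
Variables (L : 'I_8 -> 'M[R]_8) (omega : @oform R).
Hypothesis G_open : open G.
Hypothesis f_neq0 : forall n z, G z -> f_ n z != 0.
Hypothesis f_cvg : normally_cvg G f_ f.
Hypothesis L_hurwitz : forall i j, L i *m (L j)^T + L j *m (L i)^T = (if i == j then 2 else 0)%:M.
Hypothesis f_diff : forall n z, G z -> differentiable (f_ n) z.
Hypothesis f_regular : forall n z, G z -> regular_at L (fun k y => f_ n y 0 k) z.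
Hypothesis omega_coef : forall k, exists b kappa,
  (forall i j, b i j + b j i = if i == j then 2 * kappa else 0 : R) /\
  forall w V, omega w V 0 k = form_coef b w V.
Hypothesis eps0 : 0 < eps.
Hypothesis closure_sub : closure (oball c eps) `<=` G.
Hypothesis f_boundary : forall z, closure (oball c eps) z -> z != c -> f z != 0.

Theorem chain_integral0 : chain_integral omega (f \o sphere c eps) = 0.
Proof.
have cs := cball_sub_closure (c := c) eps0.
have [eps1 ee1 eps1G] := cball_enlarge G_open eps0 (subset_trans cs closure_sub).
have eps10 : 0 < eps1 := lt_trans eps0 ee1.
pose rt := retract c eps1.
have rtG z : G (rt z) by apply: eps1G; exact: retract_cball.
pose Frow n z := f_ n (rt z).
have cFrow n : continuous (Frow n).
  move=> z; apply: continuous_comp; first exact: retract_continuous.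
  exact: differentiable_continuous (f_diff n (rtG z)).
pose F n (k : 'I_8) z := Frow n z 0 k.
have cF n k : continuous (F n k).
  exact: (continuous_comp_fun (@cFrow n) (@coord_continuous R 8 k)).
pose g (k : 'I_8) z := f (rt z) 0 k.
have Fg k : uniformly_cvg (fun n => F n k) (g k).
  move=> e e0; have [N HN] := uniform_cvg_coord (f_cvg (cball_compact (c := c) (a := eps1)) eps1G) e0.
  by exists N => n z Nn; apply: HN => //; exact: retract_cball.
have cg k : continuous (g k) := uniformly_cvg_continuous (fun n => @cF n k) (@Fg k).
(* Three radii: the extended functions are regular inside [eps1], their approximants are harmonic up
   to [eps2], and gradients are controlled up to [eps]. The numbers [eta] and [eta2] measure the two
   gaps. *)
pose eps2 := (eps + eps1) / 2.
have e2 : eps < eps2 by rewrite /eps2; lra.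
have e21 : eps2 < eps1 by rewrite /eps2; lra.
have [eta eta0 Heta] := cball_gap c e21.
have [eta2 eta20 Heta2] := cball_gap c e2.
have F_regular n y : oball c eps1 y ->
    (forall k, differentiable (F n k) y) /\ regular_at L (F n) y.
  move=> y1; have nf k : {near y, (fun z => f_ n z 0 k) =1 F n k}.
    have : nbhs y (oball c eps1) by apply: open_nbhs_nbhs; split => //; exact: oball_open.
    by apply: filterS => z z1; rewrite /F /Frow /rt retract_id//; exact: ltW.
  have yG : G y by apply: eps1G; exact: ltW.
  split=> [k|l].
    apply: near_eq_differentiable (@nf k) _; apply: differentiable_coord_fun; exact: f_diff.
  apply: etrans (f_regular n yG l); apply: eq_bigr => i _; apply: eq_bigr => k _.
  by congr (_ * _); apply/esym/near_eq_derive; exact: nf.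
have [m m0 Hm] : exists2 m : nat -> R, (forall n, 0 < m n) &
    forall n x, cball c eps x -> m n <= `|Frow n x|.
  have H n : exists2 a, 0 < a & forall x, cball c eps x -> a <= `|Frow n x|.
    have Kc : cball c eps c.
      by rewrite /cball /= subrr -(scale0r c) onormZ normr0 mul0r ltW.
    have cN : {within cball c eps, continuous (fun x => `|Frow n x|)}.
      by apply: continuous_subspaceT => x; exact: (cvg_norm (cFrow n x)).
    have [y _ Hy] := EVT_min_rV (ex_intro _ c Kc) (cball_compact (c := c) (a := eps)) cN.
    exists `|Frow n y|; first by rewrite normr_gt0; exact: f_neq0.
    by move=> x Kx; apply: Hy; exact: mem_set.
  exists (fun n => s2val (cid2 (H n))); first by move=> n; exact: (s2valP (cid2 (H n))).
  by move=> n; exact: (s2valP' (cid2 (H n))).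
(* The bound [m n / 2] keeps the approximant of [f_ n] free of zeros on the ball; the other bound
   makes the approximants converge to the same limit. *)
pose e_ n := Num.min (m n / 2) n.+1%:R^-1.
have e_0 n : 0 < e_ n by rewrite lt_min divr_gt0//= invr_gt0.
have Hh n := cid (regular_approx L_hurwitz (@cF n) (cball_compact (c := c) (a := eps2)) eta0 (e_0 n)
  (fun x y Kx xy => F_regular n y (Heta x y Kx xy))).
pose h_ n := sval (Hh n).
have h_C2 n k : Cn 2 (h_ n k) by have [H _ _] := svalP (Hh n); exact: H.
have h_harm n k x : cball c eps2 x -> laplacian (h_ n k) x = 0.
  by have [_ H _] := svalP (Hh n); exact: H.
have h_close n k x : cball c eps2 x -> `|h_ n k x - F n k x| <= e_ n.
  by have [_ _ H] := svalP (Hh n); exact: H.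
have sub12 x : cball c eps x -> cball c eps2 x by move=> xe; exact: le_trans xe (ltW e2).
have h_neq0 n x : cball c eps x -> row_fun (h_ n) x != 0.
  move=> xe; apply/eqP => h0; have := Hm n x xe; apply/negP; rewrite -ltNge.
  apply: le_lt_trans (_ : e_ n < _); last first.
    have : e_ n <= m n / 2 by rewrite /e_ ge_min lexx.
    by have := m0 n; lra.
  rewrite [leLHS]mx_normrE; apply: bigmax_le => [|[i k] _]; first exact: ltW.
  rewrite (ord1 i) /=; have := h_close n k x (sub12 _ xe).
  have -> : h_ n k x = 0 by have := congr1 (fun w : 'rV[R]_8 => w 0 k) h0; rewrite !mxE.
  by rewrite sub0r normrN.
have h_cvg2 k e : 0 < e -> exists N, forall n x, (N <= n)%N ->
    cball c eps2 x -> `|h_ n k x - g k x| <= e.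
  move=> e0; have e20 : 0 < e / 2 by rewrite divr_gt0.
  have [N HN] := Fg k _ e20.
  have [M HM] : exists M : nat, forall n, (M <= n)%N -> n.+1%:R^-1 <= e / 2.
    have [M HM] := ltr_add_invr e20.
    exists M => n Mn; move: HM; rewrite add0r => /ltW; apply: le_trans.
    by rewrite lef_pV2 ?posrE// ler_nat.
  exists (maxn N M) => n x; rewrite geq_max => /andP[Nn Mn] xe.
  rewrite -(subrKA (F n k x)) (le_trans (ler_normD _ _))// (splitr e) lerD//; last exact: HN.
  apply: le_trans (h_close n k x xe) _; apply: le_trans (HM n Mn).
  by rewrite /e_ ge_min lexx orbT.
have h_cvg k e : 0 < e -> exists N, forall n x, (N <= n)%N ->
    cball c eps x -> `|h_ n k x - g k x| <= e.
  by move=> /(h_cvg2 k)[N HN]; exists N => n x Nn xe; apply: HN => //; exact: sub12.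
have dh_cauchy i k e : 0 < e -> exists N, forall n m x, (N <= n)%N -> (N <= m)%N ->
    cball c eps x -> `|'D_(ev i) (h_ n k) x - 'D_(ev i) (h_ m k) x| <= e.
  (* The gradient estimate in dimension 8 costs the factor [(8 + 1) / eta2], which turns this [M]
     into [e]. It is applied to the difference [u] of two approximants, harmonic and at most [M]
     near [x]. *)
  move=> e0; pose M := e * eta2 / 9.
  have M0 : 0 < M by rewrite divr_gt0// mulr_gt0.
  have M20 : 0 < M / 2 by rewrite divr_gt0.
  have [N HN] := h_cvg2 k _ M20; exists N => n n' x Nn Nn' xe.
  pose u y := h_ n k y + (-1) * h_ n' k y.
  have Cu : Cn 2 u := Cn_add (h_C2 n k) (Cn_mul (Cn_cst 2 (-1)) (h_C2 n' k)).
  have Du j y : 'D_(ev j) u y = 'D_(ev j) (h_ n k) y + (-1) * 'D_(ev j) (h_ n' k) y.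
    apply: derive_val; apply: is_deriveD; first exact: Cn_is_derive (h_C2 n k).
    by apply: is_deriveZ; exact: Cn_is_derive (h_C2 n' k).
  have DDu j y : 'D_(ev j) ('D_(ev j) u) y =
      'D_(ev j) ('D_(ev j) (h_ n k)) y + (-1) * 'D_(ev j) ('D_(ev j) (h_ n' k)) y.
    have -> : 'D_(ev j) u = (fun y => 'D_(ev j) (h_ n k) y + (-1) * 'D_(ev j) (h_ n' k) y).
      by apply/funext => z; exact: Du.
    apply: derive_val; apply: is_deriveD; first exact: Cn_is_derive (Cn_derive j (h_C2 n k)).
    by apply: is_deriveZ; exact: Cn_is_derive (Cn_derive j (h_C2 n' k)).
  have Hu (y : O) : (forall j, `|y 0 j - x 0 j| <= eta2) -> `|u y| <= M /\ laplacian u y = 0.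
    move=> yx; have y2 : cball c eps2 y by exact: ltW (Heta2 x y xe yx).
    split.
      have -> : u y = (h_ n k y - g k y) - (h_ n' k y - g k y) by rewrite /u; ring.
      by rewrite (le_trans (ler_normB _ _))// (splitr M) lerD//; exact: HN.
    transitivity (laplacian (h_ n k) y + (-1) * laplacian (h_ n' k) y).
      rewrite /laplacian mulr_sumr -big_split; apply: eq_bigr => j _; exact: DDu.
    by rewrite !h_harm// mulr0 addr0.
  have := gradient_estimate i Cu eta20 M0 Hu; rewrite Du mulN1r => /le_trans; apply.
  rewrite /M le_eqVlt; apply/orP; left; apply/eqP.
  have -> : 8%:R + 1 = 9 :> R by ring.
  by field; rewrite gt_eqF.
have g_neq0 x : onorm (x - c) = eps -> row_fun g x != 0.
  move=> xe; have xb : cball c eps x by rewrite /cball /= xe.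
  have xc : x != c.
    apply/eqP => xc; move: xe; rewrite xc subrr -(scale0r c) onormZ normr0 mul0r => e00.
    by move: eps0; rewrite -e00 ltxx.
  have -> : row_fun g x = f x.
    apply/rowP => k; rewrite mxE /g /rt retract_id//; exact: le_trans xb (ltW ee1).
  by apply: f_boundary => //; exact: cs.
have S_id t : rt (sphere c eps t) = sphere c eps t.
  by apply: retract_id => //; rewrite /cball /= onorm_sphere gtr0_norm// ltW.
have gSE k : (fun t => g k (sphere c eps t)) = (fun t => (f \o sphere c eps) t 0 k).
  by apply/funext => t; rewrite /g S_id.
apply/rowP => k; rewrite [LHS]mxE [RHS]mxE.
have [b [kappa [bE oE]]] := omega_coef k.
have [dg [int0 cont]] := limit_integral bE eps0 h_C2 h_neq0 h_cvg dh_cauchy cg g_neq0.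
rewrite -[RHS]int0 -(iterated_integral_row cont).
congr (iterated_integral _ _); apply/funext => s /=.
rewrite oE; congr (form_coef _ _ _).
  by apply/rowP => l; rewrite [RHS]mxE /g S_id.
have df t j : derivable (f \o sphere c eps) t (ev j).
  apply/derivable_mxP => i l; rewrite (ord1 i).
  by have := dg l t j; rewrite gSE.
by apply/matrixP => j l; rewrite [LHS]mxE [RHS]mxE gSE -(derive_coord l (df _ j)).
Qed.

End RegularSequence.

(** * The octonions *)

Section OctonionTable.

(* An integer copy of [ostruct], on which identities are checked by computation. *)
Definition ostructZ (i j k : nat) : int :=
  if i == 0%N then (j == k)%:R
  else if j == 0%N then (i == k)%:R
  else if i == j then - (k == 0%N)%:R
  else (fano_cyclic i j k)%:R - (fano_cyclic j i k)%:R.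

Definition osignZ (i : nat) : int := if i == 0%N then 1 else -1.

Definition forall8 (P : nat -> bool) := all P (iota 0 8).

Lemma forall8P (P : nat -> bool) : forall8 P -> forall i : 'I_8, P i.
Proof. by move=> /allP H i; apply: H; rewrite mem_iota ltn_ord. Qed.

Definition sum8 (F : nat -> int) := foldr (fun l s => F l + s) 0 (iota 0 8).

Lemma sum8E (F : nat -> int) : sum8 F = \sum_(l < 8) F l.
Proof.
by rewrite -(big_mkord xpredT F) unlock.
Qed.

(** The multiplicativity of the norm, polarised in both factors; on basis vectors it is a finite
    statement about the table. *)
Lemma left_hurwitzZ : forall8 (fun i => forall8 (fun j => forall8 (fun k => forall8 (fun m =>
  sum8 (fun l => ostructZ i k l * ostructZ j m l + ostructZ j k l * ostructZ i m l) ==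
  ((if i == j then 2 else 0) * (k == m)%:R))))).
Proof. by vm_compute. Qed.

Lemma right_hurwitzZ : forall8 (fun i => forall8 (fun j => forall8 (fun k => forall8 (fun m =>
  sum8 (fun l => ostructZ k i l * ostructZ m j l + ostructZ k j l * ostructZ m i l) ==
  ((if i == j then 2 else 0) * (k == m)%:R))))).
Proof. by vm_compute. Qed.

(** Coordinate [k] of the polarised identity [conj x * x = |x|^2] on basis vectors. It makes the
    symmetric part of the array of the 7-form scalar. *)
Lemma left_coefZ : forall8 (fun i => forall8 (fun j => forall8 (fun k =>
  osignZ i * ostructZ i j k + osignZ j * ostructZ j i k ==
  (if i == j then 2 * (k == 0%N)%:R else 0)))).
Proof. by vm_compute. Qed.

Lemma right_coefZ : forall8 (fun i => forall8 (fun j => forall8 (fun k =>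
  osignZ i * ostructZ j i k + osignZ j * ostructZ i j k ==
  (if i == j then 2 * (k == 0%N)%:R else 0)))).
Proof. by vm_compute. Qed.

Context {R : realType}.
Local Notation O := (octonion R).

(** * Multiplication matrices and coordinates of the 7-forms over the reals *)

Lemma ostruct_intr i j k : ostruct i j k = (ostructZ i j k)%:~R :> R.
Proof.
rewrite /ostruct /ostructZ.
by case: ifP => _; [|case: ifP => _; [|case: ifP => _]];
  rewrite ?rmorphB ?rmorphN /= ?rmorph_nat.
Qed.

Definition osign (i : nat) : R := (osignZ i)%:~R.

Definition mul_left_mx (i : 'I_8) : 'M[R]_8 := \matrix_(k, l) ostruct i k l.
Definition mul_right_mx (i : 'I_8) : 'M[R]_8 := \matrix_(k, l) ostruct k i l.

Lemma omul_oel i (x : O) l : omul (oe i) x 0 l = \sum_k x 0 k * mul_left_mx i k l.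
Proof.
rewrite mxE (bigD1 i)//= [X in _ + X]big1 ?addr0 => [|a ai].
  by apply: eq_bigr => k _; rewrite !mxE !eqxx mul1r.
by apply: big1 => k _; rewrite mxE (negbTE ai) andbF !mul0r.
Qed.

Lemma omul_oer i (x : O) l : omul x (oe i) 0 l = \sum_k x 0 k * mul_right_mx i k l.
Proof.
rewrite mxE; apply: eq_bigr => k _.
rewrite (bigD1 i)//= [X in _ + X]big1 ?addr0 => [|a ai]; first by rewrite !mxE !eqxx mulr1.
by rewrite mxE (negbTE ai) andbF mulr0 mul0r.
Qed.

Lemma mul_left_mx_hurwitz i j : mul_left_mx i *m (mul_left_mx j)^T +
  mul_left_mx j *m (mul_left_mx i)^T = (if i == j then 2 else 0)%:M.
Proof.
apply/matrixP => k m; have /forall8P/(_ i)/forall8P/(_ j)/forall8P/(_ k)/forall8P/(_ m)/eqP := left_hurwitzZ.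
rewrite sum8E => /(congr1 (intr : int -> R)); rewrite rmorph_sum rmorphM rmorph_nat /= => E.
have : (if i == j then 2 else 0) = (if val i == val j then 2 else 0 : int)%:~R :> R.
  by rewrite -val_eqE; case: ifP.
move: (if i == j then 2 else 0 : R) => d dE.
rewrite !mxE -big_split /= -[k == m]/(val k == val m) -mulr_natr dE -E; apply: eq_bigr => l _.
by rewrite !mxE !ostruct_intr -!rmorphM -rmorphD.
Qed.

Lemma mul_right_mx_hurwitz i j : mul_right_mx i *m (mul_right_mx j)^T +
  mul_right_mx j *m (mul_right_mx i)^T = (if i == j then 2 else 0)%:M.
Proof.
apply/matrixP => k m; have /forall8P/(_ i)/forall8P/(_ j)/forall8P/(_ k)/forall8P/(_ m)/eqP := right_hurwitzZ.
rewrite sum8E => /(congr1 (intr : int -> R)); rewrite rmorph_sum rmorphM rmorph_nat /= => E.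
have : (if i == j then 2 else 0) = (if val i == val j then 2 else 0 : int)%:~R :> R.
  by rewrite -val_eqE; case: ifP.
move: (if i == j then 2 else 0 : R) => d dE.
rewrite !mxE -big_split /= -[k == m]/(val k == val m) -mulr_natr dE -E; apply: eq_bigr => l _.
by rewrite !mxE !ostruct_intr -!rmorphM -rmorphD.
Qed.

Lemma q0E (w : O) i : q0 w 0 i = (sqnorm w)^-1 ^+ 4 * (osign i * w 0 i).
Proof.
rewrite mxE; congr (_ * _).
  by rewrite -sqr_onorm -!exprVn -exprM.
rewrite /oconj !mxE summxE /osign /osignZ.
have [->|i0] := eqVneq i 0.
  rewrite eqxx mulr1 big1 ?subr0 ?mul1r// => j j0.
  by rewrite !mxE eq_sym (negbTE j0) mulr0.
rewrite andbF mulr0 sub0r (bigD1 i)//= big1 => [|j /andP[_ ji]].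
  by rewrite !mxE !eqxx mulr1 addr0; move: i0; rewrite -val_eqE /= => /negbTE ->; rewrite mulN1r.
by rewrite !mxE eq_sym (negbTE ji) andbF mulr0.
Qed.

Lemma dsigmaE (V : 'M[R]_(7, 8)) j : dsigma V 0 j = (-1) ^+ j * \det (col' j V).
Proof.
rewrite /dsigma summxE (bigD1 j)//= big1 ?addr0; first by rewrite !mxE !eqxx mulr1.
by move=> i ij; rewrite !mxE eq_sym (negbTE ij) andbF mulr0.
Qed.

Lemma form_coef_omul (b : 'I_8 -> 'I_8 -> R) w V :
  form_coef b w V = \sum_j \sum_m (sqnorm w)^-1 ^+ 4 * (w 0 m * b m j) * dsigma V 0 j.
Proof.
apply: eq_bigr => j _; rewrite -dsigmaE mxE -mulr_suml; congr (_ * _).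
by rewrite mulr_sumr.
Qed.

Lemma q0_dsigma_coef k : exists b kappa,
  (forall i j, b i j + b j i = if i == j then 2 * kappa else 0 : R) /\
  forall w V, q0_dsigma w V 0 k = form_coef b w V.
Proof.
(* The coefficient of [e_k] in the conjugate of [e_i] times [e_j]. For [i = j] that product is 1, so
   [kappa] is 1 for the real coordinate and 0 for the others. *)
exists (fun i j : 'I_8 => osign i * ostruct i j k), (k == 0)%:R; split=> [i j|w V].
  have /forall8P/(_ i)/forall8P/(_ j)/forall8P/(_ k)/eqP := left_coefZ.
  move=> /(congr1 (intr : int -> R)); rewrite rmorphD !rmorphM /= -!ostruct_intr => ->.
  by rewrite -val_eqE; case: ifP => _; rewrite ?rmorphM ?rmorph_nat ?rmorph0.
rewrite form_coef_omul /q0_dsigma mxE exchange_big; apply: eq_bigr => j _.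
by apply: eq_bigr => i _; rewrite q0E; ring.
Qed.

Lemma dsigma_q0_coef k : exists b kappa,
  (forall i j, b i j + b j i = if i == j then 2 * kappa else 0 : R) /\
  forall w V, dsigma_q0 w V 0 k = form_coef b w V.
Proof.
exists (fun i j : 'I_8 => osign i * ostruct j i k), (k == 0)%:R; split=> [i j|w V].
  have /forall8P/(_ i)/forall8P/(_ j)/forall8P/(_ k)/eqP := right_coefZ.
  move=> /(congr1 (intr : int -> R)); rewrite rmorphD !rmorphM /= -!ostruct_intr => ->.
  by rewrite -val_eqE; case: ifP => _; rewrite ?rmorphM ?rmorph_nat ?rmorph0.
rewrite form_coef_omul /dsigma_q0 mxE; apply: eq_bigr => j _.
by apply: eq_bigr => i _; rewrite q0E; ring.
Qed.

(** * Regularity in coordinates and vanishing of the orders *)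

Lemma left_regular_at (G : set O) (f : O -> O) z : left_regular G f -> G z ->
  regular_at mul_left_mx (fun k y => f y 0 k) z.
Proof.
move=> Hf Gz l; have [df] := Hf z Gz.
move=> /(congr1 (fun w : O => w 0 l)); rewrite summxE mxE => E; apply: etrans E.
apply: eq_bigr => i _; rewrite omul_oel; apply: eq_bigr => k _.
by rewrite derive_coord//; exact: diff_derivable.
Qed.

Lemma right_regular_at (G : set O) (f : O -> O) z : right_regular G f -> G z ->
  regular_at mul_right_mx (fun k y => f y 0 k) z.
Proof.
move=> Hf Gz l; have [df] := Hf z Gz.
move=> /(congr1 (fun w : O => w 0 l)); rewrite summxE mxE => E; apply: etrans E.
apply: eq_bigr => i _; rewrite omul_oer; apply: eq_bigr => k _.
by rewrite derive_coord//; exact: diff_derivable.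
Qed.

Lemma ord_wrt0 (omega : oform) (G : set O) (f : O -> O) : open G ->
  (forall c eps, 0 < eps -> closure (oball c eps) `<=` G ->
     (forall z, closure (oball c eps) z -> z != c -> f z != 0) ->
     chain_integral omega (f \o sphere c eps) = 0) ->
  forall c, ord_dom G f c -> ord_wrt omega G f c = 0.
Proof.
move=> oG H c [Gc fc]; rewrite /ord_wrt; case: ifPn => // fc0.
have iz : isolated_zero G f c by case: fc => // h; move: fc0; rewrite h.
(* An isolated zero has admissible radii, so [xget] returns one of them rather than falling back on
   its default 1. *)
have [eps] := xgetPex 1 (ord_radius_neq0 oG iz) => e1 e2.
by rewrite H ?scaler0.
Qed.

Lemma sums_to0 (A : set O) (F : O -> O) : (forall c, A c -> F c = 0) -> sums_to A F 0.
Proof.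
move=> H; rewrite /sums_to; have -> : patch (fun=> 0) A F = (fun=> 0).
  by apply/funext => c; rewrite /patch; case: ifPn => // /set_mem /H.
have -> : summability.partial_sum (fun _ : O => 0 : O) = (fun=> 0).
  by apply/funext => B; rewrite /summability.partial_sum big1.
have FF : Filter (@summability.totally O) := @filter_filter _ _ (summability.totally_filter (I := O)).
exact: cvg_cst.
Qed.

End OctonionTable.

Theorem theorem3p19 (R : realType) (G : set (octonion R))
    (f_ : nat -> octonion R -> octonion R) (f : octonion R -> octonion R)
    (G_domain : domain G)
    (f_neq0 : forall n z, G z -> f_ n z != 0)
    (f_cvg : normally_cvg G f_ f) :
  ((forall n, left_regular G (f_ n)) ->
     sums_to (ord_dom G f) (left_ord G f) 0 \/ (forall z, G z -> f z = 0)) /\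
  ((forall n, right_regular G (f_ n)) ->
     sums_to (ord_dom G f) (right_ord G f) 0 \/ (forall z, G z -> f z = 0)).
Proof.
have oG : open G by case: G_domain.
split=> Hf; left; apply: sums_to0; apply: ord_wrt0 => // c eps eps0 cG fc.
  apply: (chain_integral0 oG f_neq0 f_cvg mul_left_mx_hurwitz _ _ (@q0_dsigma_coef R)) => // n z Gz.
    by have [] := Hf n z Gz.
  exact: left_regular_at (Hf n) Gz.
apply: (chain_integral0 oG f_neq0 f_cvg mul_right_mx_hurwitz _ _ (@dsigma_q0_coef R)) => // n z Gz.
  by have [] := Hf n z Gz.
exact: right_regular_at (Hf n) Gz.
Qed.
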